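(* Let $G$ be a (discrete) group. Consider (i) a topological dynamical system $(L;\psi)$ on a Stonean space $L$, (ii) an open compact group bundle $p\colon H\to L_{\mathrm{fix}}$, (iii) an open closed subgroup bundle $p|_U\colon U\to L_{\mathrm{fix}}$, and (iv) a relative cocycle $c\colon G\times L\to H$. Then the relative skew-product extension $q_c\colon(L\times_{L_{\mathrm{fix}}}H/U;\varphi_c)\to(L;\psi)$ is an open extension such that the union of all finitely generated, projective, closed, $T_{\varphi_c}$-invariant $\mathrm{C}(L)$-submodules of $\mathrm{C}(L\times_{L_{\mathrm{fix}}}H/U)$ is total in $\mathrm{C}(L\times_{L_{\mathrm{fix}}}H/U)$ (i.e., has dense linear span). In particular, $q_c$ has relative discrete spectrum.
   Context: All compact spaces are Hausdorff; $G$ is a fixed group with the discrete topology; function spaces are complex-valued. A Stonean space is an extremally disconnected compact space. A topological dynamical system $(K;\varphi)$ is a compact space $K$ with a group homomorphism $\varphi\colon G\to\mathrm{Homeo}(K)$, $t\mapsto\varphi_t$. An extension $q\colon(K;\varphi)\to(L;\psi)$ is a continuous surjection $q\colon K\to L$ with $q\circ\varphi_t=\psi_t\circ q$ for all $t$; it is open if $q$ is an open map. $(T_\varphi)_tf=f\circ\varphi_{t^{-1}}$ on $\mathrm{C}(K)$. $L_{\mathrm{fix}}$ is the Gelfand space of the unital commutative C*-algebra $\mathrm{fix}(T_\psi)=\{f\in\mathrm{C}(L):(T_\psi)_tf=f\ \forall t\}$, and $q_{\mathrm{fix}}\colon L\to L_{\mathrm{fix}}$ is the continuous surjection induced by $\mathrm{fix}(T_\psi)\hookrightarrow\mathrm{C}(L)$.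 $\mathrm{C}(K)$ is a $\mathrm{C}(L)$-module via $f\cdot g=(f\circ q)g$. An open extension $q$ over a Stonean space $L$ has relative discrete spectrum if $\mathrm{C}(K)$ is generated as a C*-algebra by its finitely generated, projective, closed, $T_\varphi$-invariant $\mathrm{C}(L)$-submodules. A compact group bundle over a compact space $M$ is a continuous surjection $p\colon H\to M$ from a compact space $H$ such that every fiber $H_m=p^{-1}(m)$ is a group and the maps $H\times_MH\to H$, $(x,y)\mapsto xy$ (with $H\times_MH=\{(x,y):p(x)=p(y)\}$), $x\mapsto x^{-1}$, and $m\mapsto1_{H_m}$ are continuous; it is open if $p$ is an open map. A closed subgroup bundle is a restriction $p|_U\colon U\to M$ to a closed subset $U\subseteq H$ such that $U_m=U\cap H_m$ is a subgroup of $H_m$ for all $m$; it is called open if the map $p|_U\colon U\to M$ is open. $H/U=\bigcup_mH_m/U_m$ carries the quotient topology; the class of $x$ is $xU$. A relative cocycle is a continuous map $c\colon G\times L\to H$ with $p(c(t,l))=q_{\mathrm{fix}}(l)$ and $c(t_1t_2,l)=c(t_1,\psi_{t_2}(l))c(t_2,l)$ for all $t,t_1,t_2\in G$, $l\in L$. The relative skew-product system is $L\times_{L_{\mathrm{fix}}}H/U$ (pairs $(l,xU)$ with $q_{\mathrm{fix}}(l)=p(x)$) with $(\varphi_c)_t(l,xU)=(\psi_t(l),c(t,l)xU)$, and $q_c(l,xU)=l$. *)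

(* Defs.v *)
From HB Require Import structures.
From mathcomp Require Import all_boot all_order all_algebra.
From mathcomp Require Import all_classical all_reals all_analysis.
From mathcomp Require Import complex.

Set Implicit Arguments.
Unset Strict Implicit.
Unset Printing Implicit Defensive.

Import Order.TTheory GRing.Theory Num.Theory.
Import numFieldNormedType.Exports.

Local Open Scope classical_set_scope.
Local Open Scope ring_scope.

(* Naming [R[i]] as a [numClosedFieldType] gives it the topology of its
   modulus. *)
Definition cplx (R : realType) : numClosedFieldType := R[i].

Definition open_map (X Y : topologicalType) (f : X -> Y) : Prop :=
  forall O : set X, open O -> open (f @` O).

Definition homeomorphism (X Y : topologicalType) (f : X -> Y) : Prop :=
  [/\ bijective f, continuous f & open_map f].

Definition compact_hausdorff (K : topologicalType) : Prop :=
  compact [set: K] /\ hausdorff_space K.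

Definition extremally_disconnected (K : topologicalType) : Prop :=
  forall O : set K, open O -> open (closure O).

Definition stonean (K : topologicalType) : Prop :=
  compact_hausdorff K /\ extremally_disconnected K.

Lemma conj_continuous (C : numClosedFieldType) : continuous (Num.conj : C -> C).
Proof.
move=> z; have Fz : Filter (nbhs z) by exact: nbhs_filter.
apply: (@cvgrPdist_lt C C C _ Fz (fun w => w^*) (z^*)).2 => e e0.
have : (id : C -> C) @ z --> z by exact: cvg_id.
move=> /(@cvgrPdist_lt C C C _ Fz id z).1 /(_ e e0).
by apply: filterS => w; rewrite -rmorphB norm_conjC.
Qed.

Definition cfun (R : realType) (K : topologicalType) : Type :=
  continuousType K (cplx R).

Section cfun.
Variables (R : realType) (K : topologicalType).
Local Notation C := (cplx R).
Implicit Types f g h : cfun R K.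

Lemma cfunP f g : f =1 g -> f = g.
Proof. by move=> fg; apply/continuousEP. Qed.

Definition cfun_of (f : K -> C) (cf : continuous f) : cfun R K := mkcts cf.

Lemma cfun_continuous f : continuous f.
Proof. exact: cts_fun. Qed.

Fact cfun_add_continuous f g : continuous (f \+ g).
Proof. by move=> x; apply: continuousD; exact: cfun_continuous. Qed.
Fact cfun_opp_continuous f : continuous (\- f).
Proof. by move=> x; apply: continuousN; exact: cfun_continuous. Qed.
Fact cfun_mul_continuous f g : continuous (f \* g).
Proof. by move=> x; apply: continuousM; exact: cfun_continuous. Qed.

Definition cfun_cst (a : C) : cfun R K := cfun_of (@cst_continuous K C a).
Definition cfun_add f g : cfun R K := cfun_of (@cfun_add_continuous f g).
Definition cfun_opp f : cfun R K := cfun_of (@cfun_opp_continuous f).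
Definition cfun_mul f g : cfun R K := cfun_of (@cfun_mul_continuous f g).
Definition cfun_scale (a : C) f : cfun R K := cfun_mul (cfun_cst a) f.

HB.instance Definition _ := Choice.copy (cfun R K) (continuousType K C).

Fact cfun_addA : associative cfun_add.
Proof. by move=> f g h; apply: cfunP => x; exact: addrA. Qed.
Fact cfun_addC : commutative cfun_add.
Proof. by move=> f g; apply: cfunP => x; exact: addrC. Qed.
Fact cfun_add0 : left_id (cfun_cst 0) cfun_add.
Proof. by move=> f; apply: cfunP => x; exact: add0r. Qed.
Fact cfun_addN : left_inverse (cfun_cst 0) cfun_opp cfun_add.
Proof. by move=> f; apply: cfunP => x; exact: addNr. Qed.

HB.instance Definition _ := GRing.isZmodule.Build (cfun R K) cfun_addA cfun_addC cfun_add0 cfun_addN.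

Fact cfun_mulA : associative cfun_mul.
Proof. by move=> f g h; apply: cfunP => x; exact: mulrA. Qed.
Fact cfun_mulC : commutative cfun_mul.
Proof. by move=> f g; apply: cfunP => x; exact: mulrC. Qed.
Fact cfun_mul1 : left_id (cfun_cst 1) cfun_mul.
Proof. by move=> f; apply: cfunP => x; exact: mul1r. Qed.
Fact cfun_mulD : left_distributive cfun_mul +%R.
Proof. by move=> f g h; apply: cfunP => x; exact: mulrDl. Qed.

HB.instance Definition _ :=
  GRing.Zmodule_isComPzRing.Build (cfun R K) cfun_mulA cfun_mulC cfun_mul1 cfun_mulD.

Fact cfun_scaleA a b f : cfun_scale a (cfun_scale b f) = cfun_scale (a * b) f.
Proof. by apply: cfunP => x; exact: mulrA. Qed.
Fact cfun_scale1 : left_id 1 cfun_scale.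
Proof. by move=> f; apply: cfunP => x; exact: mul1r. Qed.
Fact cfun_scaleDr : right_distributive cfun_scale +%R.
Proof. by move=> a f g; apply: cfunP => x; exact: mulrDr. Qed.
Fact cfun_scaleDl f : {morph cfun_scale^~ f : a b / a + b}.
Proof. by move=> a b; apply: cfunP => x; exact: mulrDl. Qed.

HB.instance Definition _ :=
  GRing.Zmodule_isLmodule.Build C (cfun R K) cfun_scaleA cfun_scale1 cfun_scaleDr cfun_scaleDl.

(* The topology of the sup norm; see [nbhs_cfunP]. *)
HB.instance Definition _ := Uniform.copy (cfun R K)
  (initial_topology (fun f : cfun R K => (f : K -> C) : {uniform K -> C})).

Fact cfun_conj_continuous f : continuous (fun x => (f x)^*).
Proof.
move=> x; apply: (@continuous_comp _ _ _ f Num.conj).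
  exact: cfun_continuous.
exact: conj_continuous.
Qed.

Definition cfun_conj f : cfun R K := cfun_of (@cfun_conj_continuous f).

Lemma nbhs_cfunP f (A : set (cfun R K)) :
  nbhs f A <->
  exists2 e : C, 0 < e & forall g, (forall x, `|f x - g x| < e) -> A g.
Proof.
have nbhsE : nbhs f A <-> exists2 B : set {uniform K -> C},
    nbhs ((f : K -> C) : {uniform K -> C}) B &
    forall g : cfun R K, B (g : K -> C) -> A g.
  split=> [[_ [[B oB <-] Bf BA]]|[B]].
    by exists B => //; exact: open_nbhs_nbhs.
  rewrite nbhsE => -[B' [oB' B'f] B'B BA].
  exists ((fun g : cfun R K => (g : K -> C)) @^-1` B'); split=> //.
    by exists B'.
  by move=> g /B'B; exact: BA.
rewrite nbhsE; split=> [[B /uniform_nbhs[E [entE EB]] BA]|[e e0 eA]].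
  move: entE; rewrite -entourage_ballE => -[e /= e0 eE].
  exists e => // g fg; apply/BA/EB => y _; apply: eE.
  exact: fg.
exists [set g : K -> C | forall x, `|f x - g x| < e].
  apply/uniform_nbhs; exists [set xy | `|xy.1 - xy.2| < e]; split.
    by rewrite -entourage_ballE; exists e.
  by move=> h /= fh x; exact: fh.
by move=> g; exact: eA.
Qed.

End cfun.

Record tds (G : groupType) (K : topologicalType) := TDS {
  tds_act :> G -> K -> K;
  tds_space : compact_hausdorff K;
  tds_homeo : forall t, homeomorphism (tds_act t);
  tds_actM : forall s t, tds_act (s * t)%g = tds_act s \o tds_act t
}.

Record extension (G : groupType) (K L : topologicalType)
    (phi : tds G K) (psi : tds G L) := Extension {
  ext_map :> continuousType K L;
  ext_surj : range ext_map = [set: L];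
  ext_equivariant : forall t, ext_map \o phi t = psi t \o ext_map
}.

Section koopman.
Variables (R : realType) (G : groupType) (K : topologicalType).
Variable phi : tds G K.

Fact koopman_continuous (t : G) (f : cfun R K) : continuous (f \o phi t^-1%g).
Proof.
move=> x; apply: continuous_comp; last exact: cfun_continuous.
by have [_ + _] := tds_homeo phi t^-1%g; apply.
Qed.

Definition koopman (t : G) (f : cfun R K) : cfun R K :=
  cfun_of (@koopman_continuous t f).

End koopman.

Section fixed.
Variables (R : realType) (G : groupType) (L : topologicalType).
Variable psi : tds G L.
Local Notation C := (cplx R).

Definition fixed : {pred cfun R L} :=
  fun f => `[< forall t, koopman psi t f = f >].

Lemma fixedP f : reflect (forall t, koopman psi t f = f) (f \in fixed).
Proof. exact: asboolP. Qed.

Fact fixed_subring : subring_closed fixed.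
Proof.
split; first by apply/fixedP => t; apply: cfunP.
  move=> f g /fixedP fF /fixedP gF; apply/fixedP => t.
  by rewrite -[in RHS](fF t) -[in RHS](gF t); exact: cfunP.
move=> f g /fixedP fF /fixedP gF; apply/fixedP => t.
by rewrite -[in RHS](fF t) -[in RHS](gF t); exact: cfunP.
Qed.

Fact fixed_submod : subsemimod_closed fixed.
Proof.
apply: GRing.submod_closed_semi; split; first by apply/fixedP => t; apply: cfunP.
move=> a f g /fixedP fF /fixedP gF; apply/fixedP => t.
by rewrite -[in RHS](fF t) -[in RHS](gF t); exact: cfunP.
Qed.

Record fix_algebra := FixAlgebra {
  fix_val : cfun R L;
  fix_valP : fix_val \in fixed
}.

HB.instance Definition _ := [isSub for fix_val].
HB.instance Definition _ := [Choice of fix_algebra by <:].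
HB.instance Definition _ :=
  GRing.SubChoice_isSubComPzRing.Build (cfun R L) fixed fix_algebra
    fixed_subring.
HB.instance Definition _ :=
  GRing.SubZmodule_isSubLmodule.Build C (cfun R L) fixed fix_algebra
    fixed_submod.

Definition fix_character (chi : fix_algebra -> C) : Prop :=
  [/\ scalar chi, {morph chi : f g / f * g} & chi 1 = 1].

(* The topology is that of pointwise convergence. *)
Definition gelfand_fix : Type :=
  set_type [set chi : {ptws fix_algebra -> C} | fix_character chi].
HB.instance Definition _ := Topological.on gelfand_fix.

Definition eval_fix (l : L) : {ptws fix_algebra -> C} := fun f => fix_val f l.

Lemma eval_fix_character l : eval_fix l \in [set chi | fix_character chi].
Proof. by apply/mem_set; split. Qed.

Definition q_fix (l : L) : gelfand_fix := SigSub (eval_fix_character l).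

Lemma q_fix_act t l : q_fix (psi t l) = q_fix l.
Proof.
apply/val_inj/funext => f /=; rewrite /eval_fix.
have /fixedP/(_ t^-1%g) := fix_valP f.
move=> /(congr1 (fun g : cfun R L => g l)) /=.
by rewrite /koopman /= /cfun_of /mkcts /= invgK.
Qed.

End fixed.

(* Only the values of [bmul] on [H x_M H] are meaningful. *)
Record group_bundle (M H : topologicalType) := GroupBundle {
  bproj :> H -> M;
  bmul : H -> H -> H;
  binv : H -> H;
  bone : M -> H;
  bundle_base : compact_hausdorff M;
  bundle_space : compact_hausdorff H;
  bproj_continuous : continuous bproj;
  bproj_surj : range bproj = [set: M];
  bproj_mul : forall x y, bproj x = bproj y -> bproj (bmul x y) = bproj x;
  bproj_inv : forall x, bproj (binv x) = bproj x;
  bproj_one : forall m, bproj (bone m) = m;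
  bmulA : forall x y z, bproj x = bproj y -> bproj y = bproj z ->
    bmul x (bmul y z) = bmul (bmul x y) z;
  bmul1x : forall x, bmul (bone (bproj x)) x = x;
  bmulx1 : forall x, bmul x (bone (bproj x)) = x;
  bmulVx : forall x, bmul (binv x) x = bone (bproj x);
  bmulxV : forall x, bmul x (binv x) = bone (bproj x);
  bmul_continuous : {within [set xy : H * H | bproj xy.1 = bproj xy.2],
    continuous (fun xy : H * H => bmul xy.1 xy.2)};
  binv_continuous : continuous binv;
  bone_continuous : continuous bone
}.

Record subgroup_bundle (M H : topologicalType) (p : group_bundle M H) :=
  SubgroupBundle {
    subbundle :> set H;
    subbundle_closed : closed subbundle;
    subbundle_one : forall m, subbundle (bone p m);
    subbundle_mul : forall x y, p x = p y ->
      subbundle x -> subbundle y -> subbundle (bmul p x y);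
    subbundle_inv : forall x, subbundle x -> subbundle (binv p x)
  }.

Definition subbundle_proj (M H : topologicalType) (p : group_bundle M H)
  (U : subgroup_bundle p) : set_type U -> M := p \o set_val.

Section coset.
Variables (M H : topologicalType) (p : group_bundle M H).
Variable U : subgroup_bundle p.
Local Notation "x * y" := (bmul p x y).
Local Notation "x ^-1" := (binv p x).
Implicit Types x y h : H.

Lemma bmulKV x y : p x = p y -> x * (x^-1 * y) = y.
Proof. by move=> pxy; rewrite bmulA ?bproj_inv// bmulxV pxy bmul1x. Qed.

Lemma bmulVK x y : p x = p y -> x^-1 * (x * y) = y.
Proof. by move=> pxy; rewrite bmulA ?bproj_inv// bmulVx pxy bmul1x. Qed.

Definition coset_eq x y : bool := `[< p x = p y /\ subbundle U (x^-1 * y) >].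

Fact coset_eqxx : reflexive coset_eq.
Proof.
move=> x; apply/asboolP; rewrite bmulVx.
by split=> //; exact: subbundle_one.
Qed.

Fact coset_eq_sym x y : coset_eq x y -> coset_eq y x.
Proof.
move=> /asboolP[pxy Uxy]; apply/asboolP; split=> //.
set a := x^-1 * y in Uxy.
have pa : p a = p x by rewrite bproj_mul ?bproj_inv.
have pyx : p (y^-1 * x) = p x by rewrite bproj_mul ?bproj_inv.
have aK : a * (y^-1 * x) = bone p (p a).
  by rewrite /a -bmulA ?bproj_inv ?bmulKV ?bmulVx ?pyx// -/a pa.
rewrite -(@bmulVK a (y^-1 * x)) ?pa ?pyx// aK -bproj_inv bmulx1.
exact: subbundle_inv.
Qed.

Fact coset_eqC : symmetric coset_eq.
Proof. by move=> x y; apply/idP/idP; exact: coset_eq_sym. Qed.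

Fact coset_eq_trans : transitive coset_eq.
Proof.
move=> y x z /asboolP[pxy Uxy] /asboolP[pyz Uyz]; apply/asboolP.
split; first exact: etrans pyz.
rewrite -(bmulKV pyz) bmulA ?bproj_inv ?bproj_mul ?bproj_inv//.
by apply: subbundle_mul => //; rewrite !bproj_mul ?bproj_inv.
Qed.

Definition coset_equiv := EquivRel coset_eq coset_eqxx coset_eqC coset_eq_trans.
Definition coset_space : Type := {eq_quot coset_equiv}%qT.

HB.instance Definition _ := Quotient.on coset_space.
HB.instance Definition _ :=
  Topological.copy coset_space (quotient_topology coset_space).

Definition coset_class x : coset_space := (\pi_coset_space x)%qT.

Lemma coset_classP x y :
  coset_class x = coset_class y <-> p x = p y /\ subbundle U (x^-1 * y).
Proof.
split=> [xy|xy].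
  by apply/asboolP/(@eqmodP _ coset_equiv x y).
by apply/(@eqmodP _ coset_equiv x y)/asboolP.
Qed.

Definition coset_proj (z : coset_space) : M := p (repr z).

Lemma coset_projE x : coset_proj (coset_class x) = p x.
Proof.
have /coset_classP[] // : coset_class (repr (coset_class x)) = coset_class x.
by rewrite /coset_class reprK.
Qed.

Definition coset_mul h (z : coset_space) : coset_space :=
  coset_class (h * repr z).

Lemma coset_mulE h x :
  p h = p x -> coset_mul h (coset_class x) = coset_class (h * x).
Proof.
move=> phx; rewrite /coset_mul; set r := repr _.
have /coset_classP[prx Urx] : coset_class r = coset_class x.
  by rewrite /coset_class reprK.
apply/coset_classP; rewrite !bproj_mul ?phx ?prx//; split=> //.
have -> : h * x = h * r * (r^-1 * x).
  by rewrite -bmulA ?bproj_mul ?bproj_inv ?bmulKV ?prx.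
by rewrite bmulVK// !bproj_mul ?bproj_inv ?phx ?prx.
Qed.

Lemma coset_proj_mul h (z : coset_space) :
  p h = coset_proj z -> coset_proj (coset_mul h z) = p h.
Proof. by move=> hz; rewrite coset_projE bproj_mul. Qed.

End coset.

Record rel_cocycle (R : realType) (G : groupType) (L H : topologicalType)
    (psi : tds G L) (p : group_bundle (gelfand_fix R psi) H) := RelCocycle {
  cocycle :> G -> L -> H;
  cocycle_continuous :
    continuous (fun tl : discrete_topology G * L => cocycle tl.1 tl.2);
  cocycle_proj : forall t l, p (cocycle t l) = q_fix R psi l;
  cocycleM : forall s t l,
    cocycle (s * t)%g l = bmul p (cocycle s (psi t l)) (cocycle t l)
}.

Section skew_product.
Variables (R : realType) (G : groupType) (L H : topologicalType).
Variables (psi : tds G L) (p : group_bundle (gelfand_fix R psi) H).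
Variables (U : subgroup_bundle p) (c : rel_cocycle p).

Definition skew_set : set (L * coset_space U) :=
  [set lz | q_fix R psi lz.1 = coset_proj lz.2].

Definition skew_product : Type := set_type skew_set.
HB.instance Definition _ := Topological.on skew_product.

Lemma skew_act_subproof (t : G) (w : skew_product) :
  (psi t (val w).1, coset_mul (c t (val w).1) (val w).2) \in skew_set.
Proof.
have wP : q_fix R psi (val w).1 = coset_proj (val w).2.
  exact: (set_mem (valP w)).
apply/mem_set => /=; rewrite /skew_set /=.
by rewrite q_fix_act coset_proj_mul cocycle_proj.
Qed.

Definition skew_act (t : G) (w : skew_product) : skew_product :=
  SigSub (skew_act_subproof t w).

Definition skew_proj (w : skew_product) : L := (val w).1.

End skew_product.

Section modules.
Variables (A : pzRingType) (V : lmodType A).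
Implicit Types S X : set V.

Definition submodule S : Prop :=
  S 0 /\ forall a u v, S u -> S v -> S (a *: u + v).

Definition lin_span X : set V := smallest submodule X.

Definition finitely_generated S : Prop :=
  exists2 X, finite_set X & S = lin_span X.

Definition linear_on (W : lmodType A) S (f : V -> W) : Prop :=
  forall a u v, S u -> S v -> f (a *: u + v) = a *: f u + f v.

(* Lifting property of the module [S] against surjections [g : M -> N]; maps
   out of [S] are maps out of [V], of which only the restriction to [S]
   matters. *)
Definition projective S : Prop :=
  forall (M N : lmodType A) (g : {linear M -> N}) (f : V -> N),
    range g = [set: N] -> linear_on S f ->
    exists2 h : V -> M, linear_on S h & forall v, S v -> g (h v) = f v.

End modules.

(* A copy of [C(K)], on which [C(L)] acts by [(f \o q) * g] without clashing
   with the scalar multiplication of [C(K)]. *)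
Definition pullback_module (R : realType) (K L : topologicalType)
  (q : continuousType K L) : Type := cfun R K.

Section pullback_module.
Variables (R : realType) (K L : topologicalType) (q : continuousType K L).
Local Notation V := (pullback_module R q).

Fact pullback_continuous (a : cfun R L) : continuous (a \o q).
Proof.
move=> x; apply: continuous_comp; first exact: cts_fun.
exact: cfun_continuous.
Qed.

Definition pullback (a : cfun R L) : cfun R K := cfun_of (@pullback_continuous a).

HB.instance Definition _ := GRing.Zmodule.copy V (cfun R K).

Definition pullback_scale (a : cfun R L) (f : V) : V :=
  pullback a * (f : cfun R K).

Fact pullback_scaleA a b f :
  pullback_scale a (pullback_scale b f) = pullback_scale (a * b) f.
Proof. by apply: cfunP => x; exact: mulrA. Qed.
Fact pullback_scale1 : left_id 1 pullback_scale.
Proof. by move=> f; apply: cfunP => x; exact: mul1r. Qed.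
Fact pullback_scaleDr : right_distributive pullback_scale +%R.
Proof. by move=> a f g; apply: cfunP => x; exact: mulrDr. Qed.
Fact pullback_scaleDl f : {morph pullback_scale^~ f : a b / a + b}.
Proof. by move=> a b; apply: cfunP => x; exact: mulrDl. Qed.

HB.instance Definition _ := GRing.Zmodule_isLmodule.Build (cfun R L) V
  pullback_scaleA pullback_scale1 pullback_scaleDr pullback_scaleDl.

End pullback_module.

Section spectrum.
Variables (R : realType) (G : groupType) (K L : topologicalType).
Variables (phi : tds G K) (psi : tds G L) (q : extension phi psi).

Definition koopman_invariant (S : set (cfun R K)) : Prop :=
  forall t f, S f -> S (koopman phi t f).

Definition fgp_submodule (S : set (cfun R K)) : Prop :=
  let S' : set (pullback_module R q) := S in
  [/\ submodule S', finitely_generated S', projective S', closed S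
    & koopman_invariant S].

Definition fgp_union : set (cfun R K) := \bigcup_(S in fgp_submodule) S.

Definition Cstar_subalgebra (B : set (cfun R K)) : Prop :=
  [/\ submodule B, forall f g, B f -> B g -> B (f * g),
      forall f, B f -> B (cfun_conj f) & closed B].

Definition rel_discrete_spectrum : Prop :=
  [/\ stonean L, open_map q & smallest Cstar_subalgebra fgp_union = setT].

End spectrum.

Arguments fgp_union R {G K L phi psi} q.
Arguments rel_discrete_spectrum R {G K L phi psi} q.

(* Main.v *)
(* Write M for [gelfand_fix R psi] and q for [q_fix]. The fibres of H over M are
   compact groups; their Haar means form a continuous family because p is open,
   so continuous functions on H have a fibrewise convolution. If w is a
   right-U-invariant idempotent for it, then the continuous functions f on the
   skew product with f(l, xU) = mean_y (f(l, yU) w(y^-1 x)) form a closed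
   C(L)-submodule, which is invariant by left invariance of the mean. On this
   submodule the integral operator with kernel w(y^-1 x) is the identity; an
   approximation of w(y^-1 x) by tensors \sum_i b_i(y) a_i(x) is therefore an
   invertible operator there, and this gives a finite dual basis: the submodule
   is finitely generated and projective.

   There are enough idempotents: a right-U-invariant g is close, over one point
   of M, to g * k * k for a symmetric approximate unit k; the spectral
   projection of the compact operator of convolution by k to its large
   eigenvalues is approximated by a polynomial in k, which is almost
   idempotent near that point. As L is Stonean, M has a base of clopen sets, so
   it can be cut off there, and Newton's iteration makes it an idempotent.
   Partitions of unity on L and M then show density. *)

Require Import Defs.
From HB Require Import structures.
From mathcomp Require Import all_boot all_order all_algebra.
From mathcomp Require Import all_classical all_reals all_analysis.
From mathcomp Require Import ring lra zify complex.

Set Implicit Arguments.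
Unset Strict Implicit.
Unset Printing Implicit Defensive.

Import Order.TTheory GRing.Theory Num.Theory.
Import numFieldNormedType.Exports.

Local Open Scope classical_set_scope.
Local Open Scope ring_scope.

(** * Approximate spectral projections *)

(** The obstacle is to pass from one fibre to a neighbourhood of it. Spectral projections of single
    fibres need not vary continuously with the base point, whereas a polynomial in [k] is a
    continuous function on the whole bundle. Hence projections are replaced by polynomials, and the
    spectral argument takes place in [{poly R}] with a positive functional, without Hilbert spaces.
    Exact idempotence is restored over a clopen set by an iteration that converges uniformly. How
    small the initial defect has to be depends on the sup norms of the almost idempotent and of [h],
    so these are bounded before the defect is chosen. Spectral estimates are in quadratic norm, but
    the iteration needs the sup norm; as a convolution is bounded by the product of two quadratic
    norms, the defect is first made quadratic. Finally, [k] has to be symmetric for the spectral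
    argument and right-[U]-invariant for the sake of the idempotent; built from the amount by which
    right translations move [g] itself, it is both. *)

Lemma discriminant_le (R : realFieldType) (a b c : R) :
  0 <= c -> (forall t, 0 <= a + 2 * t * b + t ^+ 2 * c) -> b ^+ 2 <= a * c.
Proof.
move=> c0 H; have [c00|cn0] := eqVneq c 0.
  have [->|b0] := eqVneq b 0; first by rewrite expr0n /= c00 mulr0.
  (* For [c = 0] the form is affine in [t], and this [t] gives it the value -1. *)
  have := H (- (a + 1) / (2 * b)); rewrite c00 mulr0 addr0.
  have -> : 2 * (- (a + 1) / (2 * b)) * b = - (a + 1) by field.
  by rewrite opprD addrA subrr sub0r oppr_ge0 ler10.
have cp : 0 < c by rewrite lt_neqAle eq_sym cn0.
have := H (- b / c).
have -> : a + 2 * (- b / c) * b + (- b / c) ^+ 2 * c = (a * c - b ^+ 2) / c by field.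
by rewrite pmulr_lge0 ?invr_gt0// subr_ge0.
Qed.

(** Otherwise [d] drops by more than [e] at every step and becomes negative. *)
Lemma archimedean_decrease (R : realType) (d : nat -> R) (e : R) :
  0 < e -> (forall j, 0 <= d j) -> exists j, d j - d j.+1 <= e.
Proof.
move=> e0 d0; apply: contrapT => /forallNP H.
have {}H j : d j.+1 <= d j - e by have /negP := H j; rewrite -ltNge; lra.
have K j : d j <= d 0%N - j%:R * e.
  elim: j => [|j IH]; first by rewrite mul0r subr0.
  by have := H j; rewrite -natr1 mulrDl mul1r; lra.
have := K (Num.truncn (d 0%N / e)).+1.
have := d0 (Num.truncn (d 0%N / e)).+1.
have := truncnS_gt (d 0%N / e); rewrite ltr_pdivrMr//; lra.
Qed.

Section spectral.
Variables (R : realType) (nu : {poly R} -> R).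
Hypothesis nuD : forall P Q, nu (P + Q) = nu P + nu Q.
Hypothesis nuZ : forall c P, nu (c%:P * P) = c * nu P.
Hypothesis nu_ge0 : forall P, 0 <= nu (P ^+ 2).
Implicit Types P Q F X u : {poly R}.

(** In the application [nu P] is the inner product of [P(k)k] with [k] on one fibre, and [n P] the
    quadratic norm of [P(k)k]. It is only a seminorm: [n P = 0] does not force [P = 0]. *)
Let n P := Num.sqrt (nu (P ^+ 2)).

Local Lemma nN P : nu (- P) = - nu P.
Proof. by have := nuZ (-1) P; rewrite polyCN mulN1r mulN1r. Qed.

Local Lemma sqr_n P : n P ^+ 2 = nu (P ^+ 2).
Proof. by rewrite sqr_sqrtr. Qed.

Local Lemma n_ge0 P : 0 <= n P.
Proof. exact: sqrtr_ge0. Qed.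

Local Lemma n_le P c : 0 <= c -> nu (P ^+ 2) <= c ^+ 2 -> n P <= c.
Proof. by move=> c0; rewrite -sqr_n ler_pXn2r ?nnegrE ?n_ge0. Qed.

Local Lemma n_CS P Q : nu (P * Q) <= n P * n Q.
Proof.
rewrite (le_trans (ler_norm _))// -(@ler_pXn2r _ 2%N) ?nnegrE ?mulr_ge0 ?n_ge0//.
rewrite -normrX ger0_norm ?sqr_ge0// exprMn !sqr_n.
apply: discriminant_le => // t; have := nu_ge0 (P + t%:P * Q).
have -> : (P + t%:P * Q) ^+ 2 = P ^+ 2 + (2 * t)%:P * (P * Q) + (t ^+ 2)%:P * Q ^+ 2.
  by rewrite polyCM rmorphXn/= polyC_natr; ring.
by rewrite !nuD !nuZ.
Qed.

Local Lemma n_triangle P Q : n (P + Q) <= n P + n Q.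
Proof.
apply: n_le; first by rewrite addr_ge0 ?n_ge0.
have -> : (P + Q) ^+ 2 = P ^+ 2 + (P * Q + P * Q) + Q ^+ 2 by ring.
by rewrite !nuD -!sqr_n; have := n_CS P Q; lra.
Qed.

Local Lemma nZ c P : 0 <= c -> n (c%:P * P) = c * n P.
Proof.
move=> c0; rewrite /n exprMn -rmorphXn/= nuZ sqrtrM ?sqr_ge0//.
by rewrite sqrtr_sqr ger0_norm.
Qed.

Local Lemma n0 : n 0 = 0.
Proof. by have := @nZ 0 0 (lexx 0); rewrite mulr0 mul0r. Qed.

Local Lemma n_opp P : n (- P) = n P.
Proof. by rewrite /n sqrrN. Qed.

Let opb P c := forall F, n (P * F) <= c * n F.

(** Multiplication by [P] is symmetric for the form [nu (P * Q)], so
    [n (P * F) ^+ 2 = nu (P ^+ 2 * F * F)] and Cauchy-Schwarz applies. *)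
Local Lemma opb_sqr P c : 0 <= c -> opb (P ^+ 2) c -> opb P (Num.sqrt c).
Proof.
move=> c0 H F; apply: n_le; first by rewrite mulr_ge0 ?sqrtr_ge0 ?n_ge0.
rewrite [X in _ <= X]exprMn sqr_sqrtr// exprMn.
have -> : P ^+ 2 * F ^+ 2 = (P ^+ 2 * F) * F by ring.
rewrite (le_trans (n_CS _ _))// expr2 mulrA ler_wpM2r ?n_ge0//; exact: H.
Qed.

Local Lemma opbX P k : opb P 1 -> opb (P ^+ k) 1.
Proof.
move=> H; elim: k => [|k IH] F; first by rewrite expr0 mul1r mul1r.
rewrite exprS -mulrA (le_trans (H _))// mul1r; exact: IH.
Qed.

(* [n (Q * u)] plays the part of the Hilbert-Schmidt norm of [X * Q]. When [X]
   has norm [l > r], the powers [(X / l) ^+ (2 * k)] converge to the spectral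
   projection onto the eigenspaces of [X] for [l] and [- l]; splitting it off
   decreases [n u ^+ 2] by at least [r ^+ 2]. *)
Lemma spectral_projection (r : R) (N : nat) X u :
  0 < r -> (forall Q F, n (X * Q * F) <= n (Q * u) * n F) ->
  n u ^+ 2 <= N%:R * r ^+ 2 ->
  forall d : R, 0 < d -> exists Q,
    [/\ n ((X * Q ^+ 2 - Q) * u) <= d, n (Q * u) <= 4 ^+ N
      & forall F, n (X * (1 - X * Q) * F) <= r * n F].
Proof.
move=> r0; elim: N X u => [|N IH] X u HS uN d d0.
  have u0 : n u = 0.
    by apply/eqP; rewrite -sqrf_eq0 eq_le sqr_ge0 andbT (le_trans uN)// mul0r.
  exists 0; split.
  - by rewrite expr0n /= mulr0 subrr mul0r n0 ltW.
  - by rewrite mul0r n0 expr0.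
  - move=> F; rewrite mulr0 subr0 (le_trans (HS _ _))// mul1r u0 mul0r.
    by rewrite mulr_ge0 ?n_ge0// ltW.
have [Xr|/existsNP[F0 /negP]] := pselect (opb X r).
  exists 0; split.
  - by rewrite expr0n /= mulr0 subrr mul0r n0 ltW.
  - by rewrite mul0r n0 exprn_ge0.
  - by move=> F; rewrite mulr0 subr0 mulr1.
rewrite -ltNge => rF0.
have nXF F : n (X * F) <= n u * n F by have := HS 1 F; rewrite mulr1 mul1r.
have nF0 : 0 < n F0.
  rewrite lt_neqAle n_ge0 andbT; apply: contraTneq rF0 => F00.
  by rewrite -leNgt -F00 mulr0 (le_trans (nXF _))// -F00 mulr0.
(* The supremum [l] of these quotients is the operator norm of [X]. *)
pose A := [set n (X * F) / n F | F in [set F | 0 < n F]].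
have hA : has_sup A.
  split; first by exists (n (X * F0) / n F0); exists F0.
  by exists (n u) => _ [F /= F0' <-]; rewrite ler_pdivrMr.
pose l := sup A.
have rl : r < l.
  apply: (@lt_le_trans _ _ (n (X * F0) / n F0)); first by rewrite ltr_pdivlMr.
  by apply: ub_le_sup; [exact: hA.2 | exists F0].
have l0 : 0 < l by exact: lt_trans rl.
have Xl : opb X l.
  move=> F; have := n_ge0 F; rewrite le_eqVlt => /predU1P[F00|Fp].
    by rewrite -F00 mulr0 (le_trans (nXF _))// -F00 mulr0.
  by rewrite -ler_pdivrMr//; apply: ub_le_sup; [exact: hA.2 | exists F].
have Xmin c : opb X c -> l <= c.
  move=> Xc; apply: ge_sup; first exact: hA.1.
  by move=> _ [F /= Fp <-]; rewrite ler_pdivrMr.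
pose l' : {poly R} := (l^-1)%:P.
pose S := l' * X.
have nl' P : n (l' * P) = l^-1 * n P by rewrite nZ// invr_ge0 ltW.
have S1 : opb S 1.
  by move=> F; rewrite /S -mulrA nl' mul1r ler_pdivrMl//; exact: Xl.
(* The powers [S ^+ (2 ^ j)] have norm at least 1: square roots, taken by [opb_sqr], lead back to
   [S], whose norm is 1 by the choice of [l]. *)
have Smin j : forall c, 0 <= c -> opb (S ^+ (2 ^ j)) c -> 1 <= c.
  elim: j => [|j IHj] c c0 Sc.
    have Xc : opb X (l * c).
      move=> F; have := Sc F; rewrite expn0 expr1 /S -mulrA nl' ler_pdivrMl//.
      by rewrite mulrA.
    by have := Xmin _ Xc; rewrite -{1}(mulr1 l) ler_pM2l.
  have /IHj : opb (S ^+ (2 ^ j)) (Num.sqrt c).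
    by apply: opb_sqr => //; rewrite -exprM -expnSr.
  by move=> /(_ (sqrtr_ge0 _)); rewrite -{1}sqrtr1 ler_sqrt.
pose b k := n (S ^+ k * u).
have b_dec k k' : (k <= k')%N -> b k' <= b k.
  move=> kk'; rewrite /b -(subnK kk') exprD -mulrA.
  by rewrite (le_trans (opbX _ S1 _))// mul1r.
(* By [HS] the norm of [S ^+ k.+1] is at most [b k / l], and it is at least 1 when [k.+1] is a power
   of 2. As [b] is nonincreasing, such [k] suffice. *)
have bl k : l <= b k.
  have k2 : (k <= (2 ^ k).-1)%N by rewrite -ltnS prednK ?expn_gt0// ltn_expl.
  apply: le_trans (b_dec _ _ k2).
  have : opb (S ^+ (2 ^ k)) (l^-1 * b (2 ^ k).-1).
    move=> F; rewrite -(prednK (expn_gt0 2 k)) exprS prednK ?expn_gt0// {1}/S.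
    by rewrite -!mulrA nl' ler_pM2l ?invr_gt0// mulrA HS.
  by move=> /Smin; rewrite mulr_ge0 ?invr_ge0 ?n_ge0 ?(ltW l0)// => /(_ isT); rewrite ler_pdivlMl// mulr1.
have Smm k k' : nu (S ^+ (k + k') * u ^+ 2) = nu (S ^+ k * u * (S ^+ k' * u)).
  by congr nu; rewrite exprD; ring.
have bE k : b k ^+ 2 = nu (S ^+ (k + k) * u ^+ 2) by rewrite Smm -expr2 sqr_n.
(* The defect of [s] enters that of the witness with the factor [(1 - w') ^+ 2 / l], where [1 - w']
   has norm at most 3, and may take half of [d]: 18 = 2 * 3 * 3. *)
pose eta := (d * l / 18) ^+ 2.
have eta0 : 0 < eta by rewrite exprn_gt0// !mulr_gt0// invr_gt0.
(* [S ^+ (2 * k)] is nearly idempotent as soon as [b] hardly changes between [2 * k - 1] and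
   [4 * k - 1]. *)
have [j jeta] := @archimedean_decrease _ (fun j => b (2 * 2 ^ j).-1 ^+ 2) eta eta0 (fun=> sqr_ge0 _).
pose k := (2 ^ j)%N; have k0 : (0 < k)%N by rewrite expn_gt0.
pose s := S ^+ (2 * k).-1; pose p := S * s.
have pE : p = S ^+ (2 * k) by rewrite /p /s -exprS prednK// muln_gt0.
have p1 : opb p 1 by rewrite pE; exact: opbX.
have p2 : opb (1 - p) 2.
  move=> F; rewrite mulrBl mul1r (le_trans (n_triangle _ _))// n_opp.
  by have := p1 F; lra.
have nps : n ((S * s ^+ 2 - s) * u) <= d * l / 18.
  apply: n_le; first by rewrite !mulr_ge0 ?invr_ge0// ltW.
  have -> : S * s ^+ 2 = S ^+ (4 * k).-1.
    rewrite /s -exprM -exprS; congr (_ ^+ _).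
    by move: (k) k0; clear; lia.
  apply: le_trans jeta; rewrite -/k expnS -/k.
  have -> : (2 * (2 * k)).-1 = (4 * k).-1 by rewrite mulnA.
  (* The mixed terms are both [b (3 * k).-1 ^+ 2], which is at least [b (4 * k).-1 ^+ 2]; so the
     square is bounded by the drop in [jeta]. *)
  have -> : ((S ^+ (4 * k).-1 - s) * u) ^+ 2 = (S ^+ (4 * k).-1 * u * (S ^+ (4 * k).-1 * u)) +
     - (S ^+ (4 * k).-1 * u * (s * u) + S ^+ (4 * k).-1 * u * (s * u)) + (s * u) * (s * u).
    ring.
  rewrite !nuD nN nuD -Smm -bE.
  have -> : nu (s * u * (s * u)) = b (2 * k).-1 ^+ 2 by rewrite bE /s -Smm.
  have -> : nu (S ^+ (4 * k).-1 * u * (s * u)) = b (3 * k).-1 ^+ 2.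
    rewrite bE /s -Smm; congr (nu (S ^+ _ * _)).
    by move: (k) k0; clear; lia.
  have : b (4 * k).-1 ^+ 2 <= b (3 * k).-1 ^+ 2.
    by rewrite ler_pXn2r ?nnegrE ?n_ge0// b_dec//; move: (k) k0; clear; lia.
  lra.
(* Removing the part of [u] under [p] lowers [n u ^+ 2] by at least [b k ^+ 2], which exceeds
   [r ^+ 2]; this is what the induction consumes. *)
pose X' := X * (1 - p); pose u' := u * (1 - p).
have HS' Q F : n (X' * Q * F) <= n (Q * u') * n F.
  have -> : X' * Q * F = X * (Q * (1 - p)) * F by rewrite /X'; ring.
  by rewrite (le_trans (HS _ _))// /u' -mulrA (mulrC (1 - p)).
have u'N : n u' ^+ 2 <= N%:R * r ^+ 2.
  have : n u' ^+ 2 = n u ^+ 2 - (b k ^+ 2 + b k ^+ 2) + b (2 * k)%N ^+ 2.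
    rewrite bE !addnn -mul2n -pE.
    rewrite !sqr_n /u' /b -pE -nuD -nN -!nuD; congr nu; ring.
  move=> ->; have : b (2 * k)%N ^+ 2 <= b k ^+ 2.
    by rewrite ler_pXn2r ?nnegrE ?n_ge0// b_dec//; move: (k) k0; clear; lia.
  have : r ^+ 2 <= b k ^+ 2.
    by rewrite ler_pXn2r ?nnegrE ?n_ge0 ?(ltW r0)// (le_trans (ltW rl)).
  by move: uN; rewrite -natr1 mulrDl mul1r; lra.
pose d' := Num.min 1 (d / 4).
have d'0 : 0 < d' by rewrite lt_min ltr01 divr_gt0.
have [Q' [Q'1 Q'2 Q'3]] := IH X' u' HS' u'N d' d'0.
pose w' := X' * Q'.
(* As [w' ^+ 2 - w'] has norm at most 1, [t = n (w' * F)] satisfies [t ^+ 2 <= t * n F + n F ^+ 2],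
   which forces [t <= 2 * n F]. *)
have w'3 : opb (1 - w') 3.
  move=> F; have : n (w' * F) <= 2 * n F.
    have H1 : n (w' * F) ^+ 2 <= n (w' * F) * n F + n F ^+ 2.
      rewrite sqr_n.
      have -> : (w' * F) ^+ 2 = w' * F * F + X' * (X' * Q' ^+ 2 - Q') * F * F by rewrite /w'; ring.
      rewrite nuD lerD ?n_CS// (le_trans (n_CS _ _))// expr2 ler_wpM2r ?n_ge0//.
      rewrite (le_trans (HS' _ _))// -{2}(mul1r (n F)) ler_wpM2r ?n_ge0//.
      by rewrite (le_trans Q'1)// ge_min lexx.
    rewrite leNgt; apply/negP => H2.
    by have := n_ge0 F; nra.
  by rewrite mulrBl mul1r => ?; rewrite (le_trans (n_triangle _ _))// n_opp; lra.
(* Multiplied by [X], this is [p + (1 - p) * w'], whose complement is [(1 - p) * (1 - w')]: what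
   remains of [X] is exactly what remains of [X']. *)
exists (l' * s + (1 - p) ^+ 2 * Q'); split.
- have -> : (X * (l' * s + (1 - p) ^+ 2 * Q') ^+ 2 - (l' * s + (1 - p) ^+ 2 * Q')) * u =
     l' * ((1 - w') * ((1 - w') * ((S * s ^+ 2 - s) * u))) + (1 - p) * ((X' * Q' ^+ 2 - Q') * u').
    rewrite /w' /u' /X' /p /S; ring.
  rewrite (le_trans (n_triangle _ _))// nl'.
  have h1 := w'3 ((1 - w') * ((S * s ^+ 2 - s) * u)).
  have h2 := w'3 ((S * s ^+ 2 - s) * u).
  have h3 := p2 ((X' * Q' ^+ 2 - Q') * u').
  have h4 : n ((X' * Q' ^+ 2 - Q') * u') <= d / 4.
    by rewrite (le_trans Q'1)// ge_min lexx orbT.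
  have h5 : l^-1 * n ((1 - w') * ((1 - w') * ((S * s ^+ 2 - s) * u))) <= d / 2.
    rewrite ler_pdivrMl//; lra.
  lra.
- rewrite mulrDl (le_trans (n_triangle _ _))//.
  have -> : l' * s * u = l' * (s * u) by ring.
  have -> : (1 - p) ^+ 2 * Q' * u = (1 - p) * (Q' * u') by rewrite /u'; ring.
  rewrite nl'.
  have h1 : n (s * u) <= n u by rewrite (le_trans (b_dec 0%N _ _))// /b expr0 mul1r.
  have h2 : n u <= N.+1%:R * r.
    rewrite -(@ler_pXn2r _ 2%N) ?nnegrE ?n_ge0 ?mulr_ge0 ?(ltW r0)//.
    rewrite (le_trans uN)// exprMn ler_wpM2r ?sqr_ge0//.
    by rewrite -natrX ler_nat -{1}(muln1 N.+1) expnS expn1 leq_mul2l.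
  have h3 : l^-1 * n (s * u) <= N.+1%:R.
    rewrite ler_pdivrMl// (le_trans h1)// (le_trans h2)// mulrC ler_wpM2r//.
    exact: ltW.
  have h4 := p2 (Q' * u').
  have h5 : N.+1%:R <= 2 * 4 ^+ N :> R.
    rewrite -!natrX -natrM ler_nat.
    by rewrite (leq_trans (ltn_expl N (isT : 1 < 4)%N))// leq_pmull.
  by rewrite exprS; lra.
- move=> F.
  have -> : X * (1 - X * (l' * s + (1 - p) ^+ 2 * Q')) * F = X' * (1 - X' * Q') * F.
    by rewrite /X' /p /S; ring.
  exact: Q'3.
Qed.

End spectral.

(** * Fibrewise Haar mean *)

Lemma compact_finite_cover (T : topologicalType) (A : set T) (Q : T -> set T) :
  compact A -> (forall b, A b -> nbhs b (Q b)) ->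
  exists s : seq T, {in s, forall b, A b} /\ forall y, A y -> exists2 b, b \in s & Q b y.
Proof.
move=> cA AQ.
(* Finite lists in [A] are directed by inclusion; the near-covering form of compactness for this
   filter yields one list that serves all points. *)
pose ok (s : seq T) := {in s, forall b, A b}.
pose F := filter_from ok (fun s => [set s' | ok s' /\ {subset s <= s'}]).
have FF : Filter F.
  apply: filter_from_filter; first by exists [::].
  move=> s t sA tA; exists (s ++ t).
    by move=> b; rewrite mem_cat => /orP[/sA|/tA].
  move=> u [uA stu]; split; split=> // b bs; apply: stu.
    by rewrite mem_cat bs.
  by rewrite mem_cat bs orbT.
have /compact_near_coveringP/(_ _ F (fun s y => exists2 b, b \in s & Q b y) FF) tube := cA.
have [x Ax|s sA sF] := tube.
  exists (Q x, [set s' | ok s' /\ {subset [:: x] <= s'}]).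
    split; first exact: AQ.
    by exists [:: x] => // b; rewrite inE => /eqP ->.
  by move=> [y s] /= [Qy [_ xs]]; exists x => //; apply: xs; rewrite inE.
by exists s; split; [exact: sA | move=> y Ay; exact: (sF s (conj sA (fun _ h => h)) y Ay)].
Qed.

Section haar.
Variables (R : realType) (M H : topologicalType) (p : group_bundle M H).
Local Notation "x ** y" := (bmul p x y) (at level 40, left associativity).
Local Notation inv := (binv p).
Local Notation one := (bone p).
Implicit Types (m : M) (x y z a b : H) (f g : H -> R) (s : seq H).

(** [bmul] is continuous on the fibre product only, so the arguments must eventually share a
    fibre. *)
Lemma cvg_bmul (T : Type) (F : set_system T) {FF : Filter F} (u v : T -> H) a b :
  p a = p b -> (\forall t \near F, p (u t) = p (v t)) ->
  u @ F --> a -> v @ F --> b -> (fun t => u t ** v t) @ F --> a ** b.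
Proof.
move=> ab uv ua vb.
have /subspace_continuousP/(_ (a, b) ab) /= H1 := @bmul_continuous _ _ p.
apply: (cvg_comp (fun t => (u t, v t)) (fun xy : H * H => xy.1 ** xy.2) _ H1).
have H2 : (fun t => (u t, v t)) @ F --> (a, b) by exact: cvg_pair.
move=> A /= /H2 HA; apply: filterS2 uv HA => t e; exact.
Qed.

Lemma cvg_binv (T : Type) (F : set_system T) {FF : Filter F} (u : T -> H) a :
  u @ F --> a -> inv \o u @ F --> inv a.
Proof. by move=> ua; apply: continuous_cvg => //; exact: binv_continuous. Qed.

Section param.
Variables (N : topologicalType) (th : N -> M).

(** Continuity on the pullback of the bundle along [th], stated for total functions by limits within
    the pullback. *)
Definition fiber_continuous (F : N -> H -> R) := forall n x, th n = p x ->
  (fun nx => F nx.1 nx.2) @ within [set nx | th nx.1 = p nx.2] (nbhs (n, x)) --> F n x.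

Lemma fiber_continuous_cvg F (T : Type) (G : set_system T) {FG : Filter G}
    (u : T -> N) (v : T -> H) n x : fiber_continuous F ->
  th n = p x -> (\forall t \near G, th (u t) = p (v t)) ->
  u @ G --> n -> v @ G --> x -> (fun t => F (u t) (v t)) @ G --> F n x.
Proof.
move=> cF nx uv un vx.
apply: (cvg_comp (fun t => (u t, v t)) (fun xy : N * H => F xy.1 xy.2) _ (cF _ _ nx)).
have H2 : (fun t => (u t, v t)) @ G --> (n, x) by exact: cvg_pair.
move=> A /= /H2 HA; apply: filterS2 uv HA => t e; exact.
Qed.

Hypothesis th_cont : continuous th.

(** A tube lemma for fibres: [H] is compact, and a point outside the fibre over [th n0] has a
    neighbourhood that misses all nearby fibres, because [M] is Hausdorff. *)
Lemma near_fiber (P : N -> H -> Prop) n0 :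
  (forall x, p x = th n0 ->
    \forall nx \near (n0, x), th nx.1 = p nx.2 -> P nx.1 nx.2) ->
  \forall n \near n0, forall x, p x = th n -> P n x.
Proof.
move=> H1.
have [cptH _] := bundle_space p; have [_ hsM] := bundle_base p.
have /compact_near_coveringP /(_ N (nbhs n0) (fun n x => p x = th n -> P n x) (nbhs_filter n0)) tube := cptH.
have H2 : forall x, [set: H] x ->
   \forall x' \near x & i \near n0, p x' = th i -> P i x'.
  move=> x _; have [px|px] := pselect (p x = th n0).
    have [[A B] /= [An Bx] AB] := H1 x px.
    by exists (B, A) => // -[x' i] /= [Bx' Ai] e; exact: (AB (i, x')).
  have /eqP := px; have := hsM; rewrite open_hausdorff => /[apply].
  move=> [[A B]] /= [/set_mem Ax /set_mem Bn] [oA oB] AB0.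
  exists (p @^-1` A, th @^-1` B) => /=.
    split; last exact/th_cont/open_nbhs_nbhs.
    exact/bproj_continuous/open_nbhs_nbhs.
  move=> [x' i] /= [Ax' Bi] e; exfalso.
  by have : (A `&` B) (th i) by [rewrite -e; split; rewrite // e]; rewrite (eqP AB0).
have := tube H2.
by apply: filterS => n /(_ _ I).
Qed.

End param.

Definition fcont m f := forall x, p x = m ->
  f @ within [set y | p y = m] (nbhs x) --> f x.

Lemma fcont_cvg m f (T : Type) (G : set_system T) {FG : Filter G} (v : T -> H) x :
  fcont m f -> p x = m -> (\forall t \near G, p (v t) = m) -> v @ G --> x ->
  f \o v @ G --> f x.
Proof.
move=> cf px pv vx; apply: cvg_comp (cf x px).
by move=> A /= /vx vA; apply: filterS2 pv vA => t e; exact.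
Qed.

Lemma within_fiber m x : \forall y \near within [set y | p y = m] (nbhs x), p y = m.
Proof. by apply: withinT; exact: nbhs_filter. Qed.

Lemma fcontW m f : continuous f -> fcont m f.
Proof. by move=> cf; move=> x _; apply: cvg_within_filter; exact: cf. Qed.

Lemma fcont_param (N : topologicalType) (th : N -> M) (F : N -> H -> R) n :
  fiber_continuous th F -> fcont (th n) (F n).
Proof.
move=> cF; move=> x px.
apply: (@fiber_continuous_cvg N th F _ _ _ (fun=> n) id n x cF) => //.
- by apply: filterS (within_fiber _ _) => y ->.
- exact: cvg_cst.
- exact: cvg_within.
Qed.

Lemma fcontD m f g : fcont m f -> fcont m g -> fcont m (f \+ g).
Proof.
move=> cf cg; move=> x px; apply: cvgD.
  exact: cf.
exact: cg.
Qed.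

Lemma fcontN m f : fcont m f -> fcont m (fun x => - f x).
Proof. by move=> cf x px; apply: cvgN; exact: cf. Qed.

Lemma fcontM m f g : fcont m f -> fcont m g -> fcont m (f \* g).
Proof.
move=> cf cg; move=> x px; apply: cvgM.
  exact: cf.
exact: cg.
Qed.

Lemma fcont_cst m (c : R) : fcont m (fun=> c).
Proof. by move=> x _; exact: cvg_cst. Qed.

Lemma fcontZ m c f : fcont m f -> fcont m (fun x => c * f x).
Proof. by move=> cf; apply: (@fcontM m (fun=> c) f _ cf); exact: fcont_cst. Qed.

Lemma fcont_sum m (I : Type) (r : seq I) (F : I -> H -> R) :
  (forall i, fcont m (F i)) -> fcont m (fun x => \sum_(i <- r) F i x).
Proof.
move=> cF; elim: r => [|i r IH].
  rewrite (_ : (fun _ => _) = (fun=> 0)); first exact: fcont_cst.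
  by apply/funext => x; rewrite big_nil.
rewrite (_ : (fun _ => _) = F i \+ (fun x => \sum_(i <- r) F i x)).
  exact: fcontD.
by apply/funext => x; rewrite big_cons.
Qed.

Lemma fcont_left m f a : p a = m -> fcont m f -> fcont m (fun y => f (a ** y)).
Proof.
move=> pa cf; move=> x px.
apply: (@fcont_cvg m f _ _ _ (fun y => a ** y) (a ** x) cf).
- by rewrite bproj_mul// pa.
- by apply: filterS (within_fiber m x) => y py; rewrite bproj_mul// pa.
- apply: cvg_bmul; rewrite ?pa ?px//; last 2 first.
  + exact: cvg_cst.
  + exact: cvg_within.
  by apply: filterS (within_fiber m x) => y ->.
Qed.

Lemma fcont_right m f a : p a = m -> fcont m f -> fcont m (fun y => f (y ** a)).
Proof.
move=> pa cf; move=> x px.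
apply: (@fcont_cvg m f _ _ _ (fun y => y ** a) (x ** a) cf).
- by rewrite bproj_mul// pa.
- by apply: filterS (within_fiber m x) => y py; rewrite bproj_mul// pa.
- apply: cvg_bmul; rewrite ?pa ?px//; last 2 first.
  + exact: cvg_within.
  + exact: cvg_cst.
  by apply: filterS (within_fiber m x) => y ->.
Qed.

Lemma fcont_inv m f : fcont m f -> fcont m (f \o inv).
Proof.
move=> cf; move=> x px.
apply: (@fcont_cvg m f _ _ _ inv (inv x) cf).
- by rewrite bproj_inv.
- by apply: filterS (within_fiber m x) => y; rewrite bproj_inv.
- exact: (cvg_binv (cvg_within _)).
Qed.

Lemma fcont_bounded m f : fcont m f ->
  exists2 B, 0 < B & forall x, p x = m -> `|f x| <= B.
Proof.
move=> cf; have [cptH hH] := bundle_space p.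
have : \forall B \near +oo, [set: H] `<=` (fun x => p x = m -> `|f x| <= B).
  have /compact_near_coveringP := cptH.
  apply => x _.
  have [px|px] := pselect (p x = m).
    have := cf _ px.
    move=> /cvgr_dist_lt/(_ 1 ltr01) H1.
    exists ([set y | p y = m -> `|f x - f y| < 1], [set B | `|f x| + 1 <= B]).
      by split; [exact: H1 | exact: nbhs_pinfty_ge; rewrite num_real].
    move=> [y B] /= [H2 H3] py; have {}H2 := H2 py.
    apply: le_trans H3; rewrite -(subrK (f x) (f y)) addrC.
    by rewrite (le_trans (ler_normD _ _))// lerD2l distrC ltW.
  have [_ hsM] := bundle_base p.
  have := hsM; rewrite open_hausdorff.
  move=> /(_ (p x) m) /(_ (introN eqP px)) [[A B]] /= [/set_mem Ax /set_mem Bn] [oA oB] AB0.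
  exists (p @^-1` A, setT) => /=.
    by split; [exact/bproj_continuous/open_nbhs_nbhs | exact: filterT].
  move=> [x' i] /= [Ax' _] e; exfalso.
  by have : (A `&` B) m by [rewrite -e; split; rewrite // e]; rewrite (eqP AB0).
move=> H1; near (@pinfty_nbhs R) => B.
by exists B => //; near: B; apply: filterS H1 => B H1 x px; exact: H1.
Unshelve. all: by end_near. Qed.

(** * Averages over finitely many translates *)

Definition lavg s f y := (\sum_(a <- s) f (a ** y)) / (size s)%:R.
Definition ravg t f y := (\sum_(b <- t) f (y ** b)) / (size t)%:R.
Definition in_fiber m s := s != [::] /\ {in s, forall a, p a = m}.

Lemma in_fiber_size m s : in_fiber m s -> 0 < (size s)%:R :> R.
Proof. by case: s => [[]//|a s _]; rewrite ltr0n. Qed.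

Lemma avg_bounds (I : Type) (s : seq I) (F : I -> R) c e : 0 < (size s)%:R :> R ->
  (forall i, `|F i - c| <= e) -> `|(\sum_(i <- s) F i) / (size s)%:R - c| <= e.
Proof.
move=> s0 H1.
have -> : (\sum_(i <- s) F i) / (size s)%:R - c = (\sum_(i <- s) (F i - c)) / (size s)%:R.
  rewrite big_split /= sumrN big_const_seq count_predT iter_addr_0 mulrDl; congr (_ + _).
  by rewrite mulNr -(mulr_natr c) mulfK// gt_eqF.
rewrite normrM normfV (gtr0_norm s0) ler_pdivrMr//.
rewrite (le_trans (ler_norm_sum _ _ _))//.
rewrite (le_trans (ler_sum _ (fun i _ => H1 i)))//.
by rewrite big_const_seq count_predT iter_addr_0 mulr_natr.
Qed.


Lemma lavg_cat m s t f y : in_fiber m s -> in_fiber m t -> p y = m ->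
  lavg t (lavg s f) y = lavg [seq a ** b | b <- t, a <- s] f y.
Proof.
move=> [s0 sm] [t0 tm] py; rewrite /lavg -mulr_suml -mulrA -invfM -natrM size_allpairs mulnC.
congr (_ / _); rewrite big_allpairs_dep /=.
rewrite [LHS]big_seq_cond [RHS]big_seq_cond; apply: eq_bigr => b /andP[bt _].
rewrite [LHS]big_seq_cond [RHS]big_seq_cond; apply: eq_bigr => a /andP[as_ _].
by rewrite bmulA ?(sm _ as_) ?(tm _ bt).
Qed.

Lemma in_fiber_cat m s t : in_fiber m s -> in_fiber m t ->
  in_fiber m [seq a ** b | b <- t, a <- s].
Proof.
move=> [s0 sm] [t0 tm]; split.
  by rewrite -size_eq0 size_allpairs muln_eq0 negb_or !size_eq0 s0 t0.
by move=> _ /allpairsPdep[b [a [bt as_ ->]]]; rewrite bproj_mul sm// tm.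
Qed.

Lemma lavg_ravg m s t f y : in_fiber m s -> in_fiber m t -> p y = m ->
  lavg s (ravg t f) y = ravg t (lavg s f) y.
Proof.
move=> [s0 sm] [t0 tm] py; rewrite /lavg /ravg -!mulr_suml mulrAC; congr (_ / _ / _).
rewrite exchange_big /=.
rewrite [LHS]big_seq_cond [RHS]big_seq_cond; apply: eq_bigr => b /andP[bt _].
rewrite [LHS]big_seq_cond [RHS]big_seq_cond; apply: eq_bigr => a /andP[as_ _].
by rewrite bmulA ?(sm _ as_) ?(tm _ bt).
Qed.

Lemma lavg_bounds m s f c e : in_fiber m s ->
  (forall y, p y = m -> `|f y - c| <= e) ->
  forall y, p y = m -> `|lavg s f y - c| <= e.
Proof.
move=> ms fc y py; have [s0 sm] := ms.
have -> : lavg s f y = (\sum_(a <- s) (if p a == m then f (a ** y) else c)) / (size s)%:R.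
  congr (_ / _); rewrite [LHS]big_seq_cond [RHS]big_seq_cond.
  by apply: eq_bigr => a /andP[as_ _]; rewrite sm// eqxx.
apply: avg_bounds; first exact: in_fiber_size ms.
move=> a; case: eqP => [pa|_]; first by apply: fc; rewrite bproj_mul pa.
by rewrite subrr normr0 (le_trans _ (fc y py)).
Qed.

Lemma ravg_bounds m s f c e : in_fiber m s ->
  (forall y, p y = m -> `|f y - c| <= e) ->
  forall y, p y = m -> `|ravg s f y - c| <= e.
Proof.
move=> ms fc y py; have [s0 sm] := ms.
have -> : ravg s f y = (\sum_(a <- s) (if p a == m then f (y ** a) else c)) / (size s)%:R.
  congr (_ / _); rewrite [LHS]big_seq_cond [RHS]big_seq_cond.
  by apply: eq_bigr => a /andP[as_ _]; rewrite sm// eqxx.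
apply: avg_bounds; first exact: in_fiber_size ms.
move=> a; case: eqP => [pa|_]; first by apply: fc; rewrite bproj_mul py// pa.
by rewrite subrr normr0 (le_trans _ (fc y py)).
Qed.

Lemma fcont_lavg m s f : in_fiber m s -> fcont m f -> fcont m (lavg s f).
Proof.
move=> [s0 sm] cf.
rewrite (_ : lavg s f = fun y => (size s)%:R^-1 *
   \sum_(a <- s) (if p a == m then f (a ** y) else 0)); last first.
  apply/funext => y; rewrite mulrC; congr (_ / _).
  rewrite [LHS]big_seq_cond [RHS]big_seq_cond.
  by apply: eq_bigr => a /andP[as_ _]; rewrite sm// eqxx.
apply: fcontZ; apply: fcont_sum => a; case: eqP => pa.
  exact: fcont_left.
exact: fcont_cst.
Qed.

(* [|f (z * y) - f (z * b)|] is bounded uniformly in [z], hence the cover also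
   serves every average of left translates of [f]. *)
Lemma fiber_cover m f (e : R) : fcont m f -> 0 < e -> exists s, in_fiber m s /\
  forall y, p y = m -> exists2 b, b \in s &
    forall z, p z = m -> `|f (z ** y) - f (z ** b)| <= e.
Proof.
move=> cf e0.
pose Q b y := forall z, p z = m -> p y = m -> `|f (z ** y) - f (z ** b)| <= e.
have H1 b : p b = m -> nbhs b [set y | Q b y].
  move=> pb.
  have := @near_fiber H (fun=> m) (@cst_continuous _ _ m)
    (fun y z => p y = m -> `|f (z ** y) - f (z ** b)| <= e) b.
  move=> /(_ _); have H2 : forall z, p z = m -> \forall yz \near (b, z),
      m = p yz.2 -> p yz.1 = m -> `|f (yz.2 ** yz.1) - f (yz.2 ** b)| <= e.
    move=> z pz; pose D := [set yz : H * H | m = p yz.2 /\ p yz.1 = m].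
    have W : \forall yz \near within D (nbhs (b, z)), D yz.
      by apply: withinT; exact: nbhs_filter.
    have c1 : fst @ within D (nbhs (b, z)) --> b.
      by apply: cvg_trans (cvg_app _ (cvg_within _)) _; exact: cvg_fst.
    have c2 : snd @ within D (nbhs (b, z)) --> z.
      by apply: cvg_trans (cvg_app _ (cvg_within _)) _; exact: cvg_snd.
    have d1 : (fun yz => f (yz.2 ** yz.1)) @ within D (nbhs (b, z)) --> f (z ** b).
      apply: (fcont_cvg cf (v := fun yz => yz.2 ** yz.1)).
      - by rewrite bproj_mul// pb.
      - by apply: filterS W => -[y z'] [/= e1 e2]; rewrite bproj_mul -e1.
      - apply: cvg_bmul; rewrite ?pb ?pz//.
        by apply: filterS W => -[y z'] [/= -> ->].
    have d2 : (fun yz => f (yz.2 ** b)) @ within D (nbhs (b, z)) --> f (z ** b).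
      apply: (fcont_cvg cf (v := fun yz => yz.2 ** b)).
      - by rewrite bproj_mul// pb.
      - by apply: filterS W => -[y z'] [/= e1 e2]; rewrite bproj_mul -e1.
      - apply: cvg_bmul; rewrite ?pb ?pz//; last exact: cvg_cst.
        by apply: filterS W => -[y z'] [/= -> _].
    have := cvgB d1 d2; rewrite subrr => /(_ (within_filter _ _))/cvgr0_norm_le/(_ e e0) H2.
    rewrite near_withinE in H2.
    by apply: filterS H2 => -[y z'] /= + e1 e2; apply; split.
  move=> /(_ H2); apply: filterS => y Qy z pz py; apply: Qy => //.
have [cptH _] := bundle_space p; have [_ hsM] := bundle_base p.
have cptF : compact [set y | p y = m].
  apply: (subclosed_compact _ cptH) => //.
  apply: (@closed_comp _ _ p [set m]) => [x _|]; first exact: bproj_continuous.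
  exact/accessible_closed_set1/hausdorff_accessible.
have [s [sm scov]] := compact_finite_cover cptF H1.
exists s; split.
  split=> //; have [b bs _] := scov (one m) (bproj_one p m).
  by apply: contraTneq bs => ->.
by move=> y py; have [b bs Qb] := scov y py; exists b => // z pz; exact: Qb.
Qed.

(* Averaging over the translations that move the cover of [fiber_cover] to a
   point where [g] is small decreases the oscillation by a fixed factor. *)
Lemma lavg_contract m f (e : R) : fcont m f -> 0 < e -> exists2 q : R, 0 <= q < 1 &
  forall s c d, in_fiber m s -> 4 * e <= d ->
    (forall y, p y = m -> c <= lavg s f y <= c + d) ->
    exists s' c', in_fiber m s' /\
      forall y, p y = m -> c' <= lavg s' f y <= c' + q * d.
Proof.
move=> cf e0; have [r [rm rcov]] := fiber_cover cf e0.
have r0 := in_fiber_size rm.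
have r1 : 1 <= (size r)%:R :> R by rewrite ler1n -(ltr0n R).
(* One of the [size r] terms is at most [c + d / 2 + e], hence at most [c + 3 * d / 4] instead of
   [c + d]; this lowers the average by [d / (4 * size r)]. *)
exists (1 - (4 * (size r)%:R)^-1).
  rewrite subr_ge0 invf_le1 ?mulr_gt0// gtrBl invr_gt0 mulr_gt0//= andbT; lra.
move=> s c d sm ed sc.
have d0 : 0 < d by rewrite (lt_le_trans _ ed)// mulr_gt0.
have [/existsNP[x0 /not_implyP[px0 /negP]]|] := pselect (~ forall x, p x = m -> c + d / 2 <= lavg s f x);
    last first.
  (* If the average never goes below the middle of its range, the oscillation is already halved and
     [s] is kept. *)
  move=> /contrapT H1; exists s, (c + d / 2); split=> // y py.
  rewrite H1//=; have /andP[_ H2] := sc y py; apply: le_trans H2 _.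
  rewrite -addrA lerD2l -lerBlDl.
  have -> : d - d / 2 = 2^-1 * d by field.
  rewrite ler_pM2r// lerBrDr -lerBrDl.
  have -> : 1 - 2^-1 = 2^-1 :> R by field.
  rewrite lef_pV2 ?posrE ?mulr_gt0//; lra.
rewrite -ltNge => gx0.
pose g := lavg s f.
(* Left multiplication by such an element moves [b] to the low point [x0], and every [y] is close to
   some [b]. *)
pose s1 := [seq x0 ** inv b | b <- r].
have s1m : in_fiber m s1.
  split; first by rewrite -size_eq0 size_map size_eq0 rm.1.
  by move=> _ /mapP[b br ->]; rewrite bproj_mul ?bproj_inv ?px0 ?(rm.2 _ br).
exists [seq a ** b | b <- s1, a <- s], c; split; first exact: in_fiber_cat.
move=> y py; rewrite -(lavg_cat _ sm s1m py) -/g.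
have gB a : a \in s1 -> c <= g (a ** y) <= c + d.
  by move=> a1; apply: sc; rewrite bproj_mul s1m.2.
have [b br rb] := rcov y py.
have gb : g (x0 ** inv b ** y) <= c + d / 2 + e.
  have pb := rm.2 b br.
  have H1 : `|g (x0 ** inv b ** y) - g x0| <= e.
    have {2}-> : x0 = x0 ** inv b ** b.
      by rewrite -bmulA ?bproj_inv ?pb// bmulVx pb -px0 bmulx1.
    have px : p (x0 ** inv b) = m by rewrite bproj_mul// bproj_inv pb.
    rewrite -(subr0 (_ - _)) /g /lavg -mulrBl -sumrB.
    have -> : \sum_(a <- s) (f (a ** (x0 ** inv b ** y)) - f (a ** (x0 ** inv b ** b))) =
        \sum_(a <- s) (if p a == m then f (a ** (x0 ** inv b) ** y) - f (a ** (x0 ** inv b) ** b) else 0).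
      rewrite [LHS]big_seq_cond [RHS]big_seq_cond; apply: eq_bigr => a /andP[as_ _].
      by rewrite (sm.2 _ as_) eqxx !bmulA ?bproj_mul ?bproj_inv ?(sm.2 _ as_) ?px0 ?pb.
    apply: avg_bounds; first exact: in_fiber_size sm.
    move=> a; rewrite subr0; case: eqP => [pa|_]; last by rewrite normr0 ltW.
    by apply: rb; rewrite bproj_mul// pa px.
  by have := ler_norm (g (x0 ** inv b ** y) - g x0); rewrite -/g in gx0; lra.
have s1r : (size s1)%:R = (size r)%:R :> R by rewrite size_map.
apply/andP; split.
  rewrite /lavg ler_pdivlMr ?s1r// -s1r mulr_natr.
  rewrite -(count_predT s1) -iter_addr_0 -big_const_seq.
  by rewrite !big_seq; apply: ler_sum => a /gB/andP[].
rewrite /lavg ler_pdivrMr ?s1r//.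
have -> : (c + (1 - (4 * (size r)%:R)^-1) * d) * (size r)%:R = (c + d) * (size r)%:R - d / 4.
  by field; rewrite gt_eqF.
rewrite big_map (big_rem b)//=.
have -> : (c + d) * (size r)%:R = (c + d) + \sum_(i <- rem b r) (c + d).
  rewrite big_const_seq count_predT iter_addr_0 size_rem//.
  rewrite -mulrS prednK ?mulr_natr// lt0n size_eq0; exact: rm.1.
have : \sum_(j <- rem b r) g (x0 ** inv j ** y) <= \sum_(j <- rem b r) (c + d).
  rewrite !big_seq; apply: ler_sum => a /mem_rem ar.
  by have /andP[] : c <= g (x0 ** inv a ** y) <= c + d by apply: gB; exact: map_f.
lra.
Qed.

(** The contraction applies as long as the oscillation exceeds [4 * (e / 8)], so finitely many
    rounds bring it down to [e / 2]. *)
Lemma lavg_approx m f (e : R) : fcont m f -> 0 < e -> exists s c,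
  in_fiber m s /\ forall y, p y = m -> `|lavg s f y - c| <= e.
Proof.
move=> cf e0; have e80 : 0 < e / 8 by rewrite divr_gt0.
have [q /andP[q0 q1] step] := lavg_contract cf e80.
have [B B0 fB] := fcont_bounded cf.
have m1 : in_fiber m [:: one m].
  by split=> // a; rewrite inE => /eqP ->; exact: bproj_one.
have K j : exists s c, in_fiber m s /\ forall y, p y = m ->
    c <= lavg s f y <= c + Num.max (e / 2) (q ^+ j * (2 * B)).
  elim: j => [|j [s [c [sm sc]]]].
    exists [:: one m], (- B); split=> // y py.
    have -> : lavg [:: one m] f y = f y.
      by rewrite /lavg big_seq1 divr1 -{1}py bmul1x.
    have := fB y py; rewrite ler_norml => /andP[-> fy] /=; rewrite expr0 mul1r.
    have H2 : B <= - B + 2 * B by lra.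
    by rewrite (le_trans fy)// (le_trans H2)// lerD2l le_max lexx orbT.
  have [H1|H1] := leP (q ^+ j * (2 * B)) (e / 2).
    exists s, c; split=> // y py; have := sc y py.
    by rewrite (max_idPl H1) => /andP[-> H2]; rewrite (le_trans H2)// lerD2l le_max lexx.
  have [|s' [c' [s'm s'c]]] := step s c _ sm _ sc.
    by rewrite le_max; apply/orP; left; lra.
  exists s', c'; split=> // y py; have /andP[-> H2] := s'c y py.
  rewrite (le_trans H2)// lerD2l (max_idPr (ltW H1)) exprS mulrA.
  by rewrite le_max lexx orbT.
have [j qj] : exists j, q ^+ j * (2 * B) <= e / 2.
  have : (fun j => q ^+ j * (2 * B)) @ \oo --> 0 * (2 * B).
    apply: cvgMl; apply: cvg_expr; rewrite ger0_norm//.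
  rewrite mul0r => /cvgr0_norm_le/(_ (e / 2)).
  case; first by rewrite divr_gt0.
  move=> j _ /(_ j (leqnn j)) /= H1; exists j.
  by rewrite (le_trans (ler_norm _)).
have [s [c [sm sc]]] := K j; exists s, c; split=> // y py.
have /andP[] := sc y py; rewrite (max_idPl qj) => H1 H2.
by rewrite ler_norml; apply/andP; split; lra.
Qed.

Lemma in_fiber_inv m s : in_fiber m s -> in_fiber m [seq inv a | a <- s].
Proof.
move=> [s0 sm]; split; first by rewrite -size_eq0 size_map size_eq0.
by move=> _ /mapP[a as_ ->]; rewrite bproj_inv sm.
Qed.

Lemma binvK x : inv (inv x) = x.
Proof.
have := @bmulVK _ _ p (inv x) x (bproj_inv p x); rewrite bmulVx.
have -> : one (p x) = one (p (inv (inv x))) by rewrite !bproj_inv.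
by rewrite bmulx1.
Qed.

Lemma binvM x y : p x = p y -> inv (x ** y) = inv y ** inv x.
Proof.
move=> pxy; have pm : p (x ** y) = p x by rewrite bproj_mul.
have pm' : p (inv y ** inv x) = p x by rewrite bproj_mul !bproj_inv.
have := @bmulVK _ _ p (x ** y) (inv y ** inv x); rewrite pm pm' => /(_ erefl) <-.
have -> : x ** y ** (inv y ** inv x) = one (p (inv (x ** y))).
  rewrite -bmulA ?pm' ?pxy// bmulKV ?bproj_inv// bmulxV.
  by rewrite pm.
by rewrite bmulx1.
Qed.

Lemma lavg_inv m s f y : in_fiber m s -> p y = m ->
  lavg s (f \o inv) y = ravg [seq inv a | a <- s] f (inv y).
Proof.
move=> [s0 sm] py; rewrite /lavg /ravg size_map big_map; congr (_ / _).
rewrite [LHS]big_seq_cond [RHS]big_seq_cond; apply: eq_bigr => a /andP[as_ _].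
by rewrite /= binvM// sm.
Qed.

Lemma ravg_approx m f (e : R) : fcont m f -> 0 < e -> exists s c,
  in_fiber m s /\ forall y, p y = m -> `|ravg s f y - c| <= e.
Proof.
move=> cf e0; have [s [c [sm sc]]] := lavg_approx (fcont_inv cf) e0.
exists [seq inv a | a <- s], c; split; first exact: in_fiber_inv.
move=> y py; rewrite -[y]binvK -(lavg_inv _ sm) ?bproj_inv//.
by apply: sc; rewrite bproj_inv.
Qed.

(** Left and right averages commute, so the twofold average at the unit is close to both
    constants. *)
Lemma avg_unique m f s t c d (e e' : R) : in_fiber m s -> in_fiber m t ->
  (forall y, p y = m -> `|lavg s f y - c| <= e) ->
  (forall y, p y = m -> `|ravg t f y - d| <= e') -> `|c - d| <= e + e'.
Proof.
move=> sm tm sc td; have p1 : p (one m) = m by exact: bproj_one.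
have H1 := lavg_bounds sm td p1.
have H2 := ravg_bounds tm sc p1.
rewrite -(subrKA (ravg t (lavg s f) (one m))) (le_trans (ler_normD _ _))//.
by rewrite lerD// ?(distrC c)// -(lavg_ravg _ sm tm p1).
Qed.

(* The value of the Haar integral over the fibre at [m]: the constant that the
   averages of translates of [f] approximate uniformly, see [mean_lavgP]. *)
Definition mean m f : R := inf [set u | exists s, in_fiber m s /\
  forall y, p y = m -> lavg s f y <= u].

Lemma mean_lavgP m f s c (e : R) : fcont m f -> in_fiber m s ->
  (forall y, p y = m -> `|lavg s f y - c| <= e) -> `|mean m f - c| <= e.
Proof.
move=> cf sm sc; rewrite /mean; set A := (X in inf X).
(* A right average serves as the common reference: its constant [d] is close to [c] and not much
   above any upper bound of any other left average. *)
have lb (e' : R) : 0 < e' -> lbound A (c - e - e' - e').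
  move=> e'0 u [s' [s'm s'u]]; have [t [d [tm td]]] := ravg_approx cf e'0.
  have H1 := avg_unique sm tm sc td.
  have p1 : p (one m) = m by exact: bproj_one.
  have := lavg_bounds s'm td p1; rewrite (lavg_ravg _ s'm tm p1).
  have H2 : ravg t (lavg s' f) (one m) <= u.
    rewrite /ravg ler_pdivrMr ?(in_fiber_size tm)// mulr_natr.
    rewrite -(count_predT t) -iter_addr_0 -big_const_seq.
    rewrite !big_seq; apply: ler_sum => a at_; apply: s'u.
    by rewrite bproj_mul ?p1// tm.2.
  by move: H1; rewrite !ler_norml => /andP[? ?] /andP[? ?]; lra.
have A1 : A (c + e).
  by exists s; split=> // y /sc; rewrite ler_norml => /andP[? ?]; lra.
have hA : has_inf A by split; [exists (c + e) | exists (c - e - 1 - 1); exact: lb].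
have H1 : inf A <= c + e by apply: ge_inf => //; exact: hA.2.
have H2 : c - e <= inf A.
  apply/ler_addgt0Pr => e' e'0; have e2 : 0 < e' / 2 by rewrite divr_gt0.
  have := lb_le_inf hA.1 (lb _ e2); lra.
by rewrite ler_norml; apply/andP; split; lra.
Qed.

Lemma mean_ravg m f (e : R) : fcont m f -> 0 < e -> exists2 t, in_fiber m t &
  forall y, p y = m -> `|ravg t f y - mean m f| <= e.
Proof.
move=> cf e0; have e4 : 0 < e / 4 by rewrite divr_gt0.
have [s [c [sm sc]]] := lavg_approx cf e4.
have [t [d [tm td]]] := ravg_approx cf e4.
exists t => // y py; have := td y py.
have := mean_lavgP cf sm sc; have := avg_unique sm tm sc td.
rewrite !ler_norml => /andP[? ?] /andP[? ?] /andP[? ?].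
by apply/andP; split; lra.
Qed.

Lemma mean_lavg m f (e : R) : fcont m f -> 0 < e -> exists2 s, in_fiber m s &
  forall y, p y = m -> `|lavg s f y - mean m f| <= e.
Proof.
move=> cf e0; have e4 : 0 < e / 4 by rewrite divr_gt0.
have [s [c [sm sc]]] := lavg_approx cf e4.
exists s => // y py; have := sc y py; have := mean_lavgP cf sm sc.
by rewrite !ler_norml => /andP[? ?] /andP[? ?]; apply/andP; split; lra.
Qed.

Lemma mean_ravgP m f t c (e : R) : fcont m f -> in_fiber m t ->
  (forall y, p y = m -> `|ravg t f y - c| <= e) -> `|mean m f - c| <= e.
Proof.
move=> cf tm tc; apply/ler_addgt0Pr => e' e'0.
have [s sm sc] := mean_lavg cf e'0.
by have := avg_unique sm tm sc tc; rewrite (addrC e).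
Qed.

(** * Invariance, linearity and positivity of the mean *)

Lemma le_distP (a b : R) : (forall e, 0 < e -> `|a - b| <= e) -> a = b.
Proof.
move=> H1; apply/eqP; rewrite -subr_eq0 -normr_le0.
by apply/ler_addgt0Pr => e e0; rewrite add0r; exact: H1.
Qed.

Lemma mean_eq m f g : (forall y, p y = m -> f y = g y) -> mean m f = mean m g.
Proof.
move=> fg; congr inf; apply/funext => u; apply/propext.
have K s y : in_fiber m s -> p y = m -> lavg s f y = lavg s g y.
  move=> [_ sm] py; congr (_ / _).
  rewrite [LHS]big_seq_cond [RHS]big_seq_cond; apply: eq_bigr => a /andP[as_ _].
  by apply: fg; rewrite bproj_mul sm.
by split=> -[s [sm su]]; exists s; split=> // y py; have := su y py; rewrite K.
Qed.

(** The mean can be read off from right averages, and these commute with left translations. *)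
Lemma mean_left m f a : fcont m f -> p a = m -> mean m (fun y => f (a ** y)) = mean m f.
Proof.
move=> cf pa; apply: le_distP => e e0.
have [t tm te] := mean_ravg cf e0.
apply: (mean_ravgP _ tm); first exact: fcont_left.
move=> y py; have -> : ravg t (fun y => f (a ** y)) y = ravg t f (a ** y).
  congr (_ / _).
  rewrite [LHS]big_seq_cond [RHS]big_seq_cond; apply: eq_bigr => b /andP[bt _].
  by rewrite bmulA ?pa ?py ?tm.2.
by apply: te; rewrite bproj_mul pa.
Qed.

Lemma mean_inv m f : fcont m f -> mean m (f \o inv) = mean m f.
Proof.
move=> cf; apply: le_distP => e e0.
have [s sm se] := mean_lavg (fcont_inv cf) e0.
rewrite distrC; apply: (mean_ravgP cf (in_fiber_inv sm)) => y py.
by rewrite -[y]binvK -(lavg_inv _ sm) ?bproj_inv//; apply: se; rewrite bproj_inv.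
Qed.

Lemma mean_right m f a : fcont m f -> p a = m -> mean m (fun y => f (y ** a)) = mean m f.
Proof.
move=> cf pa; rewrite -mean_inv; last exact: fcont_right.
have pia : p (inv a) = m by rewrite bproj_inv.
rewrite -[RHS](mean_inv cf) -[RHS](mean_left (fcont_inv cf) pia).
by apply: mean_eq => y py /=; rewrite binvM ?binvK ?pia.
Qed.

Lemma mean_cst m (c : R) : mean m (fun=> c) = c.
Proof.
apply: le_distP => e e0.
have m1 : in_fiber m [:: one m].
  by split=> // a; rewrite inE => /eqP ->; exact: bproj_one.
refine (@mean_lavgP m (fun=> c) _ c e (@fcont_cst m c) m1 _) => y py.
by rewrite /lavg big_seq1 divr1 subrr normr0 ltW.
Qed.

Lemma meanZ m c f : fcont m f -> mean m (fun x => c * f x) = c * mean m f.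
Proof.
move=> cf; apply: le_distP => e e0.
have e1 : 0 < e / (`|c| + 1) by rewrite divr_gt0// ltr_wpDl.
have [s sm se] := mean_lavg cf e1.
refine (@mean_lavgP m _ _ _ e (@fcontZ m c f cf) sm _) => y py.
have -> : lavg s (fun x => c * f x) y = c * lavg s f y by rewrite /lavg -mulr_sumr mulrA.
rewrite -mulrBr normrM.
have := se y py; rewrite ler_pdivlMr ?ltr_wpDl// => H1.
by rewrite (le_trans _ H1)// mulrC ler_wpM2l// lerDl.
Qed.

Lemma mean_lavg_eq m s f : fcont m f -> in_fiber m s -> mean m (lavg s f) = mean m f.
Proof.
move=> cf sm; apply: le_distP => e e0.
have [t tm te] := mean_ravg cf e0.
apply: (mean_ravgP (fcont_lavg sm cf) tm) => y py.
by rewrite -(lavg_ravg _ sm tm py); exact: lavg_bounds te _ py.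
Qed.

(** One list has to serve both functions: [s] is chosen for [f] and [t] for [lavg s g]; averaging
    again by [t] keeps [lavg s f] near its constant. *)
Lemma meanD m f g : fcont m f -> fcont m g -> mean m (f \+ g) = mean m f + mean m g.
Proof.
move=> cf cg; apply: le_distP => e e0; have e2 : 0 < e / 2 by rewrite divr_gt0.
have [s sm se] := mean_lavg cf e2.
have [t tm te] := mean_lavg (fcont_lavg sm cg) e2.
apply: (mean_lavgP (fcontD cf cg) (in_fiber_cat sm tm)) => y py.
rewrite -(lavg_cat _ sm tm py).
have -> : lavg t (lavg s (f \+ g)) y = lavg t (lavg s f) y + lavg t (lavg s g) y.
  rewrite /lavg -mulrDl -big_split; congr (_ / _); apply: eq_bigr => a _.
  by rewrite /= -mulrDl -big_split.
rewrite opprD addrACA (le_trans (ler_normD _ _))// [leRHS]splitr lerD//.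
  exact: lavg_bounds se _ py.
by have := te y py; rewrite mean_lavg_eq.
Qed.

Lemma meanN m f : fcont m f -> mean m (fun x => - f x) = - mean m f.
Proof. by move=> cf; rewrite -mulN1r -meanZ//; apply: mean_eq => y; rewrite mulN1r. Qed.

Lemma mean_sum m (I : Type) (r : seq I) (F : I -> H -> R) :
  (forall i, fcont m (F i)) ->
  mean m (fun x => \sum_(i <- r) F i x) = \sum_(i <- r) mean m (F i).
Proof.
move=> cF; elim: r => [|i r IH].
  by rewrite big_nil -[RHS](mean_cst m); apply: mean_eq => y _; rewrite big_nil.
rewrite big_cons -IH -meanD//; last exact: fcont_sum.
by apply: mean_eq => y _; rewrite big_cons.
Qed.

Lemma mean_ge0 m f : fcont m f -> (forall y, p y = m -> 0 <= f y) -> 0 <= mean m f.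
Proof.
move=> cf f0; apply/ler_addgt0Pr => e e0; have [s sm se] := mean_lavg cf e0.
have p1 : p (one m) = m by exact: bproj_one.
have : 0 <= lavg s f (one m).
  rewrite divr_ge0// big_seq sumr_ge0// => a as_; apply: f0.
  by rewrite bproj_mul sm.2.
by have := se _ p1; rewrite ler_norml => /andP[? ?]; lra.
Qed.

Lemma mean_le m f g : fcont m f -> fcont m g ->
  (forall y, p y = m -> f y <= g y) -> mean m f <= mean m g.
Proof.
move=> cf cg fg; rewrite -subr_ge0 -meanN// -meanD//; last exact: fcontN.
apply: mean_ge0 => [|y py]; last by rewrite /= subr_ge0; exact: fg.
by apply: fcontD => //; exact: fcontN.
Qed.

Lemma mean_norm_le m f (c : R) : fcont m f ->
  (forall y, p y = m -> `|f y| <= c) -> `|mean m f| <= c.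
Proof.
move=> cf fc; rewrite ler_norml -{1}(mean_cst m (- c)) -{2}(mean_cst m c).
apply/andP; split; apply: mean_le => //; try exact: fcont_cst.
  by move=> y /fc; rewrite ler_norml => /andP[].
by move=> y /fc; rewrite ler_norml => /andP[].
Qed.

(** Average over the inverses of the points of a cover: every [y] is close to some [b] of it, and
    then [f] at [b^-1 y] is at least half of its value at the unit. *)
Lemma mean_gt0 m f : fcont m f -> (forall y, p y = m -> 0 <= f y) ->
  0 < f (one m) -> 0 < mean m f.
Proof.
move=> cf f0 f1; have e0 : 0 < f (one m) / 2 by rewrite divr_gt0.
have [r [rm rcov]] := fiber_cover cf e0.
have irm := in_fiber_inv rm; have r0 := in_fiber_size rm.
rewrite -(mean_lavg_eq cf irm).
apply: (@lt_le_trans _ _ (f (one m) / 2 / (size r)%:R)); first by rewrite divr_gt0.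
rewrite -{1}(mean_cst m (_ / _)); apply: mean_le; [exact: fcont_cst|exact: fcont_lavg|].
move=> y py; rewrite /lavg size_map ler_pM2r ?invr_gt0//.
have [b br rb] := rcov y py; rewrite big_map (big_rem b)//=.
have pib : p (inv b) = m by rewrite bproj_inv rm.2.
have := rb (inv b) pib; rewrite bmulVx rm.2// ler_norml => /andP[H1 _].
have : 0 <= \sum_(a <- rem b r) f (inv a ** y).
  rewrite big_seq sumr_ge0// => a /mem_rem ar; apply: f0.
  by rewrite bproj_mul bproj_inv rm.2.
lra.
Qed.

End haar.

(** * Compact spaces and convolution *)

Section compact_hausdorff.
Variables (R : realType) (X : topologicalType).
Hypothesis hX : compact_hausdorff X.

Lemma tietze_compact (D : set X) (f : X -> R) : closed D ->
  {within D, continuous f} -> exists2 g : X -> R, continuous g & forall x, D x -> g x = f x.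
Proof.
move=> cD cf; have [cX hsX] := hX.
have cptD : compact D by apply: (subclosed_compact cD cX).
have [B [_ HB]] := compact_bounded (continuous_compact cf cptD).
have B0 : 0 < `|B| + 1 by rewrite ltr_wpDl.
have fB x : D x -> `|f x| <= `|B| + 1.
  by move=> Dx; apply: HB; [rewrite (le_lt_trans (ler_norm _))// ltrDl | exists x].
have [g [fg cg _]] := continuous_bounded_extension (compact_normal hsX cX) cD B0 cf fB.
by exists g => // x Dx; rewrite fg// inE.
Qed.

(** The functions are indexed by their centres, so that data chosen at a point [b] can be attached
    to [phi b]. *)
Lemma partition_of_unity (Q : X -> set X) : (forall b, nbhs b (Q b)) ->
  exists (s : seq X) (phi : X -> X -> R), [/\ forall b, continuous (phi b),
    forall b y, 0 <= phi b y, forall b y, phi b y != 0 -> Q b y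
    & forall y, \sum_(b <- s) phi b y = 1].
Proof.
move=> HQ; have [cX hsX] := hX.
have K b : exists f : X -> R, [/\ continuous f, forall y, 0 <= f y, f b = 1
    & forall y, f y != 0 -> Q b y].
  have c1 : closed [set b] by exact/accessible_closed_set1/hausdorff_accessible.
  have c2 : closed (~` (Q b)^°) by exact/open_closedC/open_interior.
  have c12 : ~` (Q b)^° `&` [set b] = set0.
    by rewrite -subset0 => y [/= nQ yb]; apply: nQ; rewrite yb; exact: HQ.
  have [f [cf f0 f1 f01]] := urysohn_ext_itv (compact_normal hsX cX) c2 c1 c12 (@ltr01 R).
  exists f; split=> //.
  - by move=> y; have /= := f01 (f y) (ex_intro2 _ _ y I erefl); rewrite in_itv/= => /andP[].
  - by apply: f1; exists b.
  - move=> y; apply: contra_neqP => nQ; apply: f0; exists y => //= Qy; apply: nQ.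
    exact: interior_subset Qy.
have {K}/choice[f Hf] := K.
have [|s [_ scov]] := @compact_finite_cover X setT (fun b => [set y | 0 < f b y]) cX.
  move=> b _; have [cf _ f1 _] := Hf b.
  have := cf b => /cvgr_gt; rewrite f1 => /(_ 0 ltr01); exact.
have S0 y : 0 < \sum_(b <- s) f b y.
  have [b bs fb] := scov y I; rewrite (big_rem b)//= ltr_wpDr//.
  by apply: sumr_ge0 => c _; have [_ + _ _] := Hf c.
exists s, (fun b y => f b y / \sum_(b <- s) f b y); split.
- move=> b y; apply: cvgM; first by have [cf _ _ _] := Hf b; exact: cf.
  apply: cvgV; first by rewrite gt_eqF.
  by apply: cvg_big => [|c _]; [exact: add_continuous|have [cf _ _ _] := Hf c; exact: cf].
- by move=> b y; have [_ H1 _ _] := Hf b; rewrite divr_ge0// ltW.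
- move=> b y; have [_ _ _ H1] := Hf b => H2; apply: H1.
  by apply: contraNneq H2 => ->; rewrite mul0r.
- by move=> y; rewrite -mulr_suml divff// gt_eqF.
Qed.

End compact_hausdorff.


Lemma hausdorff_pair (X Y : topologicalType) :
  hausdorff_space X -> hausdorff_space Y -> hausdorff_space (X * Y)%type.
Proof.
move=> hX hY [a b] [c d] cl; congr pair.
  apply: hX => A C aA cC.
  have [|[x y] [/= Ax Cx]] := cl (fst @^-1` A) (fst @^-1` C) _ (cvg_fst cC).
    exact: (cvg_fst aA).
  by exists x.
apply: hY => A C aA cC.
have [|[x y] [/= Ax Cx]] := cl (snd @^-1` A) (snd @^-1` C) _ (cvg_snd cC).
  exact: (cvg_snd aA).
by exists y.
Qed.

Lemma near_compact (X Y : topologicalType) (P : X -> Y -> Prop) (x0 : X) :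
  compact [set: Y] -> (forall y : Y, \forall xy \near (x0, y), P xy.1 xy.2) ->
  \forall x \near x0, forall y, P x y.
Proof.
move=> cY HP.
have /compact_near_coveringP/(_ X (nbhs x0) P (nbhs_filter x0)) tube := cY.
have H1 : forall y, [set: Y] y -> \forall y' \near y & x \near nbhs x0, P x y'.
  move=> y _; have [[A B] /= [Ax By] AB] := HP y.
  by exists (B, A) => // -[y' x] /= [By' Ax']; exact: (AB (x, y')).
have := tube H1; apply: filterS => x Px y; exact: (Px y I).
Qed.

(** Slices of [K] at nearby points are uniformly close, so a partition of unity interpolates the
    kernel between finitely many of its own slices. *)
Lemma tensor_approx (R : realType) (X Y : topologicalType) (K : X * Y -> R) (e : R) :
  compact_hausdorff X -> compact [set: Y] -> continuous K -> 0 < e ->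
  exists (s : seq X) (b : X -> X -> R), (forall c, continuous (b c)) /\
    forall x y, `|K (x, y) - \sum_(c <- s) b c x * K (c, y)| <= e.
Proof.
move=> hX cY cK e0.
have slice c : continuous (fun y => K (c, y)).
  move=> y; apply: (@cvg_comp _ _ _ (fun y => (c, y)) K _ (nbhs (c, y))) (cK (c, y)).
  by apply: cvg_pair; [exact: cvg_cst | exact: cvg_id].
pose Q c := [set x | forall y, `|K (x, y) - K (c, y)| <= e].
have HQ c : nbhs c (Q c).
  apply: near_compact => // y /=.
  have c2 : (fun xy => K (c, xy.2)) @ (c, y) --> K (c, y).
    by apply: (cvg_comp snd (fun y => K (c, y)) _ (slice c y)); exact: cvg_snd.
  have := cvgB (cK (c, y)) c2; rewrite subrr => /(_ (nbhs_filter _))/cvgr0_norm_le/(_ e e0).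
  by apply: filterS => -[x' y'].
have [s [phi [cphi phi0 phiQ phi1]]] := partition_of_unity R hX HQ.
exists s, phi; split=> // x y.
rewrite -[K (x, y)]mul1r -(phi1 x) mulr_suml -sumrB.
rewrite (le_trans (ler_norm_sum _ _ _))// -[leRHS]mul1r -(phi1 x) mulr_suml.
apply: ler_sum => c _; rewrite -mulrBr normrM ger0_norm//.
have [->|/phiQ Qc] := eqVneq (phi c x) 0; first by rewrite !mul0r.
by rewrite ler_wpM2l.
Qed.

Section conv.
Variables (R : realType) (M H : topologicalType) (p : group_bundle M H).
Local Notation "x ** y" := (bmul p x y) (at level 40, left associativity).
Local Notation inv := (binv p).
Local Notation one := (bone p).
Local Notation mean := (mean (R := R) p).
Implicit Types (m : M) (x y z a b : H) (f g h : H -> R).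

Let hH : compact_hausdorff H := bundle_space p.
Let hM : compact_hausdorff M := bundle_base p.

Lemma closed_fiber m : closed [set y | p y = m].
Proof.
apply: (@closed_comp _ _ p [set m]) => [x _|]; first exact: bproj_continuous.
exact/accessible_closed_set1/hausdorff_accessible/hM.2.
Qed.

Lemma fcont_extend m f : fcont p m f ->
  exists2 g : H -> R, continuous g & forall y, p y = m -> g y = f y.
Proof.
by move=> cf; apply: (tietze_compact hH (closed_fiber (m := m))); exact/subspace_continuousP.
Qed.

Hypothesis p_open : open_map p.

(** Openness of the bundle in the form used below: a point can be followed into the neighbouring
    fibres. *)
Lemma near_bproj x (A : set H) : nbhs x A -> \forall m \near p x, exists2 y, A y & p y = m.
Proof.
move=> xA; have : nbhs (p x) (p @` A°).
  by apply: open_nbhs_nbhs; split; [exact/p_open/open_interior | exists x].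
by apply: filterS => m [y Ay <-]; exists y => //; exact: interior_subset.
Qed.

(** * Continuous dependence of the mean on parameters, and Fubini's theorem *)

Section param.
Variables (N : topologicalType) (th : N -> M) (F : N -> H -> R).
Hypotheses (th_cont : continuous th) (F_cont : fiber_continuous p th F).

(* Openness of the bundle lets the translating elements follow the parameter. *)
Lemma near_lavg_translates n0 (s : seq H) (e : R) : 0 < e ->
  {in s, forall a, p a = th n0} -> exists2 g : H -> R, continuous g &
    (forall y, p y = th n0 -> g y = \sum_(a <- s) F n0 (a ** y)) /\
    \forall n \near n0, exists s' : seq H, [/\ size s' = size s,
      {in s', forall a, p a = th n}
      & forall y, p y = th n ->
          `|\sum_(a <- s') F n (a ** y) - g y| <= (size s)%:R * e].
Proof.
move=> e0; elim: s => [_|a s IH sm].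
  exists (fun=> 0); first exact: cst_continuous.
  split=> [y _|]; first by rewrite big_nil.
  by near=> n; exists [::]; split=> // y _; rewrite big_nil subrr normr0 mul0r.
have [|g cg [gE gN]] := IH; first by move=> b bs; apply: sm; rewrite inE bs orbT.
have pa : p a = th n0 by apply: sm; rewrite inE eqxx.
have cFa : fcont p (th n0) (fun y => F n0 (a ** y)).
  exact: (fcont_left pa (fcont_param (n := n0) F_cont)).
(* The comparison takes place on fibres other than the one over [th n0], so the translate is
   extended to all of [H]. *)
have [ga cga gaE] := fcont_extend cFa.
exists (fun y => ga y + g y); first by move=> y; apply: cvgD; [exact: cga | exact: cg].
split=> [y py|]; first by rewrite big_cons gaE// gE.
have cth1 : continuous (th \o fst : N * H -> M).
  by move=> [n x]; apply: (cvg_comp fst th _ (th_cont (x := n))); exact: cvg_fst.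
have near_a : \forall na \near (n0, a), forall y, p y = th na.1 ->
    p na.2 = th na.1 -> `|F na.1 (na.2 ** y) - ga y| <= e.
  apply: (near_fiber cth1 (P := fun na y => p na.2 = th na.1 -> `|F na.1 (na.2 ** y) - ga y| <= e)).
  move=> y /= py.
  pose D := [set w : N * H * H | th w.1.1 = p w.2 /\ p w.1.2 = th w.1.1].
  have W : \forall w \near within D (nbhs (n0, a, y)), D w.
    by apply: withinT; exact: nbhs_filter.
  have FW := within_filter D (nbhs_filter (n0, a, y)).
  have c1 : (fun w : N * H * H => w.1.1) @ within D (nbhs (n0, a, y)) --> n0.
    apply: cvg_trans (cvg_app _ (cvg_within _)) _.
    by apply: (cvg_comp fst fst); exact: cvg_fst.
  have c2 : (fun w : N * H * H => w.1.2) @ within D (nbhs (n0, a, y)) --> a.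
    apply: cvg_trans (cvg_app _ (cvg_within _)) _.
    by apply: (cvg_comp fst snd); [exact: cvg_fst|exact: cvg_snd].
  have c3 : snd @ within D (nbhs (n0, a, y)) --> y.
    by apply: cvg_trans (cvg_app _ (cvg_within _)) _; exact: cvg_snd.
  have d1 : (fun w => F w.1.1 (w.1.2 ** w.2)) @ within D (nbhs (n0, a, y)) --> F n0 (a ** y).
    apply: (fiber_continuous_cvg F_cont (v := fun w => w.1.2 ** w.2)) => //.
    - by rewrite bproj_mul ?pa.
    - by apply: filterS W => -[[n b] z] [/= e1 e2]; rewrite bproj_mul e2.
    - apply: cvg_bmul; rewrite ?pa ?py//.
      by apply: filterS W => -[[n b] z] [/= e1 e2]; rewrite e2.
  have d2 : (ga \o snd) @ within D (nbhs (n0, a, y)) --> ga y.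
    exact: (cvg_comp snd ga c3 (cga y)).
  have := cvgB d1 d2; rewrite gaE// subrr => /(_ FW)/cvgr0_norm_le/(_ e e0) H2.
  rewrite near_withinE in H2.
  by apply: filterS H2 => -[[n b] z] /= + e1 e2; apply; split.
have [[A1 A2] /= [A1n A2a] A12] := near_a.
have near_t : \forall n \near n0, exists2 a', A2 a' & p a' = th n.
  by have := near_bproj A2a; rewrite pa => /th_cont.
near=> n.
have [s' [ss' s'm s'g]] : exists s', [/\ size s' = size s, {in s', forall a, p a = th n}
  & forall y, p y = th n -> `|\sum_(a <- s') F n (a ** y) - g y| <= (size s)%:R * e].
  by near: n.
have [a' A2a' pa'] : exists2 a', A2 a' & p a' = th n by near: n.
have A1n' : A1 n by near: n.
exists (a' :: s'); split=> /=; first by rewrite ss'.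
  by move=> b; rewrite inE => /predU1P[->//|]; exact: s'm.
move=> y py; rewrite big_cons opprD addrACA (le_trans (ler_normD _ _))//.
rewrite -natr1 mulrDl mul1r [leRHS]addrC lerD//; [exact: (A12 (n, a')) | exact: s'g].
Unshelve. all: by end_near. Qed.

(** Translations that nearly flatten [F n0] are moved to the fibre over [th n], where they nearly
    flatten [F n] to the same constant; [mean_lavgP] then locates its mean. *)
Lemma mean_continuous : continuous (fun n => mean (th n) (F n)).
Proof.
move=> n0; apply/cvgrPdist_le => e e0.
have e3 : 0 < e / 3 by rewrite divr_gt0.
have cF n : fcont p (th n) (F n) by exact: fcont_param.
have [s sm sc] := mean_lavg (cF n0) e3.
have s0 := in_fiber_size R sm.
have [g cg [gE gN]] := near_lavg_translates e3 sm.2.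
have near_g : \forall n \near n0, forall y, p y = th n ->
    `|g y / (size s)%:R - mean (th n0) (F n0)| < e / 3 + e / 3.
  apply: (near_fiber th_cont (P := fun n y => `|g y / (size s)%:R - mean (th n0) (F n0)| < e / 3 + e / 3)).
  move=> y py.
  have : (fun ny : N * H => `|g ny.2 / (size s)%:R - mean (th n0) (F n0)|) @ (n0, y) -->
      `|g y / (size s)%:R - mean (th n0) (F n0)|.
    apply: cvg_norm; apply: cvgB; last exact: cvg_cst.
    by apply: cvgMl; apply: (cvg_comp snd g _ (cg y)); exact: cvg_snd.
  move=> /cvgr_lt/(_ (e / 3 + e / 3)).
  have -> : `|g y / (size s)%:R - mean (th n0) (F n0)| < e / 3 + e / 3.
    by rewrite gE//; apply: le_lt_trans (sc y py) _; rewrite ltrDl.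
  by move=> /(_ isT); apply: filterS.
near=> n.
have [s' [ss' s'm s'g]] : exists s', [/\ size s' = size s, {in s', forall a, p a = th n}
  & forall y, p y = th n -> `|\sum_(a <- s') F n (a ** y) - g y| <= (size s)%:R * (e / 3)].
  by near: n.
have gn : forall y, p y = th n ->
    `|g y / (size s)%:R - mean (th n0) (F n0)| < e / 3 + e / 3 by near: n.
have s'f : in_fiber p (th n) s'.
  by split=> //; rewrite -size_eq0 ss' size_eq0; exact: sm.1.
rewrite distrC; apply: (mean_lavgP (cF n) s'f) => y py.
have -> : lavg p s' (F n) y - mean (th n0) (F n0) =
   (\sum_(a <- s') F n (a ** y) - g y) / (size s)%:R + (g y / (size s)%:R - mean (th n0) (F n0)).
  by rewrite /lavg ss'; ring.
rewrite (le_trans (ler_normD _ _))// normrM normfV (gtr0_norm s0).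
have := s'g y py; have := gn y py.
move=> h1; rewrite mulrC -ler_pdivrMr// => h2; lra.
Unshelve. all: by end_near. Qed.

End param.

(* Both iterated means agree on tensors, hence on their uniform limits. *)
Lemma mean_fubini_continuous m (K : H * H -> R) : continuous K ->
  mean m (fun x => mean m (fun y => K (y, x))) = mean m (fun y => mean m (fun x => K (y, x))).
Proof.
move=> cK.
have c1 x : continuous (fun y => K (y, x)).
  move=> y; apply: (@cvg_comp _ _ _ (fun y => (y, x)) K _ (nbhs (y, x))) (cK (y, x)).
  by apply: cvg_pair; [exact: cvg_id | exact: cvg_cst].
have c2 y : continuous (fun x => K (y, x)).
  move=> x; apply: (@cvg_comp _ _ _ (fun x => (y, x)) K _ (nbhs (y, x))) (cK (y, x)).
  by apply: cvg_pair; [exact: cvg_cst | exact: cvg_id].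
have d1 : continuous (fun x => mean m (fun y => K (y, x))).
  apply: (@mean_continuous H (fun=> m) (fun x y => K (y, x))); first exact: cst_continuous.
  move=> x y _; apply: cvg_trans (cvg_app _ (cvg_within _)) _.
  apply: (@cvg_comp _ _ _ (fun xy : H * H => (xy.2, xy.1)) K _ (nbhs (y, x))) (cK (y, x)).
  by apply: cvg_pair; [exact: cvg_snd | exact: cvg_fst].
have d2 : continuous (fun y => mean m (fun x => K (y, x))).
  apply: (@mean_continuous H (fun=> m) (fun y x => K (y, x))); first exact: cst_continuous.
  move=> y x _; apply: cvg_trans (cvg_app _ (cvg_within _)) _.
  by rewrite (_ : (fun nx => _) = K); [exact: cK | apply/funext => -[]].
apply: le_distP => e e0; have e2 : 0 < e / 2 by rewrite divr_gt0.
have [s [b [cb Kb]]] := tensor_approx hH hH.1 cK e2.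
pose T := \sum_(c <- s) mean m (b c) * mean m (fun x => K (c, x)).
have h1 : `|mean m (fun x => mean m (fun y => K (y, x))) - T| <= e / 2.
  have -> : T = mean m (fun x => \sum_(c <- s) mean m (b c) * K (c, x)).
    rewrite mean_sum; last by move=> c; apply: fcontZ; exact/fcontW/c2.
    by apply: eq_bigr => c _; rewrite meanZ//; exact/fcontW/c2.
  rewrite -meanN -?meanD; first last.
  - by apply: fcont_sum => c; apply: fcontZ; exact/fcontW/c2.
  - by apply: fcontN; apply: fcont_sum => c; apply: fcontZ; exact/fcontW/c2.
  - exact/fcontW/d1.
  apply: mean_norm_le.
    apply: fcontD; first exact/fcontW/d1.
    by apply: fcontN; apply: fcont_sum => c; apply: fcontZ; exact/fcontW/c2.
  move=> x px /=.
  have -> : \sum_(c <- s) mean m (b c) * K (c, x) = mean m (fun y => \sum_(c <- s) K (c, x) * b c y).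
    rewrite mean_sum; last by move=> c; apply: fcontZ; exact/fcontW/cb.
    by apply: eq_bigr => c _; rewrite meanZ 1?mulrC//; exact/fcontW/cb.
  have cs : fcont p m (fun y => \sum_(c <- s) K (c, x) * b c y).
    by apply: fcont_sum => c; apply: fcontZ; exact/fcontW/cb.
  rewrite -meanN// -meanD; [|exact/fcontW/c1|exact: fcontN].
  apply: mean_norm_le; first by apply: fcontD; [exact/fcontW/c1|exact: fcontN].
  move=> y py /=; have := Kb y x.
  by under eq_bigr do rewrite mulrC.
have h2 : `|mean m (fun y => mean m (fun x => K (y, x))) - T| <= e / 2.
  have -> : T = mean m (fun y => \sum_(c <- s) mean m (fun x => K (c, x)) * b c y).
    rewrite mean_sum; last by move=> c; apply: fcontZ; exact/fcontW/cb.
    by apply: eq_bigr => c _; rewrite meanZ 1?mulrC//; exact/fcontW/cb.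
  have cs : fcont p m (fun y => \sum_(c <- s) mean m (fun x => K (c, x)) * b c y).
    by apply: fcont_sum => c; apply: fcontZ; exact/fcontW/cb.
  rewrite -meanN// -meanD; [|exact/fcontW/d2|exact: fcontN].
  apply: mean_norm_le; first by apply: fcontD; [exact/fcontW/d2|exact: fcontN].
  move=> y py /=.
  have -> : \sum_(c <- s) mean m (fun x => K (c, x)) * b c y =
      mean m (fun x => \sum_(c <- s) b c y * K (c, x)).
    rewrite mean_sum; last by move=> c; apply: fcontZ; exact/fcontW/c2.
    by apply: eq_bigr => c _; rewrite meanZ 1?mulrC//; exact/fcontW/c2.
  have cs' : fcont p m (fun x => \sum_(c <- s) b c y * K (c, x)).
    by apply: fcont_sum => c; apply: fcontZ; exact/fcontW/c2.
  rewrite -meanN// -meanD; [|exact/fcontW/c2|exact: fcontN].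
  apply: mean_norm_le; first by apply: fcontD; [exact/fcontW/c2|exact: fcontN].
  by move=> x px /=; exact: Kb.
rewrite -(subrKA T) (le_trans (ler_normD _ _))// [leRHS]splitr lerD//.
by rewrite distrC.
Qed.

(** The square of a fibre is closed, so Tietze's theorem reduces the claim to kernels that are
    continuous everywhere. *)
Lemma mean_fubini m (K : H -> H -> R) :
  {within [set yx | p yx.1 = m /\ p yx.2 = m], continuous (fun yx => K yx.1 yx.2)} ->
  mean m (fun x => mean m (fun y => K y x)) = mean m (fun y => mean m (fun x => K y x)).
Proof.
move=> cK; set D := (D in {within D, continuous _}) in cK.
have hHH : compact_hausdorff (H * H)%type.
  split; last exact: hausdorff_pair hH.2 hH.2.
  by rewrite -setXTT; exact: compact_setX hH.1 hH.1.
have cD : closed D.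
  apply: closedI.
    apply: (@closed_comp _ _ fst [set y | p y = m]) => [x _|]; first exact: cvg_fst.
    exact: closed_fiber.
  apply: (@closed_comp _ _ snd [set y | p y = m]) => [x _|]; first exact: cvg_snd.
  exact: closed_fiber.
have [g cg gK] := tietze_compact hHH cD cK.
transitivity (mean m (fun x => mean m (fun y => g (y, x)))).
  by apply: mean_eq => x px; apply: mean_eq => y py; rewrite gK.
rewrite mean_fubini_continuous//.
by apply: mean_eq => y py; apply: mean_eq => x px; rewrite gK.
Qed.

(** * Fibrewise convolution *)

Definition bundle_conv f g x := mean (p x) (fun y => f y * g (inv y ** x)).

Local Notation conv := bundle_conv.

Lemma conv_integrand_continuous f g : continuous f -> continuous g ->
  fiber_continuous p p (fun x y => f y * g (inv y ** x)).
Proof.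
move=> cf cg x y pxy; set D := [set nx | _].
have W : \forall w \near within D (nbhs (x, y)), D w.
  by apply: withinT; exact: nbhs_filter.
have FW := within_filter D (nbhs_filter (x, y)).
have c1 : fst @ within D (nbhs (x, y)) --> x.
  by apply: cvg_trans (cvg_app _ (cvg_within _)) _; exact: cvg_fst.
have c2 : snd @ within D (nbhs (x, y)) --> y.
  by apply: cvg_trans (cvg_app _ (cvg_within _)) _; exact: cvg_snd.
apply: cvgM; first exact: (cvg_comp snd f c2 (cf y)).
apply: (cvg_comp (fun w => inv w.2 ** w.1) g _ (cg _)).
apply: cvg_bmul => //; first by rewrite bproj_inv.
  by apply: filterS W => -[a b] /= ->; rewrite bproj_inv.
exact: (cvg_binv c2).
Qed.

Lemma conv_continuous f g : continuous f -> continuous g -> continuous (conv f g).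
Proof.
move=> cf cg; apply: (@mean_continuous H p (fun x y => f y * g (inv y ** x))).
  exact: bproj_continuous.
exact: conv_integrand_continuous.
Qed.

Lemma fcont_conv f g x : continuous f -> continuous g ->
  fcont p (p x) (fun y => f y * g (inv y ** x)).
Proof. by move=> cf cg; exact: (fcont_param (n := x) (conv_integrand_continuous cf cg)). Qed.

(** Left translation of the inner variable by [z^-1] brings the integrand into the form [K z y];
    then Fubini exchanges the means. *)
Lemma bundle_convA f g h : continuous f -> continuous g -> continuous h ->
  conv f (conv g h) = conv (conv f g) h.
Proof.
move=> cf cg ch; apply/funext => x; set m := p x.
pose K z y := f z * (g (inv z ** y) * h (inv y ** x)).
have fG z : p z = m -> fcont p m (fun y => g (inv z ** y) * h (inv y ** x)).
  move=> pz; apply: fcontM; first by apply: fcont_left; rewrite ?bproj_inv//; exact: fcontW.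
  apply: (@fcont_inv _ _ _ p m (fun y => h (y ** x))).
  by apply: fcont_right => //; exact: fcontW.
transitivity (mean m (fun z => mean m (fun y => K z y))).
  apply: mean_eq => z pz; rewrite /bundle_conv bproj_mul bproj_inv// pz.
  rewrite meanZ; last exact: fG.
  congr (_ * _); pose w := inv z ** x.
  have pw : p w = m by rewrite bproj_mul bproj_inv.
  have cF : fcont p m (fun y => g y * h (inv y ** w)) by rewrite -pw; exact: fcont_conv.
  rewrite -[LHS](@mean_left _ _ _ p m _ (inv z) cF) ?bproj_inv//.
  apply: mean_eq => y py; congr (_ * h _).
  rewrite binvM ?bproj_inv ?pz// binvK -bmulA ?bproj_inv ?bproj_mul ?bproj_inv ?pz ?py//.
  by rewrite bmulKV ?pz.
rewrite -mean_fubini; last first.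
  apply/subspace_continuousP => -[z y] /= [pz py]; set D := [set yx | _].
  have W : \forall w \near within D (nbhs (z, y)), D w.
    by apply: withinT; exact: nbhs_filter.
  have FW := within_filter D (nbhs_filter (z, y)).
  have c1 : fst @ within D (nbhs (z, y)) --> z.
    by apply: cvg_trans (cvg_app _ (cvg_within _)) _; exact: cvg_fst.
  have c2 : snd @ within D (nbhs (z, y)) --> y.
    by apply: cvg_trans (cvg_app _ (cvg_within _)) _; exact: cvg_snd.
  apply: cvgM; first exact: (cvg_comp fst f c1 (cf z)).
  apply: cvgM.
    apply: (cvg_comp (fun w => inv w.1 ** w.2) g _ (cg _)).
    apply: cvg_bmul => //; first by rewrite bproj_inv pz.
      by apply: filterS W => -[a b] /= [pa pb]; rewrite bproj_inv pa.
    exact: (cvg_binv c1).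
  apply: (cvg_comp (fun w => inv w.2 ** x) h _ (ch _)).
  apply: cvg_bmul => //; first by rewrite bproj_inv.
    by apply: filterS W => -[a b] /= [pa pb]; rewrite bproj_inv.
    exact: (cvg_binv c2).
  exact: cvg_cst.
apply: mean_eq => y py; rewrite /bundle_conv py mulrC -meanZ; last first.
  by rewrite -py; exact: fcont_conv.
by apply: mean_eq => z pz; rewrite /K; ring.
Qed.

Lemma bundle_conv_inv f g : continuous f -> continuous g ->
  conv f g \o inv = conv (g \o inv) (f \o inv).
Proof.
move=> cf cg; apply/funext => x; rewrite /bundle_conv /= bproj_inv; set m := p x.
have c1 : fcont p m (fun y => g (inv y) * f (inv (inv y ** x))).
  apply: fcontM; first by apply: fcont_inv; exact: fcontW.
  apply: (@fcont_inv _ _ _ p m (fun y => (f \o inv) (y ** x))).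
  by apply: fcont_right => //; apply: fcont_inv; exact: fcontW.
rewrite -[RHS](@mean_left _ _ _ p m _ x)//.
apply: mean_eq => y py; rewrite mulrC; congr (g _ * f _).
  by rewrite binvM// py.
by rewrite binvM ?bproj_inv ?bproj_mul ?py// binvK bmulVK// py.
Qed.

End conv.

(** * Convolution powers and idempotents *)

Lemma geometric_limit (R : realType) (X : topologicalType) (f : nat -> X -> R) (C : R) :
  (forall n, continuous (f n)) -> (forall n x, `|f n.+1 x - f n x| <= C / 2 ^+ n) ->
  exists2 F : X -> R, continuous F & forall n x, `|F x - f n x| <= 2 * C / 2 ^+ n.
Proof.
move=> cf fC.
have K n k x : `|f (n + k)%N x - f n x| <= 2 * C / 2 ^+ n - 2 * C / 2 ^+ (n + k).
  elim: k => [|k IH]; first by rewrite addn0 !subrr normr0.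
  rewrite -(subrKA (f (n + k)%N x)) (le_trans (ler_normD _ _))// addnS.
  have := fC (n + k)%N x; rewrite exprS.
  have -> : 2 * C / (2 * 2 ^+ (n + k)) = C / 2 ^+ (n + k).
    by rewrite -mulf_div divff// mul1r.
  have E : 2 * C / 2 ^+ (n + k) = 2 * (C / 2 ^+ (n + k)) by rewrite mulrA.
  by move: IH; rewrite E; lra.
have C0 (x : X) : 0 <= C by have := fC 0%N x; rewrite expr0 divr1; apply: le_trans.
have e0 n (x : X) : 0 <= 2 * C / 2 ^+ n by rewrite divr_ge0 ?exprn_ge0 ?mulr_ge0 ?(C0 x).
have K2 n m (x : X) : f n x - 2 * C / 2 ^+ n <= f m x + 2 * C / 2 ^+ m.
  have [nm|/ltnW nm] := leqP n m.
    have := K n (m - n)%N x; rewrite subnKC// ler_norml => /andP[h _].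
    by move: h (e0 m x) => {C0 e0}; lra.
  have := K m (n - m)%N x; rewrite subnKC// ler_norml => /andP[_ h].
  by move: h (e0 n x) => {C0 e0}; lra.
(* By [K2] the intervals of radius [2 * C / 2 ^+ n] around [f n x] meet pairwise, so the infimum of
   their upper ends lies in all of them. *)
clear C0 e0; pose F x := inf [set f n x + 2 * C / 2 ^+ n | n in setT].
have F1 n x : `|F x - f n x| <= 2 * C / 2 ^+ n.
  have h : has_inf [set f n x + 2 * C / 2 ^+ n | n in setT].
    split; first by exists (f 0%N x + 2 * C / 2 ^+ 0); exists 0%N.
    by exists (f 0%N x - 2 * C / 2 ^+ 0) => _ [m _ <-]; exact: K2.
  have h1 : F x <= f n x + 2 * C / 2 ^+ n by apply: (ge_inf h.2); exists n.
  have h2 : f n x - 2 * C / 2 ^+ n <= F x.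
    by apply: lb_le_inf; [exact: h.1 | move=> _ [m _ <-]; exact: K2].
  by rewrite ler_norml; apply/andP; split; lra.
exists F => // x; apply/cvgrPdist_le => e e0'.
have [n ne] : exists n, 2 * C / 2 ^+ n <= e / 3.
  have : (fun n => 2 * C * 2^-1 ^+ n) @ \oo --> 2 * C * 0.
    by apply: cvgMr; apply: cvg_expr; rewrite ger0_norm// invf_lt1// ltr1n.
  rewrite mulr0 => /cvgr0_norm_le/(_ (e / 3)).
  case; first by rewrite divr_gt0.
  by move=> n _ /(_ n (leqnn n)) /= H1; exists n; rewrite (le_trans (ler_norm _))// -exprVn.
have e30 : 0 < e / 3 by rewrite divr_gt0.
have := cf n x => /cvgrPdist_le/(_ (e / 3) e30); apply: filterS => y fxy.
have h1 := F1 n x; have h2 := F1 n y.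
by move: h1 h2 fxy; rewrite !ler_norml => /andP[? ?] /andP[? ?] /andP[? ?]; apply/andP; split; lra.
Qed.

Section conv_algebra.
Variables (R : realType) (M H : topologicalType) (p : group_bundle M H).
Hypothesis p_open : open_map p.
Local Notation "x ** y" := (bmul p x y) (at level 40, left associativity).
Local Notation inv := (binv p).
Local Notation one := (bone p).
Local Notation mean := (mean (R := R) p).
Local Notation conv := (bundle_conv (R := R) p).
Implicit Types (m : M) (x y z a b : H) (f g h k : H -> R).

Definition fnorm m f := Num.sqrt (mean m (fun y => f y ^+ 2)).

Lemma fcont_sqr m f : fcont p m f -> fcont p m (fun y => f y ^+ 2).
Proof. by move=> cf; apply: (fcontM cf cf). Qed.

Lemma sqr_fnorm m f : fcont p m f -> fnorm m f ^+ 2 = mean m (fun y => f y ^+ 2).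
Proof.
move=> cf; rewrite sqr_sqrtr// mean_ge0//; first exact: fcont_sqr.
by move=> y _; exact: sqr_ge0.
Qed.

Lemma fnorm_ge0 m f : 0 <= fnorm m f.
Proof. exact: sqrtr_ge0. Qed.

Lemma mean_CS m f g : fcont p m f -> fcont p m g ->
  `|mean m (fun y => f y * g y)| <= fnorm m f * fnorm m g.
Proof.
move=> cf cg.
rewrite -(@ler_pXn2r _ 2%N) ?nnegrE ?mulr_ge0 ?fnorm_ge0// -normrX.
rewrite ger0_norm ?sqr_ge0// exprMn !sqr_fnorm//.
apply: discriminant_le; first by apply: mean_ge0; [exact: fcont_sqr | move=> *; exact: sqr_ge0].
move=> t; have ctg := @fcontZ _ _ _ p m t g cg.
have : 0 <= mean m (fun y => (f y + t * g y) ^+ 2).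
  by apply: mean_ge0; [exact: (fcont_sqr (fcontD cf ctg)) | move=> *; exact: sqr_ge0].
have -> : mean m (fun y => (f y + t * g y) ^+ 2) =
   mean m ((fun y => f y ^+ 2) \+ ((fun y => 2 * t * (f y * g y)) \+ (fun y => t ^+ 2 * g y ^+ 2))).
  by apply: mean_eq => y _ /=; ring.
have h1 := fcont_sqr cf; have h2 := @fcontZ _ _ _ p m (2 * t) _ (fcontM cf cg).
have h3 := @fcontZ _ _ _ p m (t ^+ 2) _ (fcont_sqr cg).
rewrite meanD//; last exact: fcontD.
by rewrite meanD// !meanZ ?addrA//; [exact: fcont_sqr | exact: (fcontM cf cg)].
Qed.

Lemma fnorm_le m f (c : R) : fcont p m f -> 0 <= c ->
  (forall y, p y = m -> `|f y| <= c) -> fnorm m f <= c.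
Proof.
move=> cf c0 fc; rewrite -(@ler_pXn2r _ 2%N) ?nnegrE ?fnorm_ge0// sqr_fnorm//.
rewrite -[leRHS](mean_cst p m); apply: mean_le; [exact: fcont_sqr|exact: fcont_cst|].
by move=> y /fc fy; rewrite -(real_normK (num_real (f y))) ler_pXn2r ?nnegrE.
Qed.

(** Cauchy-Schwarz, as inversion and right translation preserve the quadratic norm of [g]. This is
    the passage from quadratic to uniform bounds. *)
Lemma conv_fnorm f g x : continuous f -> continuous g ->
  `|conv f g x| <= fnorm (p x) f * fnorm (p x) g.
Proof.
move=> cf cg; set m := p x.
have c1 : fcont p m (fun y => g (inv y ** x)).
  apply: (@fcont_inv _ _ _ p m (fun y => g (y ** x))).
  by apply: fcont_right => //; exact: fcontW.
have -> : fnorm m g = fnorm m (fun y => g (inv y ** x)).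
  congr Num.sqrt; have cg2 := fcont_sqr (fcontW (p := p) (m := m) cg).
  rewrite -(mean_right cg2 (erefl m)) -mean_inv//.
  exact: (fcont_right (erefl m) cg2).
by apply: mean_CS => //; exact: fcontW.
Qed.

Lemma conv_sup f g x (c d : R) : continuous f -> continuous g -> 0 <= c -> 0 <= d ->
  (forall y, p y = p x -> `|f y| <= c) -> (forall y, p y = p x -> `|g y| <= d) ->
  `|conv f g x| <= c * d.
Proof.
move=> cf cg c0 d0 fc gd; rewrite (le_trans (conv_fnorm _ cf cg))//.
by rewrite ler_pM ?fnorm_ge0// fnorm_le//; exact: fcontW.
Qed.

Lemma convDl f f' g : continuous f -> continuous f' -> continuous g ->
  conv (f \+ f') g = conv f g \+ conv f' g.
Proof.
move=> cf cf' cg; apply/funext => x /=; rewrite -meanD; [|exact: fcont_conv..].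
by apply: mean_eq => y _ /=; ring.
Qed.

Lemma convDr f g g' : continuous f -> continuous g -> continuous g' ->
  conv f (g \+ g') = conv f g \+ conv f g'.
Proof.
move=> cf cg cg'; apply/funext => x /=; rewrite -meanD; [|exact: fcont_conv..].
by apply: mean_eq => y _ /=; ring.
Qed.

Lemma convZr (c : R) f g : continuous f -> continuous g ->
  conv f (fun x => c * g x) = (fun x => c * conv f g x).
Proof.
move=> cf cg; apply/funext => x /=; rewrite -meanZ; last exact: fcont_conv.
by apply: mean_eq => y _ /=; ring.
Qed.

Lemma convZl (c : R) f g : continuous f -> continuous g ->
  conv (fun x => c * f x) g = (fun x => c * conv f g x).
Proof.
move=> cf cg; apply/funext => x /=; rewrite -meanZ; last exact: fcont_conv.
by apply: mean_eq => y _ /=; ring.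
Qed.

Lemma conv0r f : conv f (fun=> 0) = (fun=> 0).
Proof.
by apply/funext => x; rewrite -[RHS](mean_cst p (p x)); apply: mean_eq => y _; rewrite mulr0.
Qed.

Section act.
Variable k : H -> R.
Hypothesis k_cont : continuous k.
Implicit Types P Q : {poly R}.

Definition convpow n : H -> R := iter n (conv^~ k) k.

(* The function [P(k)k], where the powers of [k] are convolution powers. *)
Definition act P : H -> R := fun x => \sum_(i < size P) P`_i * convpow i x.

Lemma act_wide P n : (size P <= n)%N -> act P = fun x => \sum_(i < n) P`_i * convpow i x.
Proof.
move=> sP; apply/funext => x; rewrite /act.
rewrite -(big_mkord xpredT (fun i => P`_i * convpow i x)).
rewrite -(big_mkord xpredT (fun i => P`_i * convpow i x)).
rewrite [RHS](big_cat_nat _ (n := size P))//=.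
have -> : \sum_(size P <= i < n) P`_i * convpow i x = 0.
  by rewrite big_nat_cond big1// => i /andP[/andP[h _] _]; rewrite nth_default// mul0r.
by rewrite addr0.
Qed.

Lemma actD P Q : act (P + Q) = act P \+ act Q.
Proof.
apply/funext => x /=; set n := maxn (size P) (size Q).
rewrite (@act_wide P n) ?leq_maxl// (@act_wide Q n) ?leq_maxr//.
rewrite (@act_wide _ n) ?(leq_trans (size_polyD _ _))// -big_split /=.
by apply: eq_bigr => i _; rewrite coefD mulrDl.
Qed.

Lemma actZ c P : act (c%:P * P) = fun x => c * act P x.
Proof.
apply/funext => x; rewrite (@act_wide _ (size P)); last first.
  by rewrite mul_polyC size_scale_leq.
by rewrite mulr_sumr; apply: eq_bigr => i _; rewrite coefCM mulrA.
Qed.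

Lemma act0 : act 0 = fun=> 0.
Proof. by apply/funext => x; rewrite /act size_poly0 big_ord0. Qed.

Lemma act1 : act 1 = k.
Proof. by apply/funext => x; rewrite /act size_poly1 big_ord1 coef1 mul1r. Qed.

Lemma actN P : act (- P) = fun x => - act P x.
Proof. by rewrite -mulN1r -polyCN actZ; apply/funext => x; rewrite mulN1r. Qed.

Lemma actB P Q x : act (P - Q) x = act P x - act Q x.
Proof. by rewrite actD /= actN. Qed.

Lemma convpow_continuous n : continuous (convpow n).
Proof. by elim: n => [//|n IH]; apply: conv_continuous. Qed.

Lemma act_continuous P : continuous (act P).
Proof.
move=> x; apply: cvg_big => [|i _]; first exact: add_continuous.
by apply: cvgMr; exact: convpow_continuous.
Qed.

Lemma actMX P : act (P * 'X) = conv (act P) k.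
Proof.
rewrite (@act_wide _ (size P).+1); last first.
  by rewrite (leq_trans (size_polyMleq _ _))// size_polyX addn2.
apply/funext => x; rewrite big_ord_recl coefMX eqxx mul0r add0r /conv.
under eq_bigr do rewrite /= coefMX /=.
have -> : mean (p x) (fun y => act P y * k (inv y ** x)) =
  mean (p x) (fun y => \sum_(i < size P) P`_i * (convpow i y * k (inv y ** x))).
  by apply: mean_eq => y _; rewrite /act mulr_suml; apply: eq_bigr => i _; rewrite mulrA.
rewrite mean_sum; last by move=> i; apply: fcontZ; apply: fcont_conv => //; exact: convpow_continuous.
by apply: eq_bigr => i _; rewrite meanZ//; apply: fcont_conv => //; exact: convpow_continuous.
Qed.

(** [act] carries one factor [k] of its own, as no unit for convolution is at hand; the product of
    two such functions carries two, whence ['X]. *)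
Lemma conv_act P Q : conv (act P) (act Q) = act ('X * P * Q).
Proof.
have cA := act_continuous.
elim/poly_ind: Q => [|Q c IH]; first by rewrite mulr0 act0 conv0r.
have -> : act (Q * 'X + c%:P) = conv (act Q) k \+ (fun x => c * k x).
  apply/funext => x; rewrite actD /= actMX; congr (_ + _).
  by rewrite -(mulr1 c%:P) actZ act1.
rewrite convDr//; first last.
- by move=> x; apply: cvgMr; exact: k_cont.
- exact: conv_continuous.
rewrite bundle_convA// IH convZr// -!actMX -actZ -actD; congr act; ring.
Qed.

Lemma act_inv P : k \o inv = k -> act P \o inv = act P.
Proof.
move=> kinv.
have kV n : convpow n \o inv = convpow n.
  elim: n => [//|n IH]; rewrite /= bundle_conv_inv//; last exact: convpow_continuous.
  rewrite -/(convpow n) IH kinv.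
  (* Inversion reverses the order of convolution, so it remains to see that [k] commutes with its
     powers. *)
  elim: n {IH} => [//|n IH].
  rewrite {1}/convpow /= -/(convpow n) bundle_convA//; last exact: convpow_continuous.
  by rewrite IH.
by apply/funext => x; apply: eq_bigr => i _; rewrite -[in RHS]kV.
Qed.

End act.

Variable U : subgroup_bundle p.

Definition right_invariant f := forall x u, subbundle U u -> p x = p u -> f (x ** u) = f x.

Lemma right_invariant_conv f g : right_invariant g -> right_invariant (conv f g).
Proof.
move=> gU x u Uu xu; rewrite /bundle_conv bproj_mul//; apply: mean_eq => y py; congr (_ * _).
by rewrite bmulA ?bproj_inv ?py// gU// bproj_mul bproj_inv py.
Qed.

Lemma right_invariant_act k P : right_invariant k -> right_invariant (act k P).
Proof.
move=> kU x u Uu xu; apply: eq_bigr => i _; congr (_ * _).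
have kUi : right_invariant (convpow k i) by case: (nat_of_ord i) => [//|n]; exact: right_invariant_conv.
exact: kUi.
Qed.

(* Newton's iteration [3 a ^+ 2 - 2 a ^+ 3] for the equation [a ^+ 2 = a]. *)
Lemma newton_step k (e d : R) : continuous k -> 0 <= e -> 0 <= d ->
  (forall x, `|conv k k x - k x| <= e) -> (forall x, `|k x| <= d) ->
  let k' := act k (3%:R%:P * 'X - 2%:R%:P * 'X^2) in
  (forall x, `|conv k' k' x - k' x| <= 4 * e ^+ 3 + 3 * e ^+ 2) /\
  (forall x, `|k' x - k x| <= e * (1 + 2 * d)).
Proof.
move=> ck e0 d0 ke kd k'.
(* With [a = k], [act k P] stands for [a P(a)], so this is the defect [a^2 - a]. The new defect is
   [4 (a^2 - a)^3 - 3 (a^2 - a)^2], and the increment is [(a^2 - a)(1 - 2 a)]. *)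
have ae : forall x, `|act k ('X - 1) x| <= e.
  by move=> x; rewrite actB act1 -(mul1r 'X) actMX// act1.
have cA := act_continuous ck.
have ae2 x : `|act k ('X * ('X - 1) ^+ 2) x| <= e ^+ 2.
  have -> : 'X * ('X - 1) ^+ 2 = 'X * ('X - 1) * ('X - 1) :> {poly R} by ring.
  by rewrite -conv_act// expr2 conv_sup.
have ae3 x : `|act k ('X ^+ 2 * ('X - 1) ^+ 3) x| <= e ^+ 3.
  have -> : 'X ^+ 2 * ('X - 1) ^+ 3 = 'X * ('X - 1) * ('X * ('X - 1) ^+ 2) :> {poly R} by ring.
  by rewrite -conv_act// [e ^+ 3]exprS conv_sup ?exprn_ge0.
split=> x.
  have -> : conv k' k' x - k' x = 4 * act k ('X ^+ 2 * ('X - 1) ^+ 3) x - 3 * act k ('X * ('X - 1) ^+ 2) x.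
    rewrite /k' conv_act//.
    have E (P Q : {poly R}) : act k P x - act k Q x = act k (P - Q) x by rewrite actB.
    have E2 (c : R) P : c * act k P x = act k (c%:P * P) x by rewrite actZ.
    rewrite !E2 !E; congr (act k _ x).
    by rewrite !polyC_natr; ring.
  rewrite (le_trans (ler_normB _ _))// !normrM (@ger0_norm _ 4)// (@ger0_norm _ 3)//.
  by rewrite lerD// ler_wpM2l.
have -> : k' x - k x = act k ('X - 1) x - 2 * act k ('X * ('X - 1) * 1) x.
  have E (P Q : {poly R}) : act k P x - act k Q x = act k (P - Q) x by rewrite actB.
  have E2 (c : R) P : c * act k P x = act k (c%:P * P) x by rewrite actZ.
  rewrite -[k x](congr1 (@^~ x) (act1 k)) !E2 !E; congr (act k _ x).
  by rewrite !polyC_natr; ring.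
rewrite (le_trans (ler_normB _ _))// normrM (@ger0_norm _ 2)// -conv_act// act1.
have h1 := ae x; have : `|conv (act k ('X - 1)) k x| <= e * d by rewrite conv_sup.
lra.
Qed.

Lemma newton_idempotent k (e d : R) : continuous k -> right_invariant k ->
  0 <= e <= 1/16 -> 0 <= d ->
  (forall x, `|conv k k x - k x| <= e) -> (forall x, `|k x| <= d) ->
  exists w : H -> R, [/\ continuous w, right_invariant w, conv w w = w
    & forall x, `|w x - k x| <= 4 * e * (1 + 2 * d)].
Proof.
move=> ck kU /andP[e0 e1] d0 ke kd.
pose nw (f : H -> R) := act f (3%:R%:P * 'X - 2%:R%:P * 'X^2).
pose s n := iter n nw k; pose B := 1 + 2 * d.
have B1 : 1 <= B by rewrite lerDl mulr_ge0.
have sc n : continuous (s n) by elim: n => [//|n IH]; exact: act_continuous.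
have sU n : right_invariant (s n) by elim: n => [//|n IH]; exact: right_invariant_act.
have q0 n : 0 < (2 ^+ n)^-1 :> R by rewrite invr_gt0 exprn_gt0.
have q1 n : (2 ^+ n)^-1 <= 1 :> R by rewrite invf_le1 ?exprn_gt0// exprn_ege1// ler1n.
(* The defect [t] is at least halved, as [4 * t ^+ 2 + 3 * t <= 1 / 2] for [t <= 1 / 16]. If [D]
   denotes the bound for [s n], then [1 + 2 * D] starts at [B] and stays below [2 * B]. *)
have K n : (forall x, `|conv (s n) (s n) x - s n x| <= e / 2 ^+ n) /\
    (forall x, `|s n x| <= (B * (2 - (2 ^+ n)^-1) - 1) / 2).
  elim: n => [|n [IH1 IH2]].
    split=> x; rewrite expr0 ?divr1//= (le_trans (kd x))// invr1 /B; lra.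
  set t := e / 2 ^+ n in IH1.
  have t0 : 0 <= t by rewrite mulr_ge0// ltW.
  have t1 : t <= 1 / 16 by rewrite (le_trans _ e1)// ler_piMr.
  set D := (_ / 2) in IH2.
  have D0 : 0 <= D by rewrite divr_ge0// subr_ge0; have := q1 n; nra.
  have [N1 N2] := newton_step (sc n) t0 D0 IH1 IH2.
  have tE : e / 2 ^+ n.+1 = t / 2 by rewrite exprSr invfM mulrA.
  have qE : (2 ^+ n.+1)^-1 = (2 ^+ n)^-1 / 2 :> R by rewrite exprSr invfM.
  split=> x.
    rewrite tE (le_trans (N1 x))//.
    have -> : 4 * t ^+ 3 + 3 * t ^+ 2 = t * (4 * t ^+ 2 + 3 * t) by ring.
    by rewrite ler_wpM2l//; nra.
  have : `|s n.+1 x| <= D + t * (1 + 2 * D).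
    rewrite -[s n.+1 x](subrK (s n x)) addrC (le_trans (ler_normD _ _))//.
    by apply: lerD; [exact: IH2|exact: N2].
  move/le_trans; apply; rewrite qE.
  have -> : 1 + 2 * D = B * (2 - (2 ^+ n)^-1) by rewrite /D; field.
  have h : t * (B * (2 - (2 ^+ n)^-1)) <= B * (2 ^+ n)^-1 / 8.
    have -> : t * (B * (2 - (2 ^+ n)^-1)) = (B * (2 ^+ n)^-1) * (e * (2 - (2 ^+ n)^-1)) by rewrite /t; ring.
    have -> : B * (2 ^+ n)^-1 / 8 = (B * (2 ^+ n)^-1) * (1 / 8) by ring.
    rewrite ler_wpM2l ?mulr_ge0 ?(ltW (q0 n)) ?(le_trans ler01 B1)//.
    by have := q0 n; nra.
  have p0 : 0 <= B * (2 ^+ n)^-1 by rewrite mulr_ge0 ?(ltW (q0 n)) ?(le_trans ler01 B1).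
  rewrite /D; lra.
have sD n x : `|s n.+1 x - s n x| <= (2 * e * B) / 2 ^+ n.
  have [K1 K2] := K n.
  set D := (_ / 2) in K2.
  have D0 : 0 <= D by rewrite divr_ge0// subr_ge0; have := q1 n; nra.
  have t0 : 0 <= e / 2 ^+ n by rewrite mulr_ge0// ltW.
  have [_ N2] := newton_step (sc n) t0 D0 K1 K2.
  rewrite (le_trans (N2 x))//.
  have -> : 1 + 2 * D = B * (2 - (2 ^+ n)^-1) by rewrite /D; field.
  have -> : 2 * e * B / 2 ^+ n = e / 2 ^+ n * (B * 2) by ring.
  rewrite ler_wpM2l// ler_wpM2l ?(le_trans ler01 B1)// gerBl; exact: ltW.
have [w cw wE] := geometric_limit sc sD.
exists w.
have C0 : 0 <= 2 * (2 * e * B) by rewrite !mulr_ge0 ?(le_trans ler01 B1).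
have small (C eps : R) : 0 <= C -> 0 < eps -> exists n, C * (2 ^+ n)^-1 <= eps.
  move=> C0' eps0.
  have : (fun n => C * 2^-1 ^+ n) @ \oo --> C * 0.
    by apply: cvgMr; apply: cvg_expr; rewrite ger0_norm// invf_lt1// ltr1n.
  rewrite mulr0 => /cvgr0_norm_le/(_ eps eps0)[n _ /(_ n (leqnn n))] /= H1.
  by exists n; rewrite (le_trans (ler_norm _))// -exprVn.
split=> //.
- move=> x u Uu xu; apply: le_distP => eps eps0.
  have [|n nE] := small _ (eps / 2) C0; first by rewrite divr_gt0.
  have h1 := wE n (x ** u); have h2 := wE n x; rewrite sU// in h1.
  move: h1 h2; rewrite !ler_norml => /andP[? ?] /andP[? ?]; apply/andP; split; lra.
- apply/funext => x; apply: le_distP => eps eps0.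
  have sB n y : `|s n y| <= B.
    rewrite (le_trans ((K n).2 y))//; have := q0 n; nra.
  have wB y : `|w y| <= B + 2 * (2 * e * B).
    have := wE 0%N y; rewrite expr0 divr1 => h.
    rewrite -[w y](subrK (s 0%N y)) addrC (le_trans (ler_normD _ _))// lerD//; exact: sB.
  set B' := B + _ in wB.
  have B'0 : 0 <= B' by rewrite addr_ge0// (le_trans ler01 B1).
  set C := 2 * (2 * e * B) in C0 wE.
  have [|n nE] := small (C * B' + C * B + C + e) eps _ eps0.
    by rewrite !addr_ge0 ?mulr_ge0// (le_trans ler01 B1).
  rewrite (le_trans _ nE)//.
  have cN f : continuous f -> continuous (fun x => - f x) by move=> cf z; apply: cvgN; exact: cf.
  have cB f g : continuous f -> continuous g -> continuous (f \+ (fun x => - g x)).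
    by move=> cf cg z; apply: cvgD; [exact: cf|exact: cN].
  have ct : 0 <= C / 2 ^+ n by rewrite mulr_ge0// ltW.
  have h1 : `|conv w w x - conv (s n) w x| <= C / 2 ^+ n * B'.
    have -> : conv w w x - conv (s n) w x = conv (w \+ (fun x => - s n x)) w x.
      rewrite convDl//; last exact: cN.
      have := convZl (-1) (sc n) cw => /(congr1 (@^~ x)); rewrite mulN1r => <- /=.
      by congr (_ + conv _ _ _); apply/funext => y; rewrite mulN1r.
    by apply: conv_sup => //; [exact: cB | move=> y _; exact: wE].
  have h2 : `|conv (s n) w x - conv (s n) (s n) x| <= B * (C / 2 ^+ n).
    have -> : conv (s n) w x - conv (s n) (s n) x = conv (s n) (w \+ (fun x => - s n x)) x.
      rewrite convDr//; last exact: cN.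
      have := convZr (-1) (sc n) (sc n) => /(congr1 (@^~ x)); rewrite mulN1r => <- /=.
      by congr (_ + conv _ _ _); apply/funext => y; rewrite mulN1r.
    by apply: conv_sup => //; [exact: cB | exact: le_trans ler01 B1 | move=> y _; exact: wE].
  have h3 := (K n).1 x; have h4 := wE n x.
  have -> : conv w w x - w x = (conv w w x - conv (s n) w x) +
    (conv (s n) w x - conv (s n) (s n) x) + (conv (s n) (s n) x - s n x) - (w x - s n x) by ring.
  have -> : (C * B' + C * B + C + e) * (2 ^+ n)^-1 =
     C / 2 ^+ n * B' + B * (C / 2 ^+ n) + e / 2 ^+ n + C / 2 ^+ n by ring.
  rewrite (le_trans (ler_normB _ _))// lerD// (le_trans (ler_normD _ _))// lerD//.
  by rewrite (le_trans (ler_normD _ _))// lerD.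
- move=> x; have := wE 0%N x; rewrite expr0 divr1 /s /=.
  by have -> : 2 * (2 * e * B) = 4 * e * B by ring.
Qed.

End conv_algebra.

(** * Local reproduction by convolution idempotents *)

Lemma continuous_bounded_compact (R : realType) (X : topologicalType) (f : X -> R) :
  compact [set: X] -> continuous f -> exists2 B, 0 <= B & forall x : X, `|f x| <= B.
Proof.
move=> cX cf.
have [B [_ HB]] := compact_bounded (continuous_compact (continuous_subspaceT cf) cX).
exists (`|B| + 1); first by rewrite addr_ge0.
by move=> x; apply: HB; [rewrite (le_lt_trans (ler_norm _))// ltrDl | exists x].
Qed.

Lemma dist4 (R : realFieldType) (a b c d f e : R) : `|a - b| <= e / 4 ->
  `|c - b| <= e / 4 -> `|c - d| <= e / 4 -> `|d - f| <= e / 4 -> `|a - f| <= e.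
Proof.
rewrite !ler_norml => /andP[? ?] /andP[? ?] /andP[? ?] /andP[? ?].
by apply/andP; split; lra.
Qed.

Section local_idempotent.
Variables (R : realType) (M H : topologicalType) (p : group_bundle M H).
Hypothesis p_open : open_map p.
Variable U : subgroup_bundle p.
Local Notation "x ** y" := (bmul p x y) (at level 40, left associativity).
Local Notation inv := (binv p).
Local Notation one := (bone p).
Local Notation mean := (mean (R := R) p).
Local Notation conv := (bundle_conv (R := R) p).
Local Notation right_invariant := (right_invariant (R := R) U).
Implicit Types (m : M) (x y z a b : H) (f g h k : H -> R).

(** Source of the approximate unit: it vanishes at the units, is invariant under inversion, and
    inherits right [U]-invariance from [g]. *)
Definition displacement g z := sup [set `|g (y ** z) - g y| | y in [set y | p y = p z]].

Section displacement.
Variable g : H -> R.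
Hypothesis g_cont : continuous g.

Let has_disp z : has_sup [set `|g (y ** z) - g y| | y in [set y | p y = p z]].
Proof.
have [B B0 gB] := continuous_bounded_compact (bundle_space p).1 g_cont.
split; first by exists `|g (z ** z) - g z|; exists z.
exists (B + B) => _ [y _ <-]; rewrite (le_trans (ler_normB _ _))// lerD//.
Qed.

Lemma displacement_ge y z : p y = p z -> `|g (y ** z) - g y| <= displacement g z.
Proof. by move=> yz; apply: ub_le_sup; [exact: (has_disp z).2 | exists y]. Qed.

Lemma displacement_le z c : (forall y, p y = p z -> `|g (y ** z) - g y| <= c) ->
  displacement g z <= c.
Proof. by move=> H1; apply: ge_sup; [exact: (has_disp z).1 | move=> _ [y /H1 ? <-]]. Qed.

(** Upper semicontinuity comes from compactness, through [near_fiber]; lower semicontinuity from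
    openness of [p], by which a nearly optimal [y] is followed into the fibre of [z]. *)
Lemma displacement_continuous : continuous (displacement g).
Proof.
have cF : fiber_continuous p p (fun z y => `|g (y ** z) - g y|).
  move=> z y zy; set D := [set nx | _].
  have W : \forall w \near within D (nbhs (z, y)), D w.
    by apply: withinT; exact: nbhs_filter.
  have FW := within_filter D (nbhs_filter (z, y)).
  have c1 : fst @ within D (nbhs (z, y)) --> z.
    by apply: cvg_trans (cvg_app _ (cvg_within _)) _; exact: cvg_fst.
  have c2 : snd @ within D (nbhs (z, y)) --> y.
    by apply: cvg_trans (cvg_app _ (cvg_within _)) _; exact: cvg_snd.
  apply: cvg_norm; apply: cvgB; last exact: (cvg_comp snd g c2 (g_cont (x := y))).
  apply: (cvg_comp (fun w => w.2 ** w.1) g _ (g_cont (x := _))).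
  by apply: cvg_bmul => //; apply: filterS W => -[a b] /= ->.
move=> z0; apply/cvgrPdist_le => e e0.
have up : \forall z \near z0, forall y, p y = p z -> `|g (y ** z) - g y| <= displacement g z0 + e.
  apply: (near_fiber (bproj_continuous (g := p))
    (P := fun z y => `|g (y ** z) - g y| <= displacement g z0 + e)).
  move=> y py; have /cvgr_le/(_ (displacement g z0 + e)) := cF z0 y (esym py).
  have -> : `|g (y ** z0) - g y| < displacement g z0 + e.
    by rewrite (le_lt_trans (displacement_ge py))// ltrDl.
  by move=> /(_ isT) h1; rewrite near_withinE in h1.
have [_ [y0 /= py0 <-] y0e] := sup_adherent e0 (has_disp z0).
have /cvgr_ge/(_ (displacement g z0 - e) y0e) h1 := cF z0 y0 (esym py0).
rewrite near_withinE in h1; have [[A B] /= [Az By] AB] := h1.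
have low : \forall z \near z0, exists2 y, B y & p y = p z.
  by have := near_bproj p_open By; rewrite py0 => /(bproj_continuous (g := p)).
near=> z.
have up' : displacement g z <= displacement g z0 + e.
  by apply: displacement_le; near: z.
have [y By' yz] : exists2 y, B y & p y = p z by near: z.
have Az' : A z by near: z.
have := AB (z, y) (conj Az' By') (esym yz) => /= h2.
have := displacement_ge yz.
by move=> h3; rewrite ler_norml; apply/andP; split; lra.
Unshelve. all: by end_near. Qed.

Lemma displacement_inv z : displacement g (inv z) = displacement g z.
Proof.
congr sup; apply/seteqP; split=> _ [y /= yz <-].
  have yz' : p y = p z by rewrite yz bproj_inv.
  exists (y ** inv z); first by rewrite /= bproj_mul.
  by rewrite -bmulA ?bproj_inv// bmulVx -yz' bmulx1 distrC.
exists (y ** z); first by rewrite /= bproj_mul// bproj_inv.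
by rewrite -bmulA ?bproj_inv// bmulxV -yz bmulx1 distrC.
Qed.

Lemma displacement_one m : displacement g (one m) = 0.
Proof.
apply/eqP; rewrite eq_le; apply/andP; split.
  apply: displacement_le => y; rewrite bproj_one => <-.
  by rewrite bmulx1 subrr normr0.
by rewrite (le_trans _ (displacement_ge (erefl (p (one m)))))//.
Qed.

Lemma displacement_right_invariant : right_invariant g -> right_invariant (displacement g).
Proof.
move=> gU z u Uu zu.
have E y : p y = p z -> g (y ** (z ** u)) = g (y ** z).
  by move=> yz; rewrite bmulA// gU// bproj_mul// yz.
have pzu : p (z ** u) = p z by rewrite bproj_mul.
congr sup; apply/seteqP; split=> _ [y /= yz <-]; exists y => //=.
- by rewrite yz pzu.
- by rewrite E// yz pzu.
- by rewrite yz pzu.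
- by rewrite E.
Qed.

End displacement.

Lemma mean_shift m k x : fcont p m k -> p x = m ->
  mean m (fun y => k (inv y ** x)) = mean m k.
Proof.
move=> ck px; rewrite -(mean_right ck px) -[RHS]mean_inv//.
exact: (fcont_right px ck).
Qed.

Lemma fcont_shift m k x : fcont p m k -> p x = m -> fcont p m (fun y => k (inv y ** x)).
Proof.
by move=> ck px; apply: (@fcont_inv _ _ _ p m (fun y => k (y ** x))); exact: fcont_right.
Qed.

Lemma mean_norm_le_mean m f g : fcont p m f -> fcont p m g ->
  (forall y, p y = m -> `|f y| <= g y) -> `|mean m f| <= mean m g.
Proof.
move=> cf cg fg; rewrite ler_norml -meanN//; apply/andP; split; apply: mean_le => //.
- exact: fcontN.
- by move=> y /fg; rewrite ler_norml => /andP[].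
- by move=> y /fg; rewrite ler_norml => /andP[].
Qed.

Lemma conv_average_le m k f x (c : R) : fcont p m k -> (forall z, p z = m -> 0 <= k z) ->
  mean m k = 1 -> p x = m -> fcont p m f ->
  (forall y, p y = m -> k (inv y ** x) != 0 -> `|f y| <= c) ->
  `|mean m (fun y => f y * k (inv y ** x))| <= c.
Proof.
move=> ck k0 k1 px cf fc; have cs := fcont_shift ck px.
rewrite -[c]mulr1 -k1 -(mean_shift ck px) -meanZ//.
apply: mean_norm_le_mean; [exact: fcontM|exact: fcontZ|] => y py.
have k0' : 0 <= k (inv y ** x) by apply: k0; rewrite bproj_mul bproj_inv ?py.
rewrite normrM (ger0_norm k0').
have [->|kn0] := eqVneq (k (inv y ** x)) 0; first by rewrite !mulr0.
by rewrite ler_wpM2r// fc.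
Qed.

(** If [k] does not vanish at [y^-1 x], the displacement there is at most [e], so [g y] is within
    [e] of [g x]; the convolution averages such values. *)
Lemma approximate_unit g m (e : R) : continuous g -> right_invariant g -> 0 < e ->
  exists k, [/\ continuous k, right_invariant k, k \o inv = k,
    (forall z, 0 <= k z) /\ mean m k = 1
    & forall x, p x = m -> `|conv g k x - g x| <= e].
Proof.
move=> cg gU e0.
(* Twice the positive part of [e - displacement g]. *)
pose k0 z := (e - displacement g z) + `|e - displacement g z|.
have ck0 : continuous k0.
  have c : continuous (fun z => e - displacement g z).
    by move=> z; apply: cvgB; [exact: cvg_cst | exact: displacement_continuous].
  by move=> z; apply: cvgD; [exact: c | apply: cvg_norm; exact: c].
have k00 z : 0 <= k0 z by rewrite /k0 addrC -lerBlDr sub0r -normrN ler_norm.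
have mk0 : 0 < mean m k0.
  apply: mean_gt0 => [||]; [exact: fcontW|by []|].
  by rewrite /k0 displacement_one// subr0 ger0_norm ?ltW// addr_gt0.
pose k z := (mean m k0)^-1 * k0 z.
have ck : continuous k by move=> z; apply: cvgMr; exact: ck0.
have kpos z : 0 <= k z by rewrite mulr_ge0// invr_ge0 ltW.
have k1 : mean m k = 1 by rewrite meanZ ?mulVf ?gt_eqF//; exact: fcontW.
exists k; split=> //.
- by move=> z u Uu zu; rewrite /k /k0 displacement_right_invariant.
- by apply/funext => z; rewrite /= /k /k0 displacement_inv.
move=> x px; have cks : fcont p m (fun y => k (inv y ** x)) by apply: fcont_shift => //; exact: fcontW.
have -> : conv g k x - g x = mean m (fun y => (g y - g x) * k (inv y ** x)).
  rewrite /bundle_conv px -[g x]mulr1 -{1}k1 -(mean_shift (fcontW ck) px) -meanZ//.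
  rewrite -meanN; last exact: fcontZ.
  rewrite -meanD; last 2 first.
  - by apply: fcontM => //; exact: fcontW.
  - by apply: fcontN; exact: fcontZ.
  by apply: mean_eq => y _ /=; ring.
apply: conv_average_le => //; first exact: fcontW.
  by apply: (@fcontD _ _ _ p m g (fun=> - g x)); [exact: fcontW|exact: fcont_cst].
move=> y py; set z := inv y ** x => kz.
have pz : p z = m by rewrite bproj_mul bproj_inv py.
have yz : y ** z = x by rewrite bmulKV// py.
have dz : displacement g z <= e.
  rewrite leNgt; apply: contra kz => dz; rewrite /k /k0.
  by rewrite ler0_norm ?subrr ?mulr0// subr_le0 ltW.
have := displacement_ge cg (y := y) (z := z); rewrite yz py pz => /(_ erefl).
by rewrite distrC => /le_trans; apply.
Qed.

(* [g] is close to [g * k * k] for an approximate unit [k]; the spectral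
   projection [w] of [k] commutes with [k] and moves [g * k * k] little. *)
Lemma local_almost_idempotent g m (e : R) : continuous g -> right_invariant g -> 0 < e ->
  exists h (D : R), [/\ continuous h, 0 <= D & forall d : R, 0 < d ->
    exists a : H -> R, [/\ continuous a, right_invariant a,
      forall x, p x = m -> `|conv a a x - a x| <= d,
      forall x, p x = m -> `|a x| <= D
      & forall x, p x = m -> `|conv h a x - g x| <= e]].
Proof.
move=> cg gU e0; have e4 : 0 < e / 4 by rewrite divr_gt0.
have [k [ck kU kinv [k0 k1] gk]] := approximate_unit m cg gU e4.
have cA := act_continuous p_open ck.
have cAm P : fcont p m (act p k P) by exact: fcontW.
pose nu P := act p k ('X * P) (one m).
have dotE P Q : nu (P * Q) = mean m (fun y => act p k P y * act p k Q y).
  rewrite /nu mulrA -conv_act// /bundle_conv bproj_one; apply: mean_eq => y py.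
  have -> : inv y ** one m = inv y by rewrite -py -(bproj_inv p y) bmulx1.
  by have /(congr1 (@^~ y)) /= -> := act_inv p_open ck Q kinv.
have nuD P Q : nu (P + Q) = nu P + nu Q by rewrite /nu mulrDr actD.
have nuZ c P : nu (c%:P * P) = c * nu P by rewrite /nu mulrCA actZ.
have nu0 P : 0 <= nu (P ^+ 2).
  rewrite expr2 dotE; apply: mean_ge0; first exact: fcontM.
  by move=> y _; rewrite -expr2 sqr_ge0.
have nE P : Num.sqrt (nu (P ^+ 2)) = fnorm p m (act p k P).
  by rewrite expr2 dotE.
have HS Q F : fnorm p m (act p k ('X * Q * F)) <= fnorm p m (act p k Q) * fnorm p m (act p k F).
  rewrite -conv_act//; apply: fnorm_le; rewrite ?mulr_ge0 ?fnorm_ge0//.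
    by apply: fcontW; exact: conv_continuous.
  by move=> y <-; exact: conv_fnorm.
pose G := fnorm p m g; have G0 : 0 <= G by exact: fnorm_ge0.
pose k2 := fnorm p m k; have k20 : 0 <= k2 by exact: fnorm_ge0.
(* Discarding the spectrum of [k] below [r] changes [h] by at most [G * r * k2 <= e / 4]. *)
pose r := e / (4 * (G * k2 + 1)).
have Gk : 0 < G * k2 + 1 by rewrite ltr_wpDl// mulr_ge0.
have r0 : 0 < r by rewrite divr_gt0// mulr_gt0.
have rE : r * (G * k2) <= e / 4.
  rewrite /r -mulrA -[leRHS]mulr1 -mulrA; rewrite ler_wpM2l ?(ltW e0)//.
  rewrite invfM -mulrA ler_wpM2l// ler_pdivrMl// mulr1 lerDl ler01//.
pose N := (Num.truncn (k2 ^+ 2 / r ^+ 2)).+1.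
have HN : k2 ^+ 2 <= N%:R * r ^+ 2.
  by rewrite -ler_pdivrMr ?exprn_gt0// ltW// truncnS_gt.
pose W : R := 4 ^+ N; have W0 : 0 <= W by rewrite exprn_ge0.
pose h := conv g (act p k 'X).
have ch : continuous h by exact: conv_continuous.
pose h2 := fnorm p m h; have h20 : 0 <= h2 by exact: fnorm_ge0.
(* The bound comes from the two terms of [Qa] below and does not involve [d], which will later be
   chosen in terms of it. *)
exists h, (3 * (W * W) + 2 * (W * (W * W))); split=> //.
  by rewrite addr_ge0 ?mulr_ge0.
move=> d d0.
pose d1 := Num.min (Num.min 1 (d / 7)) (e / (4 * (h2 * (1 + 2 * W) + 1))).
have hW : 0 < h2 * (1 + 2 * W) + 1 by rewrite ltr_wpDl// mulr_ge0// addr_ge0// mulr_ge0.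
have d10 : 0 < d1 by rewrite !lt_min ltr01 !divr_gt0// mulr_gt0.
have d11 : d1 <= 1 by rewrite !ge_min lexx.
have d1d : 7 * d1 <= d.
  have : d1 <= d / 7 by rewrite !ge_min lexx !orbT.
  lra.
have d1e : h2 * (d1 * (1 + 2 * W)) <= e / 4.
  have : d1 <= e / (4 * (h2 * (1 + 2 * W) + 1)) by rewrite !ge_min lexx !orbT.
  rewrite ler_pdivlMr ?mulr_gt0//; lra.
have [||Q [Q1 Q2 Q3]] := spectral_projection nuD nuZ nu0 (N := N) (X := 'X) (u := 1) r0 _ _ d10.
- by move=> Q F; rewrite !nE mulr1.
- by rewrite nE act1.
move: Q1 Q2 (Q3 1); rewrite !nE !mulr1 act1 => Q1 Q2 {}Q3.
pose Z := 'X * Q ^+ 2 - Q : {poly R}.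
(* ['X * Qa] is one Newton step from ['X * Q]. The defect [Z] of [Q] is small in quadratic norm
   only; every term of the defect of [Qa] contains at least two factors [Z], so it is small in sup
   norm. Likewise every term of [Qa] contains two factors [Q]. *)
pose Qa := (3%:R%:P * 'X * Q ^+ 2 - 2%:R%:P * 'X^2 * Q ^+ 3 : {poly R}).
exists (act p k Qa).
have conv_fn f P x c (c' : R) : continuous f -> p x = m -> fnorm p m f <= c ->
    fnorm p m (act p k P) <= c' -> `|conv f (act p k P) x| <= c * c'.
  move=> cf px fc Pc; apply: (le_trans (y := fnorm p m f * fnorm p m (act p k P))).
    by rewrite -px; exact: conv_fnorm.
  by rewrite ler_pM ?fnorm_ge0.
have sup2 P P' x c (c' : R) : p x = m -> fnorm p m (act p k P) <= c ->
    fnorm p m (act p k P') <= c' -> `|act p k ('X * P * P') x| <= c * c'.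
  by move=> px Pc P'c; rewrite -conv_act//; exact: conv_fn.
have n2 P P' c (c' : R) : 0 <= c -> 0 <= c' -> fnorm p m (act p k P) <= c ->
    fnorm p m (act p k P') <= c' -> fnorm p m (act p k ('X * P * P')) <= c * c'.
  by move=> c0 c'0 Pc P'c; apply: fnorm_le; rewrite ?mulr_ge0// => y py; exact: sup2.
have actB' P P' x : act p k P x - act p k P' x = act p k (P - P') x by rewrite actB.
have act_scale c P x : c * act p k P x = act p k (c%:P * P) x by rewrite actZ.
split=> //.
- exact: right_invariant_act.
- move=> x px; rewrite conv_act//.
  have -> : act p k ('X * Qa * Qa) x - act p k Qa x =
      4 * act p k ('X * Z * ('X * Z * Z)) x - 3 * act p k ('X * Z * Z) x.
    rewrite !act_scale !actB'; congr (act _ _ _ x).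
    by rewrite /Qa /Z !polyC_natr; ring.
  rewrite (le_trans (ler_normB _ _))// !normrM (@ger0_norm _ 4)// (@ger0_norm _ 3)//.
  have s1 : `|act p k ('X * Z * Z) x| <= d1 * d1 by exact: sup2.
  have s2 : `|act p k ('X * Z * ('X * Z * Z)) x| <= d1 * (d1 * d1).
    by apply: sup2 => //; apply: n2 => //; exact: ltW.
  have dd : d1 * d1 <= d1 by rewrite ler_piMr// ltW.
  apply: le_trans d1d; rewrite (_ : 7 * d1 = 4 * d1 + 3 * d1); last by ring.
  by rewrite lerD// ler_wpM2l// ?(le_trans s1)// (le_trans s2)// (le_trans _ dd)// ler_wpM2l// ltW.
- move=> x px.
  have -> : act p k Qa x = 3 * act p k ('X * Q * Q) x - 2 * act p k ('X * Q * ('X * Q * Q)) x.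
    rewrite !act_scale !actB'; congr (act _ _ _ x).
    by rewrite /Qa !polyC_natr; ring.
  rewrite (le_trans (ler_normB _ _))// !normrM (@ger0_norm _ 3)// (@ger0_norm _ 2)//.
  have s1 : `|act p k ('X * Q * Q) x| <= W * W by exact: sup2.
  have s2 : `|act p k ('X * Q * ('X * Q * Q)) x| <= W * (W * W).
    by apply: sup2 => //; apply: n2.
  by rewrite lerD// ler_wpM2l.
- move=> x px.
  have convB P P' f : continuous f ->
      conv f (act p k P) x - conv f (act p k P') x = conv f (act p k (P - P')) x.
    move=> cf.
    have -> : act p k (P - P') = act p k P \+ (fun x => -1 * act p k P' x).
      by apply/funext => z /=; rewrite actB mulN1r.
    rewrite convDr//; last by move=> z; apply: cvgMr; exact: cA.
    by rewrite convZr//= mulN1r.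
  have hE P : conv h (act p k P) = conv g (act p k ('X * 'X * P)).
    by rewrite /h -bundle_convA// conv_act.
  have t1 : `|conv h (act p k Qa) x - conv h (act p k Q) x| <= e / 4.
    rewrite convB//.
    have -> : Qa - Q = Z - 2%:R%:P * ('X * Q * Z).
      by rewrite /Qa /Z !polyC_natr; ring.
    rewrite -convB// actZ convZr// (le_trans (ler_normB _ _))// normrM (@ger0_norm _ 2)//.
    have s1 : `|conv h (act p k Z) x| <= h2 * d1 by exact: conv_fn.
    have s2 : `|conv h (act p k ('X * Q * Z)) x| <= h2 * (W * d1).
      by apply: conv_fn => //; apply: n2 => //; exact: ltW.
    apply: le_trans d1e; rewrite (_ : _ * _ = h2 * d1 + 2 * (h2 * (W * d1))); last by ring.
    by rewrite lerD// ler_wpM2l.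
  have t2 : `|h x - conv h (act p k Q) x| <= e / 4.
    rewrite hE /h convB//.
    have -> : 'X - 'X * 'X * Q = 'X * (1 - 'X * Q) :> {poly R} by ring.
    rewrite (le_trans _ rE)// mulrCA.
    by apply: conv_fn => //; rewrite mulrC -mulrA; rewrite [_ * r]mulrC.
  have aX : act p k 'X = conv k k by rewrite -(mul1r 'X) actMX// act1.
  have cgk : continuous (conv g k) by exact: conv_continuous.
  have t3 : `|h x - conv g k x| <= e / 4.
    rewrite /h aX bundle_convA//.
    have cks : fcont p m (fun y => k (inv y ** x)) by apply: fcont_shift => //; exact: fcontW.
    have -> : conv (conv g k) k x - conv g k x = mean m (fun y => (conv g k y - g y) * k (inv y ** x)).
      rewrite [in LHS]/bundle_conv px -/(bundle_conv p g k).
      have -> : mean m (fun y => g y * k (inv y ** x)) = conv g k x by rewrite /bundle_conv px.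
      rewrite -[conv g k x]/(mean (p x) (fun y => g y * k (inv y ** x))) px.
      rewrite -meanN; last by apply: fcontM => //; exact: fcontW.
      rewrite -meanD; last 2 first.
      - by apply: fcontM => //; exact: fcontW.
      - by apply: fcontN; apply: fcontM => //; exact: fcontW.
      by apply: mean_eq => y _ /=; ring.
    apply: conv_average_le => //; first exact: fcontW.
      by apply: (fcontD (f := conv g k) (g := fun y => - g y)); [exact: fcontW|apply: fcontN; exact: fcontW].
    by move=> y py _; exact: gk.
  exact: dist4 t1 t2 t3 (gk x px).
Qed.

Definition fiber_restrict (V : set M) f x : R := if `[< V (p x) >] then f x else 0.

Lemma fiber_restrict_continuous (V : set M) f : clopen V -> continuous f ->
  continuous (fiber_restrict V f).
Proof.
move=> [oV cV] cf x A.
have [Vx|Vx] := pselect (V (p x)).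
  rewrite {1}/fiber_restrict asboolT// => /cf fA.
  have := bproj_continuous (g := p) (open_nbhs_nbhs (conj oV Vx)) => VA.
  have fA' : \forall y \near x, A (f y) := fA.
  have VA' : \forall y \near x, V (p y) := VA.
  by apply: filterS2 fA' VA' => y /= Ay Vy; rewrite /fiber_restrict asboolT.
rewrite {1}/fiber_restrict asboolF// => A0.
have := bproj_continuous (g := p) (open_nbhs_nbhs (conj (closed_openC cV) Vx)) => VA.
have VA' : \forall y \near x, ~ V (p y) := VA.
by apply: filterS VA' => y Vy; rewrite /= /fiber_restrict asboolF//; exact: nbhs_singleton A0.
Qed.

Hypothesis clopen_base : forall m (A : set M), nbhs m A ->
  exists V, [/\ clopen V, V m & V `<=` A].

Lemma local_idempotent g m (e : R) : continuous g -> right_invariant g -> 0 < e ->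
  exists (V : set M) (h w : H -> R), [/\ nbhs m V, continuous h,
    [/\ continuous w, right_invariant w & conv w w = w]
    & forall x, V (p x) -> `|conv h w x - g x| <= e].
Proof.
move=> cg gU e0; have e4 : 0 < e / 4 by rewrite divr_gt0.
have [h [D [ch D0 Ha]]] := local_almost_idempotent m cg gU e4.
have [C C0 hC] := continuous_bounded_compact (bundle_space p).1 ch.
pose E := 1 + 2 * (D + 1); have E0 : 0 < E by rewrite ltr_wpDr// mulr_ge0// addr_ge0.
(* [1 / 16] lets Newton's iteration start; the other bound keeps its correction [4 * eta * E],
   convolved with [h], below [e / 4]. *)
pose eta := Num.min (1 / 16) (e / (16 * (C + 1) * E)).
have C1 : 0 < C + 1 by rewrite ltr_wpDl.
have eta0 : 0 < eta by rewrite lt_min !divr_gt0// !mulr_gt0.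
have eta1 : 0 <= eta <= 1 / 16 by rewrite (ltW eta0) ge_min lexx.
have etaC : C * (4 * eta * E) <= e / 4.
  have : eta <= e / (16 * (C + 1) * E) by rewrite ge_min lexx orbT.
  rewrite ler_pdivlMr ?mulr_gt0// => h1.
  have h2 : 0 <= eta * E by rewrite mulr_ge0 ?ltW.
  lra.
have eta2 : 0 < eta / 2 by rewrite divr_gt0.
have [a [ca aU aa aD ha]] := Ha _ eta2.
have nearP (f : H -> R) (c d : R) : continuous f -> c < d -> (forall x, p x = m -> `|f x| <= c) ->
    \forall n \near m, forall x, p x = n -> `|f x| < d.
  move=> cf cd fc.
  have cid : continuous (@id M) by move=> ?; exact: cvg_id.
  apply: (near_fiber cid (P := fun _ x => `|f x| < d)).
  move=> x /= px.
  have : (fun nx : M * H => `|f nx.2|) @ (m, x) --> `|f x|.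
    by apply: cvg_norm; apply: (cvg_comp snd f _ (cf x)); exact: cvg_snd.
  move=> /cvgr_lt/(_ d); rewrite (le_lt_trans (fc x px) cd) => /(_ isT).
  by apply: filterS.
have cB (f f' : H -> R) : continuous f -> continuous f' -> continuous (fun x => f x - f' x).
  by move=> cf cf' x; apply: cvgB; [exact: cf|exact: cf'].
have caa : continuous (conv a a) by exact: conv_continuous.
have cha : continuous (conv h a) by exact: conv_continuous.
have n1 := nearP _ _ eta (cB _ _ caa ca) _ aa.
have n2 := nearP _ _ (D + 1) ca _ aD.
have n3 := nearP _ _ (e / 2) (cB _ _ cha cg) _ ha.
have eta_lt : eta / 2 < eta by rewrite ltr_pdivrMr// ltr_pMr// ltr1n.
have D_lt : D < D + 1 by rewrite ltrDl.
have e_lt : e / 4 < e / 2 by rewrite ltr_pM2l// ltf_pV2 ?posrE// ltr_nat.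
(* The estimates on the fibre over [m] persist, with slightly larger constants, over a clopen
   neighbourhood; cutting [a] off there makes the first two hold on all of [H]. *)
have [V [cV Vm VA]] := clopen_base (filterI (n1 eta_lt) (filterI (n2 D_lt) (n3 e_lt))).
pose a0 := fiber_restrict V a.
have ca0 : continuous a0 by exact: fiber_restrict_continuous.
have a0V x : V (p x) -> a0 x = a x by move=> Vx; rewrite /a0 /fiber_restrict asboolT.
have a0N x : ~ V (p x) -> a0 x = 0 by move=> Vx; rewrite /a0 /fiber_restrict asboolF.
have a0U : right_invariant a0.
  by move=> x u Uu xu; rewrite /a0 /fiber_restrict bproj_mul// aU.
have aa0 x : `|conv a0 a0 x - a0 x| <= eta.
  have [Vx|Vx] := pselect (V (p x)); last first.
    rewrite a0N// subr0 (_ : conv a0 a0 x = 0) ?normr0 ?ltW//.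
    rewrite -[RHS](mean_cst p (p x)); apply: mean_eq => y py.
    by rewrite a0N ?mul0r ?py.
  rewrite a0V// (_ : conv a0 a0 x = conv a a x).
    by have [h1 _] := VA _ Vx; exact/ltW/h1.
  by apply: mean_eq => y py; rewrite !a0V// ?bproj_mul ?bproj_inv ?py.
have aD0 x : `|a0 x| <= D + 1.
  have [Vx|Vx] := pselect (V (p x)); last by rewrite a0N// normr0 addr_ge0.
  by rewrite a0V//; have [_ [h1 _]] := VA _ Vx; exact/ltW/h1.
have D10 : 0 <= D + 1 by rewrite addr_ge0.
have [w [cw wU ww wa]] := newton_idempotent p_open ca0 a0U eta1 D10 aa0 aD0.
exists V, h, w; split=> //.
  exact: (open_nbhs_nbhs (conj cV.1 Vm)).
move=> x Vx.
have cd : continuous (fun x => w x - a0 x) by exact: cB.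
have -> : conv h w x - g x = conv h (fun x => w x - a0 x) x + (conv h a x - g x).
  have -> : conv h a x = conv h a0 x.
    by apply: mean_eq => y py; rewrite a0V// bproj_mul bproj_inv ?py.
  rewrite addrA; congr (_ - _).
  rewrite -[RHS]/((conv h (fun x => w x - a0 x) \+ conv h a0) x) -convDr//.
  by congr (conv h _ x); apply/funext => y /=; rewrite subrK.
have h1 : `|conv h (fun x => w x - a0 x) x| <= C * (4 * eta * E).
  apply: conv_sup => //.
  by rewrite mulr_ge0 ?mulr_ge0 ?ltW.
have [_ [_ h2]] := VA _ Vx; have {}h2 := h2 x erefl.
rewrite (le_trans (ler_normD _ _))//; move/ltW: h2; lra.
Qed.

End local_idempotent.

(** * Complex-valued functions and the Gelfand space of the fixed algebra *)

Section cplx.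
Variable R : realType.
Local Notation C := (cplx R).
Implicit Types z : C.

Definition re z : R := complex.Re z.
Definition im z : R := complex.Im z.
Definition ofR (a : R) : C := (a%:C)%C.

Lemma cplxP z1 z2 : re z1 = re z2 -> im z1 = im z2 -> z1 = z2.
Proof. by case: z1 z2 => [a b] [c d] /= ; rewrite /re /im /= => -> ->. Qed.

Lemma reB z1 z2 : re (z1 - z2) = re z1 - re z2.
Proof. by case: z1 z2 => [a b] [c d]. Qed.

Lemma imB z1 z2 : im (z1 - z2) = im z1 - im z2.
Proof. by case: z1 z2 => [a b] [c d]. Qed.

Lemma reD z1 z2 : re (z1 + z2) = re z1 + re z2.
Proof. by case: z1 z2 => [a b] [c d]. Qed.

Lemma imD z1 z2 : im (z1 + z2) = im z1 + im z2.
Proof. by case: z1 z2 => [a b] [c d]. Qed.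

Lemma reM z1 z2 : re (z1 * z2) = re z1 * re z2 - im z1 * im z2.
Proof. by case: z1 z2 => [a b] [c d]. Qed.

Lemma imM z1 z2 : im (z1 * z2) = re z1 * im z2 + im z1 * re z2.
Proof. by case: z1 z2 => [a b] [c d]. Qed.

Lemma norm_cplx z : `|z| = ofR (Num.sqrt (re z ^+ 2 + im z ^+ 2)).
Proof. exact: normc_def. Qed.

Lemma ofR_lt (a b : R) : (ofR a < ofR b) = (a < b).
Proof. exact: ltcR. Qed.

Lemma ofR_le (a b : R) : (ofR a <= ofR b) = (a <= b).
Proof. exact: lecR. Qed.

Lemma re_norm_le z : ofR `|re z| <= `|z|.
Proof. by rewrite norm_cplx ofR_le -sqrtr_sqr ler_sqrt ?lerDl ?sqr_ge0// addr_ge0 ?sqr_ge0. Qed.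

Lemma im_norm_le z : ofR `|im z| <= `|z|.
Proof. by rewrite norm_cplx ofR_le -sqrtr_sqr ler_sqrt ?lerDr ?sqr_ge0// addr_ge0 ?sqr_ge0. Qed.

Lemma norm_le_re_im z : `|z| <= ofR (`|re z| + `|im z|).
Proof.
rewrite norm_cplx ofR_le -[leRHS](@ger0_norm _ (`|re z| + `|im z|)) ?addr_ge0//.
rewrite -sqrtr_sqr ler_sqrt ?sqr_ge0// sqrrD -!normrX.
rewrite (ger0_norm (sqr_ge0 (re z))) (ger0_norm (sqr_ge0 (im z))).
by rewrite -addrA lerD2l lerDr mulrn_wge0// mulr_ge0.
Qed.

(** In the order of [R[i]], comparable numbers have the same imaginary part. *)
Lemma cplx_pos (e : C) : 0 < e -> exists2 e' : R, 0 < e' & e = ofR e'.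
Proof.
case: e => [a b]; rewrite ltcE /= => /andP[/eqP b0 a0]; exists a => //.
by rewrite b0.
Qed.

Lemma cvg_cplx (T : Type) (F : set_system T) {FF : Filter F} (f : T -> C) z :
  (fun t => re (f t)) @ F --> re z -> (fun t => im (f t)) @ F --> im z -> f @ F --> z.
Proof.
move=> fre fim; apply/cvgrPdist_lt => _ /cplx_pos[e e0 ->].
have e2 : 0 < e / 2 by rewrite divr_gt0.
move/cvgrPdist_lt/(_ _ e2) : fre; move/cvgrPdist_lt/(_ _ e2) : fim.
apply: filterS2 => t h1 h2; rewrite (le_lt_trans (norm_le_re_im _))// ofR_lt.
by rewrite reB imB [ltRHS]splitr ltrD.
Qed.

Lemma cvg_re (T : Type) (F : set_system T) {FF : Filter F} (f : T -> C) z :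
  f @ F --> z -> (fun t => re (f t)) @ F --> re z.
Proof.
move=> fz; apply/cvgrPdist_lt => e e0.
have e0' : 0 < ofR e by rewrite (ofR_lt 0).
move/cvgrPdist_lt/(_ _ e0') : fz; apply: filterS => t.
by move/(le_lt_trans (re_norm_le _)); rewrite ofR_lt reB.
Qed.

Lemma cvg_im (T : Type) (F : set_system T) {FF : Filter F} (f : T -> C) z :
  f @ F --> z -> (fun t => im (f t)) @ F --> im z.
Proof.
move=> fz; apply/cvgrPdist_lt => e e0.
have e0' : 0 < ofR e by rewrite (ofR_lt 0).
move/cvgrPdist_lt/(_ _ e0') : fz; apply: filterS => t.
by move/(le_lt_trans (im_norm_le _)); rewrite ofR_lt imB.
Qed.

Lemma ofR_continuous (X : topologicalType) (f : X -> R) :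
  continuous f -> continuous (fun x => ofR (f x)).
Proof. by move=> cf x; apply: cvg_cplx; [exact: cf | exact: cvg_cst]. Qed.

End cplx.

(** [phi 1] is idempotent and injective. *)
Lemma tds_act1 (G : groupType) (X : topologicalType) (phi : tds G X) x : phi 1%g x = x.
Proof.
have [[f fK _] _ _] := tds_homeo phi 1%g.
have := congr1 (@^~ x) (tds_actM phi 1%g 1%g); rewrite mulg1 /= => /(congr1 f).
by rewrite !fK.
Qed.

Section gelfand.
Variables (R : realType) (G : groupType) (L : topologicalType) (psi : tds G L).
Hypothesis hL : stonean L.
Local Notation C := (cplx R).
Local Notation M := (gelfand_fix R psi).

Lemma fixed_invariant (f : cfun R L) : (forall t l, f (psi t l) = f l) -> f \in fixed psi.
Proof. by move=> fi; apply/fixedP => t; apply: cfunP => l; exact: fi. Qed.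

Lemma fix_act (f : fix_algebra R psi) t l : fix_val f (psi t l) = fix_val f l.
Proof.
have /(congr1 (fun chi : M => val chi f)) := q_fix_act R psi t l.
by [].
Qed.

Lemma gelfand_eval_continuous (f : fix_algebra R psi) :
  continuous (fun chi : M => (val chi : {ptws fix_algebra R psi -> C}) f).
Proof.
move=> chi.
have c1 : (val : M -> {ptws fix_algebra R psi -> C}) @ chi --> val chi.
  exact: initial_continuous.
apply: (cvg_comp val (fun g : {ptws fix_algebra R psi -> C} => g f) c1).
exact: (@proj_continuous _ (fun=> C) f).
Qed.

(* If [chi] were no evaluation, then by compactness its kernel would contain
   some [h = \sum_l `|g l| ^+ 2] without zeros, which is invertible. *)
Lemma q_fix_surj (chi : M) : exists l, q_fix R psi l = chi.
Proof.
apply: contrapT => /forallNP nl.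
have [cL hsL] := hL.1.
have [chi_lin chi_mul chi1] : fix_character (val chi) := set_mem (valP chi).
have chiD f g : val chi (f + g) = val chi f + val chi g.
  by have := chi_lin 1 f g; rewrite scale1r mul1r.
have chi0 : val chi 0 = 0.
  by apply: (@addrI _ (val chi 0)); rewrite -chiD !addr0.
have chiZ a f : val chi (a *: f) = a * val chi f.
  by have := chi_lin a f 0; rewrite addr0 chi0 addr0.
have : forall l, exists f, fix_val f l != val chi f.
  move=> l; apply: contrapT => /forallNP H1; apply: (nl l).
  by apply/val_inj/funext => f; have /negP := H1 f; rewrite negbK => /eqP.
move=> /choice[F HF].
(* [g l] lies in the kernel of [chi] but does not vanish at [l]. *)
pose g l : fix_algebra R psi := (F l : fix_algebra R psi) - val chi (F l) *: (1 : fix_algebra R psi).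
have chig l : val chi (g l) = 0.
  by rewrite /g -scaleNr chiD chiZ chi1 mulr1 subrr.
have gE l l' : fix_val (g l) l' = fix_val (F l) l' - val chi (F l).
  by rewrite -[in RHS](mulr1 (val chi (F l))).
have conj_fix (f : fix_algebra R psi) : cfun_conj (fix_val f) \in fixed psi.
  by apply: fixed_invariant => t l; exact: (congr1 Num.conj (fix_act f t l)).
pose cg l : fix_algebra R psi := FixAlgebra (conj_fix (g l)).
have [|s [_ scov]] := @compact_finite_cover L setT (fun l => [set l' | fix_val (g l) l' != 0]) cL.
  move=> l _.
  apply: open_nbhs_nbhs; split; last by rewrite /= gE subr_eq0.
  rewrite (_ : mkset _ = ~` (fix_val (g l) @^-1` [set 0])).
    apply: closed_openC; apply: closed_comp => [x _|]; first exact: cfun_continuous.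
    exact/accessible_closed_set1/hausdorff_accessible/norm_hausdorff.
  by apply/seteqP; split=> l' /= /eqP.
pose h : fix_algebra R psi := \sum_(l <- s) (g l * cg l).
have chih : val chi h = 0.
  rewrite /h (big_morph (val chi) chiD chi0) big1// => l _.
  by rewrite chi_mul chig mul0r.
have hE l' : fix_val h l' = \sum_(l <- s) `|fix_val (g l) l'| ^+ 2.
  rewrite /h (big_morph (fun f : fix_algebra R psi => fix_val f l') (id1 := 0) (op1 := +%R))//.
  by apply: eq_bigr => l _; rewrite normCK.
have hn0 l' : fix_val h l' != 0.
  have [l ls gl] := scov l' I.
  rewrite hE gt_eqF// (big_rem l)//= ltr_wpDr//.
    by apply: sumr_ge0 => i _; rewrite exprn_ge0.
  by rewrite exprn_gt0// normr_gt0.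
have cV : continuous (fun l => (fix_val h l)^-1).
  by move=> l; apply: cvgV => //; exact: cfun_continuous.
have iV : cfun_of cV \in fixed psi.
  by apply: fixed_invariant => t l; rewrite /= /cfun_of /mkcts /= fix_act.
have : h * FixAlgebra iV = 1.
  by apply/val_inj/cfunP => l; exact: divff.
move=> /(congr1 (val chi)); rewrite chi_mul chih mul0r chi1 => /esym/eqP.
by rewrite oner_eq0.
Qed.

(* For invariant [u], the closure of the open set [c < u] is clopen, as [L] is
   extremally disconnected, and invariant: its indicator separates points. *)
Lemma gelfand_fix_zero_dimensional : zero_dimensional M.
Proof.
have sep (u : L -> R) l1 l2 : continuous u -> (forall t l, u (psi t l) = u l) ->
    u l1 < u l2 -> exists V : set M, [/\ clopen V, V (q_fix R psi l2) & ~ V (q_fix R psi l1)].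
  move=> cu ui u12; pose c := (u l1 + u l2) / 2.
  have c1 : u l1 < c by rewrite /c; lra.
  have c2 : c < u l2 by rewrite /c; lra.
  pose O := [set l | c < u l]; pose W := closure O.
  have oO : open O by apply: (@open_comp _ _ u [set y | c < y]) => [l _|]; [exact: cu|exact: open_gt].
  have oW : open W by exact: hL.2.
  have cW : closed W by exact: closed_closure.
  have W2 : W l2 by apply: subset_closure.
  have W1 : ~ W l1.
    (* This neighbourhood of [l1] is disjoint from [O]. *)
    move=> /(_ [set l | u l < c]) [|l [/= h1 h2]]; last by have := lt_trans h1 h2; rewrite ltxx.
    apply: open_nbhs_nbhs; split=> //.
    by apply: (@open_comp _ _ u [set y | y < c]) => [l _|]; [exact: cu|exact: open_lt].
  have Winv t l : W l -> W (psi t l).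
    move=> Wl A /=; have [_ ct _] := tds_homeo psi t.
    move=> /ct /Wl [l' [/= Ol' Al']]; exists (psi t l'); split=> //.
    by rewrite /O /= ui.
  (* As an idempotent of the fixed algebra, the indicator takes only the values 0 and 1 under
     characters; hence [V] below is clopen. *)
  pose e (l : L) : C := if `[< W l >] then 1 else 0.
  have ce : continuous e.
    move=> l; have [Wl|Wl] := pselect (W l).
      rewrite /continuous_at {2}/e asboolT//; apply: (cvg_trans _ (@cvg_cst _ (1 : C) _ (nbhs l) _)).
      apply: near_eq_cvg; near=> l'; rewrite /e asboolT//; near: l'.
      exact: open_nbhs_nbhs.
    rewrite /continuous_at {2}/e asboolF//; apply: (cvg_trans _ (@cvg_cst _ (0 : C) _ (nbhs l) _)).
    apply: near_eq_cvg; near=> l'; rewrite /e asboolF//; near: l'.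
    by apply: open_nbhs_nbhs; split=> //; exact: closed_openC.
  have ei t l : e (psi t l) = e l.
    rewrite /e; congr (if _ then _ else _); apply/asbool_equiv_eq; split; last exact: Winv.
    move=> /(Winv t^-1%g); rewrite -[psi _ (psi _ _)]/((psi t^-1%g \o psi t) l).
    by rewrite -tds_actM mulVg tds_act1.
  have ef : cfun_of ce \in fixed psi by exact: fixed_invariant.
  pose E := FixAlgebra ef.
  have EE : E * E = E.
    apply/val_inj/cfunP => l; rewrite -[LHS]/(e l * e l) -[RHS]/(e l) /e.
    by case: ifP; rewrite ?mulr1 ?mulr0.
  pose V := [set chi : M | (val chi : fix_algebra R psi -> C) E = 1].
  have cl (z : C) : closed [set chi : M | (val chi : fix_algebra R psi -> C) E = z].
    apply: (@closed_comp _ _ (fun chi : M => (val chi : fix_algebra R psi -> C) E) [set z]).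
      by move=> chi _; exact: gelfand_eval_continuous.
    exact/accessible_closed_set1/hausdorff_accessible/norm_hausdorff.
  exists V; split.
  - split; last exact: cl.
    rewrite (_ : V = ~` [set chi : M | (val chi : fix_algebra R psi -> C) E = 0]).
      exact/closed_openC/cl.
    apply/seteqP; split=> chi /=.
      by move=> -> /eqP; rewrite oner_eq0.
    have [_ chi_mul _] : fix_character (val chi) := set_mem (valP chi).
    have := chi_mul E E; rewrite EE => /eqP; rewrite -subr_eq0 -{1}(mulr1 (val chi E)) -mulrBr mulf_eq0.
    by rewrite subr_eq0 => /orP[/eqP E0 E1|/eqP/esym E1 _]; [case: (E1 E0)|exact: E1].
  - by rewrite /V /= /eval_fix /= /cfun_of /mkcts /= /e asboolT.
  - by rewrite /V /= /eval_fix /= /cfun_of /mkcts /= /e asboolF// => /esym/eqP; rewrite oner_eq0.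
have sep' (u : L -> R) l1 l2 : continuous u -> (forall t l, u (psi t l) = u l) ->
    u l1 != u l2 -> exists V : set M, [/\ clopen V, V (q_fix R psi l1) & ~ V (q_fix R psi l2)].
  move=> cu ui; rewrite neq_lt => /orP[u12|]; last exact: sep.
  have [V [[oV cV] V2 V1]] := sep u l1 l2 cu ui u12.
  by exists (~` V); split=> //=; split; [exact: closed_openC|exact: open_closedC].
move=> chi1 chi2; have [l1 <-] := q_fix_surj chi1; have [l2 <-] := q_fix_surj chi2.
move=> /eqP q12; have [f f12] : exists f : fix_algebra R psi, fix_val f l1 <> fix_val f l2.
  apply: contrapT => /forallNP H1; apply: q12; apply/val_inj/funext => f.
  exact: contrapT (H1 f).
have [r12|/eqP r12] := eqVneq (re (fix_val f l1)) (re (fix_val f l2)).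
  apply: (sep' (fun l => im (fix_val f l))).
  - by move=> l; apply: cvg_im; exact: cfun_continuous.
  - by move=> t l; rewrite fix_act.
  - by apply/eqP => i12; apply: f12; exact: cplxP.
apply: (sep' (fun l => re (fix_val f l))).
- by move=> l; apply: cvg_re; exact: cfun_continuous.
- by move=> t l; rewrite fix_act.
- exact/eqP.
Unshelve. all: by end_near. Qed.

Lemma gelfand_fix_clopen_base : compact_hausdorff M -> forall (m : M) (A : set M),
  nbhs m A -> exists V, [/\ clopen V, V m & V `<=` A].
Proof.
move=> [cM hM] m A mA.
have := @zero_dimensional_cvg M m hM gelfand_fix_zero_dimensional cM A mA.
by move=> [V [Vm cV] VA]; exists V.
Qed.

End gelfand.

Lemma set_type_compact_hausdorff (T : topologicalType) (A : set T) :
  compact_hausdorff T -> closed A -> compact_hausdorff (set_type A).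
Proof.
move=> [cT hT] cA; have sv : continuous (set_val : set_type A -> T) by exact: initial_continuous.
split; last first.
  move=> x y xy; apply/val_inj/hT => B D xB yD.
  have [z [Bz Dz]] := xy _ _ (sv x B xB) (sv y D yD).
  by exists (set_val z).
have cptA : compact A := subclosed_compact cA cT (@subsetT _ A).
move=> F FF _; have FsF : ProperFilter (set_val @ F) by exact: fmap_proper_filter.
have FA : (set_val @ F) A.
  by apply: (@filterS _ F _ setT) => [x _|]; [exact: set_mem (valP x) | exact: filterT].
have [a [Aa aF]] := cptA _ FsF FA.
exists (SigSub (mem_set Aa)); split=> // B D FB.
rewrite /nbhs/= => -[D' [[D'' oD'' <-] /= D''a DD]].
have [|b [Bb D''b]] := aF (set_val @` B) D'' _ (open_nbhs_nbhs (conj oD'' D''a)).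
  by apply: (@filterS _ F _ B) => // x Bx; exists x.
by move: Bb D''b => [x Bx <-] D''x; exists x; split=> //; exact: DD.
Qed.

(** * Coset spaces and relative skew products *)

Section coset_topology.
Variables (M H : topologicalType) (p : group_bundle M H) (U : subgroup_bundle p).
Hypothesis U_open : open_map (subbundle_proj (U := U)).
Local Notation "x ** y" := (bmul p x y) (at level 40, left associativity).
Local Notation inv := (binv p).
Local Notation Q := (coset_space U).
Local Notation cls := (coset_class U).

Lemma coset_class_continuous : continuous (cls : H -> Q).
Proof. exact: pi_continuous. Qed.

Lemma coset_class_surj (z : Q) : exists x, cls x = z.
Proof. by exists (repr z); rewrite /coset_class reprK. Qed.

Lemma coset_class_right x u : subbundle U u -> p x = p u -> cls (x ** u) = cls x.
Proof.
move=> Uu xu; apply/esym/coset_classP; rewrite bproj_mul//; split=> //.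
by rewrite bmulVK.
Qed.

(* Openness of [U] over the base makes saturations of open sets open. *)
Lemma coset_class_open : open_map (cls : H -> Q).
Proof.
move=> O oO; rewrite -[open _]/(open (cls @^-1` (cls @` O))).
rewrite openE => z [x Ox /coset_classP[pxz Uu]].
set u := inv x ** z in Uu; have pu : p u = p z by rewrite bproj_mul bproj_inv.
have zux : z ** inv u = x.
  by rewrite /u binvM ?bproj_inv// binvK bmulKV ?bproj_inv.
pose S := [set w : H * H | p w.1 = p w.2].
have W : \forall w \near within S (nbhs (z, u)), S w by apply: withinT; exact: nbhs_filter.
have FW := within_filter S (nbhs_filter (z, u)).
have c1 : fst @ within S (nbhs (z, u)) --> z.
  by apply: cvg_trans (cvg_app _ (cvg_within _)) _; exact: cvg_fst.
have c2 : snd @ within S (nbhs (z, u)) --> u.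
  by apply: cvg_trans (cvg_app _ (cvg_within _)) _; exact: cvg_snd.
have c3 : (fun w => w.1 ** inv w.2) @ within S (nbhs (z, u)) --> z ** inv u.
  apply: cvg_bmul => //; first by rewrite bproj_inv.
    by apply: filterS W => w; rewrite bproj_inv.
  exact: (cvg_binv c2).
have nO : nbhs (z ** inv u) O by rewrite zux; exact: open_nbhs_nbhs.
have h : \forall w \near within S (nbhs (z, u)), O (w.1 ** inv w.2) := c3 _ nO.
rewrite near_withinE in h; move: h => -[[A B] /= [Az Bu] AB].
pose u' : set_type (subbundle U) := SigSub (mem_set Uu).
have : nbhs (p u) (subbundle_proj (U := U) @` (set_val @^-1` B°)).
  apply: open_nbhs_nbhs; split; last by exists u'.
  by apply: U_open; exists B° => //; exact: open_interior.
rewrite pu => /(bproj_continuous (g := p)) nz.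
near=> z'.
have [v /= Bv pv] : (subbundle_proj (U := U) @` (set_val @^-1` B°)) (p z') by near: z'.
have Az' : A z' by near: z'.
have Uv : subbundle U (set_val v) := set_mem (valP v).
have pv' : p z' = p (set_val v) by rewrite -pv.
have Oz' : O (z' ** inv (set_val v)).
  by apply: (AB (z', set_val v)) => //; split=> //; exact: interior_subset.
exists (z' ** inv (set_val v)) => //.
by apply: coset_class_right; [exact: subbundle_inv|rewrite bproj_inv].
Unshelve. all: by end_near. Qed.

Lemma coset_proj_continuous : continuous (coset_proj (U := U)).
Proof.
apply/quotient_continuous.
rewrite (_ : _ \o _ = p); first exact: bproj_continuous.
by apply/funext => x; exact: coset_projE.
Qed.

Lemma coset_lift_continuous (Y : topologicalType) (f : H -> Y) (g : Q -> Y) :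
  continuous f -> (forall x, g (cls x) = f x) -> continuous g.
Proof.
move=> cf gf; apply/quotient_continuous.
by rewrite (_ : _ \o _ = f)//; apply/funext => x; exact: gf.
Qed.

(** Cosets over distinct base points are separated in [M]. In a common fibre [x^-1 y] avoids the
    closed set [U], and so it does for all composable pairs nearby; as the quotient map is open,
    this separates the cosets. *)
Lemma coset_space_compact_hausdorff : compact_hausdorff Q.
Proof.
have [cH hH] := bundle_space p; have [_ hM] := bundle_base p.
split.
  rewrite (_ : [set: Q] = cls @` setT).
    exact: (continuous_compact (continuous_subspaceT coset_class_continuous) cH).
  by apply/seteqP; split=> // z _; have [x <-] := coset_class_surj z; exists x.
rewrite open_hausdorff => z1 z2; have [x <-] := coset_class_surj z1.
have [y <-] := coset_class_surj z2 => /eqP xy.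
have [pxy|pxy] := pselect (p x = p y); last first.
  have /eqP := pxy; have := hM; rewrite open_hausdorff => /[apply].
  move=> [[A B]] /= [Ax By] [oA oB AB0].
  have op O : open O -> open (coset_proj (U := U) @^-1` O).
    by move=> oO; apply: open_comp => // ? _; exact: coset_proj_continuous.
  exists (coset_proj (U := U) @^-1` A, coset_proj (U := U) @^-1` B) => /=.
    by move: Ax By; rewrite !inE /= !coset_projE.
  split; [exact: op|exact: op|].
  by rewrite -preimage_setI (eqP AB0) preimage_set0.
have nU : ~ subbundle U (inv x ** y) by move=> Uxy; apply: xy; apply/coset_classP.
pose S := [set w : H * H | p w.1 = p w.2].
have W : \forall w \near within S (nbhs (x, y)), S w by apply: withinT; exact: nbhs_filter.
have FW := within_filter S (nbhs_filter (x, y)).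
have c1 : fst @ within S (nbhs (x, y)) --> x.
  by apply: cvg_trans (cvg_app _ (cvg_within _)) _; exact: cvg_fst.
have c2 : snd @ within S (nbhs (x, y)) --> y.
  by apply: cvg_trans (cvg_app _ (cvg_within _)) _; exact: cvg_snd.
have c3 : (fun w => inv w.1 ** w.2) @ within S (nbhs (x, y)) --> inv x ** y.
  apply: cvg_bmul => //; first by rewrite bproj_inv.
    by apply: filterS W => w; rewrite bproj_inv.
  exact: (cvg_binv c1).
have nU' : nbhs (inv x ** y) (~` subbundle U).
  by apply: open_nbhs_nbhs; split=> //; apply: closed_openC; exact: subbundle_closed.
have h : \forall w \near within S (nbhs (x, y)), ~ subbundle U (inv w.1 ** w.2) := c3 _ nU'.
rewrite near_withinE in h; move: h => -[[A B] /= [Ax By] AB].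
exists (cls @` A°, cls @` B°) => /=.
  by split; apply/mem_set; [exists x|exists y].
split; [exact/coset_class_open/open_interior|exact/coset_class_open/open_interior|].
apply/eqP; rewrite -subset0 => _ [[a Aa <-] [b Bb]] /esym/coset_classP[pab Uab].
by apply: (AB (a, b)) Uab => //; split; exact: interior_subset.
Qed.

Lemma coset_proj_open : open_map p -> open_map (coset_proj (U := U)).
Proof.
move=> op O oO; rewrite (_ : _ @` O = p @` (cls @^-1` O)).
  by apply: op; apply: open_comp => // ? _; exact: coset_class_continuous.
apply/seteqP; split=> m /=.
  move=> [z Oz <-]; have [x xz] := coset_class_surj z; exists x; rewrite ?xz//.
  by rewrite -xz coset_projE.
by move=> [x Ox <-]; exists (cls x) => //; exact: coset_projE.
Qed.

(** Openness of the quotient map provides representatives of [v t] near a given representative of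
    [b], where continuity of [bmul] applies. *)
Lemma cvg_coset_mul (T : Type) (F : set_system T) {FF : Filter F} (u : T -> H)
    (v : T -> Q) a b : p a = coset_proj b ->
  (\forall t \near F, p (u t) = coset_proj (v t)) ->
  u @ F --> a -> v @ F --> b -> (fun t => coset_mul (u t) (v t)) @ F --> coset_mul a b.
Proof.
have [x <-] := coset_class_surj b; rewrite coset_projE => ax uv ua vb.
rewrite coset_mulE// => O /coset_class_continuous => nO.
have /subspace_continuousP/(_ (a, x) ax) /= cm := @bmul_continuous _ _ p.
have h : \forall w \near within [set xy | p xy.1 = p xy.2] (nbhs (a, x)), O (cls (w.1 ** w.2)) := cm _ nO.
rewrite near_withinE in h; move: h => -[[A B] /= [Aa Bx] AB].
have nB : nbhs (cls x) (cls @` B°).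
  by apply: open_nbhs_nbhs; split; [exact/coset_class_open/open_interior | exists x].
have Fu : \forall t \near F, A (u t) by exact: ua.
have Fv : \forall t \near F, (cls @` B°) (v t) by exact: vb.
apply: filterS3 uv Fu Fv => t uvt Aut [y By yv]; rewrite /= -yv coset_mulE.
  by apply: (AB (u t, y)); [split=> //; exact: interior_subset | rewrite /= uvt -yv coset_projE].
by rewrite uvt -yv coset_projE.
Qed.

End coset_topology.

Section skew.
Variables (R : realType) (G : groupType) (L H : topologicalType).
Variables (psi : tds G L) (p : group_bundle (gelfand_fix R psi) H).
Variables (U : subgroup_bundle p) (c : rel_cocycle p).
Hypothesis hL : compact_hausdorff L.
Hypothesis p_open : open_map p.
Hypothesis U_open : open_map (subbundle_proj (U := U)).
Local Notation K := (skew_product U).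
Local Notation cls := (coset_class U).

Lemma cocycle_slice_continuous t : continuous (c t).
Proof.
move=> l.
have h := @cocycle_continuous R G L H psi p c (t : discrete_topology G, l).
pose pr (l : L) : discrete_topology G * L := (t, l).
apply: (@cvg_comp _ _ _ pr (fun tl : discrete_topology G * L => c tl.1 tl.2) _ (nbhs (pr l))) h.
move=> A [[A1 A2] /= [A1t A2l] A12]; apply: filterS A2l => l' A2l'.
by apply: A12; split=> //; exact: nbhs_singleton A1t.
Qed.

(** The cocycle lies over [q_fix], so its continuity at the time 1 suffices. *)
Lemma q_fix_continuous : continuous (q_fix R psi).
Proof.
rewrite (_ : q_fix R psi = p \o c 1%g); last first.
  by apply/funext => l /=; rewrite cocycle_proj.
move=> l; apply: continuous_comp; first exact: cocycle_slice_continuous.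
exact: bproj_continuous.
Qed.

(** By the cocycle identity it is an idempotent in a group. *)
Lemma cocycle1 l : c 1%g l = bone p (q_fix R psi l).
Proof.
have := cocycleM c 1%g 1%g l; rewrite mulg1 tds_act1 => E.
have := @bmulVK _ _ p (c 1%g l) (c 1%g l) erefl.
by rewrite -E bmulVx cocycle_proj.
Qed.

Lemma skew_productP (w : K) : q_fix R psi (val w).1 = coset_proj (val w).2.
Proof. exact: (set_mem (valP w)). Qed.

Lemma skew_val_continuous : continuous (val : K -> L * coset_space U).
Proof. exact: initial_continuous. Qed.

Lemma skew_fst_continuous : continuous (fun w : K => (val w).1).
Proof. by move=> w; apply: (cvg_comp val fst (skew_val_continuous (x := w))); exact: cvg_fst. Qed.

Lemma skew_snd_continuous : continuous (fun w : K => (val w).2).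
Proof. by move=> w; apply: (cvg_comp val snd (skew_val_continuous (x := w))); exact: cvg_snd. Qed.

Lemma skew_set_closed : closed (skew_set (U := U)).
Proof.
have [_ hM] := bundle_base p.
pose q1 (w : L * coset_space U) := q_fix R psi w.1.
pose q2 (w : L * coset_space U) := coset_proj w.2.
have c1 : continuous q1.
  by move=> w; apply: (cvg_comp fst (q_fix R psi) _ (q_fix_continuous (x := w.1))); exact: cvg_fst.
have c2 : continuous q2.
  move=> w; apply: (cvg_comp snd (coset_proj (U := U)) _ (coset_proj_continuous (x := w.2))).
  exact: cvg_snd.
rewrite -(setCK (skew_set (U := U))); apply: open_closedC; rewrite openE => w /= /eqP.
have := hM; rewrite open_hausdorff => /[apply] -[[A B]] /= [/set_mem Ax /set_mem By] [oA oB AB0].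
have nA := c1 w A (open_nbhs_nbhs (conj oA Ax)).
have nB := c2 w B (open_nbhs_nbhs (conj oB By)).
apply: filterS2 (nA : nbhs w (q1 @^-1` A)) (nB : nbhs w (q2 @^-1` B)) => w' /= A' B' e.
by have : (A `&` B) (q1 w') by [split=> //; rewrite /q1 e]; rewrite (eqP AB0).
Qed.

Lemma compact_hausdorff_prod_coset : compact_hausdorff (L * coset_space U)%type.
Proof.
have [cQ hQ] := coset_space_compact_hausdorff U_open; have [cL sL] := hL.
split; last exact: hausdorff_pair.
by rewrite -setXTT; exact: compact_setX.
Qed.

Lemma skew_product_compact_hausdorff : compact_hausdorff K.
Proof. exact: set_type_compact_hausdorff compact_hausdorff_prod_coset skew_set_closed. Qed.

Lemma skew_act_continuous t : continuous (skew_act (U := U) c t).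
Proof.
suff cv (w : K) : (fun w' : K => (psi t (val w').1, coset_mul (U := U) (c t (val w').1) (val w').2)) @ w -->
    (psi t (val w).1, coset_mul (U := U) (c t (val w).1) (val w).2).
  by apply: continuous_comp_initial => w; exact: cv.
have h1 : (fun w' : K => psi t (val w').1) @ w --> psi t (val w).1.
  apply: (cvg_comp (fun w : K => (val w).1) (psi t) (skew_fst_continuous (x := w))).
  by have [_ ct _] := tds_homeo psi t; exact: ct.
have h2 : (fun w' : K => coset_mul (U := U) (c t (val w').1) (val w').2) @ w -->
    coset_mul (U := U) (c t (val w).1) (val w).2.
  apply: (@cvg_coset_mul _ _ p U U_open K (nbhs w) (nbhs_filter w)).
  - by rewrite cocycle_proj skew_productP.
  - by apply: nearW => w'; rewrite cocycle_proj skew_productP.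
  - apply: (cvg_comp (fun w : K => (val w).1) (c t) (skew_fst_continuous (x := w))).
    exact: cocycle_slice_continuous.
  - exact: skew_snd_continuous.
move=> A [[A1 A2] /= [n1 n2] A12].
have n1' : \forall w' \near w, A1 (psi t (val w').1) := h1 _ n1.
have n2' : \forall w' \near w, A2 (coset_mul (U := U) (c t (val w').1) (val w').2) := h2 _ n2.
by apply: filterS2 n1' n2' => w' ? ?; exact: A12.
Qed.

Lemma skew_actM s t : skew_act (U := U) c (s * t)%g = skew_act (U := U) c s \o skew_act (U := U) c t.
Proof.
apply/funext => w; apply/val_inj => /=; congr pair.
  by rewrite tds_actM.
have [x xw] := coset_class_surj (val w).2; have := skew_productP w.
rewrite -xw coset_projE => qx.
rewrite !coset_mulE ?cocycle_proj// ?bproj_mul ?cocycle_proj ?q_fix_act//.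
by rewrite cocycleM bmulA// !cocycle_proj ?q_fix_act.
Qed.

Lemma skew_act1 w : skew_act (U := U) c 1%g w = w.
Proof.
apply/val_inj => /=; rewrite tds_act1 [RHS]surjective_pairing; congr pair.
have [x xw] := coset_class_surj (val w).2; have := skew_productP w.
rewrite -xw coset_projE => qx.
by rewrite coset_mulE ?cocycle_proj// cocycle1 qx bmul1x.
Qed.

Lemma skew_act_homeo t : homeomorphism (skew_act (U := U) c t).
Proof.
have K1 s : cancel (skew_act (U := U) c s) (skew_act (U := U) c s^-1%g).
  move=> w; rewrite -[LHS]/((skew_act (U := U) c s^-1%g \o skew_act (U := U) c s) w).
  by rewrite -skew_actM mulVg skew_act1.
have K2 : cancel (skew_act (U := U) c t^-1%g) (skew_act (U := U) c t) by have := K1 t^-1%g; rewrite invgK.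
split; [by exists (skew_act (U := U) c t^-1%g) | exact: skew_act_continuous|].
move=> O oO; rewrite (_ : _ @` O = skew_act (U := U) c t^-1%g @^-1` O).
  by apply: open_comp => // ? _; exact: skew_act_continuous.
apply/seteqP; split=> w /=; first by move=> [w' Ow' <-]; rewrite K1.
by move=> Ow; exists (skew_act (U := U) c t^-1%g w).
Qed.

Definition skew_tds : tds G K :=
  TDS skew_product_compact_hausdorff skew_act_homeo skew_actM.

Lemma skew_proj_continuous : continuous (@skew_proj _ _ _ _ _ _ U).
Proof. exact: skew_fst_continuous. Qed.

Lemma skew_proj_surj : range (mkcts skew_proj_continuous) = [set: L].
Proof.
apply/seteqP; split=> // l _.
have [x _ px] : range p (q_fix R psi l) by rewrite bproj_surj.
have w0 : (l, cls x) \in skew_set (U := U) by apply/mem_set; rewrite /skew_set /= coset_projE px.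
by exists (SigSub w0).
Qed.

Lemma skew_proj_equivariant t :
  mkcts skew_proj_continuous \o skew_tds t = psi t \o mkcts skew_proj_continuous.
Proof. by []. Qed.

Definition skew_extension : extension skew_tds psi :=
  Extension skew_proj_surj skew_proj_equivariant.

(** As [coset_proj] is open, the second coordinate can be adjusted to a nearby [l] within a given
    neighbourhood. *)
Lemma skew_proj_open : open_map skew_extension.
Proof.
move=> _ [V oV <-]; rewrite openE => _ [w /= Vw <-].
have : nbhs (val w) V by exact: open_nbhs_nbhs.
rewrite [val w]surjective_pairing => -[[A B] /= [Aw Bw] AB].
have nB : nbhs (q_fix R psi (val w).1) (coset_proj (U := U) @` B°).
  rewrite skew_productP; apply: open_nbhs_nbhs; split; last by exists (val w).2.
  by apply: coset_proj_open => //; exact: open_interior.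
have nB' : \forall l \near (val w).1, (coset_proj (U := U) @` B°) (q_fix R psi l).
  exact: q_fix_continuous nB.
have nA : \forall l \near (val w).1, A l by [].
apply: filterS2 nA nB' => l Al [z Bz zl].
have w0 : (l, z) \in skew_set (U := U) by apply/mem_set.
exists (SigSub w0) => //=; apply: AB; split=> //=; exact: interior_subset.
Qed.

End skew.

(** * Functions reproduced by an idempotent *)

Section real_continuous.
Variables (R : realType) (X : topologicalType) (f g : X -> R).
Hypotheses (cf : continuous f) (cg : continuous g).

Lemma continuous_sub : continuous (fun x => f x - g x).
Proof. by move=> x; apply: cvgB; [exact: cf|exact: cg]. Qed.

Lemma continuous_add : continuous (f \+ g).
Proof. by move=> x; apply: cvgD; [exact: cf|exact: cg]. Qed.

Lemma continuous_mul : continuous (fun x => f x * g x).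
Proof. by move=> x; apply: cvgM; [exact: cf|exact: cg]. Qed.

Lemma continuous_scale (a : R) : continuous (fun x => a * f x).
Proof. by move=> x; apply: cvgMr; exact: cf. Qed.

End real_continuous.

Lemma continuous_sum (R : realType) (X : topologicalType) (I : Type) (r : seq I) (F : I -> X -> R) :
  (forall i, continuous (F i)) -> continuous (fun x => \sum_(i <- r) F i x).
Proof. by move=> cF x; apply: cvg_big => [|i _]; [exact: add_continuous|exact: cF]. Qed.

Section reproducing.
Variables (R : realType) (G : groupType) (L H : topologicalType).
Variables (psi : tds G L) (p : group_bundle (gelfand_fix R psi) H).
Variables (U : subgroup_bundle p) (c : rel_cocycle p).
Hypothesis hL : compact_hausdorff L.
Hypothesis p_open : open_map p.
Hypothesis U_open : open_map (subbundle_proj (U := U)).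
Local Notation K := (skew_product U).
Local Notation cls := (coset_class U).
Local Notation "x ** y" := (bmul p x y) (at level 40, left associativity).
Local Notation inv := (binv p).
Local Notation mean := (mean (R := R) p).
Local Notation conv := (bundle_conv (R := R) p).
Local Notation q := (q_fix R psi).
Implicit Types (l : L) (x y z : H) (k : K) (f g : K -> R).

(** Means are taken of total functions on [H], so [f] is read on pairs of a point and a
    representative, with the default value 0 where they do not match. *)
Definition lift (V : zmodType) (f : K -> V) l x : V :=
  if pselect ((l, cls x) \in skew_set (U := U)) is left h then f (SigSub h) else 0.

Lemma liftE (V : zmodType) (f : K -> V) k x : (val k).2 = cls x -> lift f (val k).1 x = f k.
Proof.
move=> kx; rewrite /lift; case: pselect => [h|[]].
  by congr f; apply/val_inj => /=; rewrite -kx -surjective_pairing.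
by rewrite -kx -surjective_pairing; exact: valP.
Qed.

Lemma skew_point l x : q l = p x -> exists k, (val k).1 = l /\ (val k).2 = cls x.
Proof.
move=> lx; have h : (l, cls x) \in skew_set (U := U) by apply/mem_set; rewrite /skew_set /= coset_projE.
by exists (SigSub h).
Qed.

Lemma skew_point_repr k : exists x, (val k).2 = cls x /\ q (val k).1 = p x.
Proof.
have [x xk] := coset_class_surj (val k).2; exists x; split=> //.
by rewrite skew_productP -xk coset_projE.
Qed.

Lemma lift_fiber_continuous f : continuous f -> fiber_continuous p q (lift f).
Proof.
move=> cf l x lx A.
have [k [kl kx]] := skew_point lx.
rewrite -{1}kl (liftE _ kx) => /cf /= -[_ [[V oV <-] /= Vk VA]].
have : nbhs (val k) V by exact: open_nbhs_nbhs.
rewrite [val k]surjective_pairing kl kx => -[[A1 A2] /= [A1l A2x] A12].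
have A2x' := coset_class_continuous A2x.
exists (A1, cls @^-1` A2); first by split.
move=> [l' x'] /= [Al Ax] lx'; have [k' [kl' kx']] := skew_point lx'.
rewrite -kl' (liftE _ kx'); apply: VA => /=.
by rewrite -[set_val _]/(val k') [val k']surjective_pairing kl' kx'; exact: A12.
Qed.

Lemma fcont_lift f l : continuous f -> fcont p (q l) (lift f l).
Proof. by move=> cf; exact: (fcont_param (n := l) (lift_fiber_continuous cf)). Qed.

Lemma lift_norm_le f (B : R) l x : q l = p x -> (forall k, `|f k| <= B) -> `|lift f l x| <= B.
Proof. by move=> lx fB; have [k [<- kx]] := skew_point lx; rewrite (liftE _ kx). Qed.

(** Fibrewise pairings with [b], from which the coordinates of the dual basis are made. *)
Definition coef (b : H -> R) f l := mean (q l) (fun y => lift f l y * b y).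

Lemma coef_continuous b f : continuous b -> continuous f -> continuous (coef b f).
Proof.
move=> cb cf; apply: (mean_continuous p_open (th := q) (F := fun l y => lift f l y * b y)).
  exact: q_fix_continuous c.
move=> l x lx; apply: cvgM; first exact: lift_fiber_continuous.
apply: (cvg_comp snd b _ (cb x)).
by apply: cvg_trans (cvg_app _ (cvg_within _)) _; exact: cvg_snd.
Qed.

Lemma coefD b f g l : continuous b -> continuous f -> continuous g ->
  coef b (f \+ g) l = coef b f l + coef b g l.
Proof.
move=> cb cf cg; rewrite /coef -meanD; last 2 first.
- by apply: fcontM; [exact: fcont_lift|exact: fcontW].
- by apply: fcontM; [exact: fcont_lift|exact: fcontW].
apply: mean_eq => y py /=; have [k [kl ky]] := skew_point (esym py).
by rewrite -kl !(liftE _ ky) mulrDl.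
Qed.

Lemma coefZ b f (a : L -> R) l : continuous b -> continuous f ->
  coef b (fun k => a (val k).1 * f k) l = a l * coef b f l.
Proof.
move=> cb cf; rewrite /coef -meanZ; last first.
  by apply: fcontM; [exact: fcont_lift|exact: fcontW].
apply: mean_eq => y py /=; have [k [kl ky]] := skew_point (esym py).
by rewrite -kl !(liftE _ ky) mulrA.
Qed.

(** For right-invariant [e] the choice of the representative is immaterial, by [descendE]. *)
Definition descend (e : H -> R) k : R := e (repr (val k).2).

Lemma descendE e k x : right_invariant U e -> (val k).2 = cls x -> descend e k = e x.
Proof.
move=> eU kx; rewrite /descend kx; set r := repr _.
have /coset_classP[prx Urx] : cls r = cls x by rewrite /coset_class reprK.
by rewrite -[in RHS](bmulKV prx) eU// bproj_mul bproj_inv.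
Qed.

Lemma descend_continuous e : right_invariant U e -> continuous e -> continuous (descend e).
Proof.
move=> eU ce; have cq : continuous (fun z : coset_space U => e (repr z)).
  apply: (coset_lift_continuous ce) => x; set r := repr _.
  have /coset_classP[prx Urx] : cls r = cls x by rewrite /coset_class reprK.
  by rewrite -[in RHS](bmulKV prx) eU// bproj_mul bproj_inv.
by move=> k; apply: (cvg_comp (fun k => (val k).2) _ (skew_snd_continuous (x := k)) (cq _)).
Qed.

Section kernel.
Variable w : H -> R.
Hypotheses (w_cont : continuous w) (wU : right_invariant U w) (ww : conv w w = w).

Definition reproduced f := forall l x, q l = p x ->
  lift f l x = mean (q l) (fun y => lift f l y * w (inv y ** x)).

Lemma fcont_kernel l x f : q l = p x -> continuous f ->
  fcont p (q l) (fun y => lift f l y * w (inv y ** x)).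
Proof.
move=> lx cf; apply: fcontM; first exact: fcont_lift.
by apply: fcont_shift => //; exact: fcontW.
Qed.

Lemma reproducedD f g : continuous f -> continuous g -> reproduced f -> reproduced g ->
  reproduced (f \+ g).
Proof.
move=> cf cg rf rg l x lx; have [k [kl kx]] := skew_point lx.
have -> : lift (f \+ g) l x = lift f l x + lift g l x by rewrite -kl !(liftE _ kx).
rewrite rf// rg// -meanD; [|exact: fcont_kernel..].
apply: mean_eq => y py /=; have [k' [kl' ky']] := skew_point (esym py).
by rewrite -kl' !(liftE _ ky') mulrDl.
Qed.

Lemma reproducedZ (a : L -> R) f : continuous f -> reproduced f ->
  reproduced (fun k => a (val k).1 * f k).
Proof.
move=> cf rf l x lx; have [k [kl kx]] := skew_point lx.
have -> : lift (fun k => a (val k).1 * f k) l x = a l * lift f l x by rewrite -kl !(liftE _ kx).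
rewrite rf// -meanZ; last exact: fcont_kernel.
apply: mean_eq => y py /=; have [k' [kl' ky']] := skew_point (esym py).
by rewrite -kl' !(liftE _ ky') mulrA.
Qed.

Lemma reproduced0 : reproduced (fun=> 0).
Proof.
move=> l x lx; have [k [kl kx]] := skew_point lx.
have -> : lift (fun=> 0 : R) l x = 0 by rewrite -kl (liftE _ kx).
rewrite -[LHS](mean_cst p (q l)); apply: mean_eq => y py.
have [k' [kl' ky']] := skew_point (esym py).
by rewrite -kl' (liftE _ ky') mul0r.
Qed.

Lemma reproducedB f g : continuous f -> continuous g -> reproduced f -> reproduced g ->
  reproduced (fun k => f k - g k).
Proof.
move=> cf cg rf rg.
rewrite (_ : (fun k => f k - g k) = f \+ (fun k => (fun=> -1) (val k).1 * g k)); last first.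
  by apply/funext => k /=; rewrite mulN1r.
apply: reproducedD => //; last exact: (@reproducedZ (fun=> -1) g cg rg).
exact: (@continuous_scale _ _ g cg).
Qed.

Let w_bounded : exists2 B, 0 <= B & forall x, `|w x| <= B.
Proof. exact: continuous_bounded_compact (bundle_space p).1 w_cont. Qed.

Lemma reproduced_mean_le l x f (B W : R) : q l = p x -> continuous f -> 0 <= B ->
  (forall k, `|f k| <= B) -> (forall x, `|w x| <= W) ->
  `|mean (q l) (fun y => lift f l y * w (inv y ** x))| <= B * W.
Proof.
move=> lx cf B0 fB wW; apply: mean_norm_le; first exact: fcont_kernel.
move=> y py; rewrite normrM ler_pM//.
by apply: lift_norm_le => //; rewrite py.
Qed.

Lemma reproduced_limit f : continuous f ->
  (forall e : R, 0 < e -> exists g, [/\ continuous g, reproduced g & forall k, `|f k - g k| <= e]) ->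
  reproduced f.
Proof.
move=> cf H1 l x lx; have [W W0 wW] := w_bounded.
have W1 : 0 < W + 1 by rewrite ltr_wpDl.
apply: le_distP => e e0; have e1 : 0 < e / (W + 1) by rewrite divr_gt0.
have [g [cg rg fg]] := H1 _ e1.
have cfg : continuous (fun k => f k - g k).
  exact: (continuous_sub cf cg).
have [k [kl kx]] := skew_point lx.
have E : mean (q l) (fun y => lift f l y * w (inv y ** x)) = lift g l x +
    mean (q l) (fun y => lift (fun k => f k - g k) l y * w (inv y ** x)).
  rewrite rg// -meanD; [|exact: fcont_kernel..].
  apply: mean_eq => y py /=; have [k' [kl' ky']] := skew_point (esym py).
  by rewrite -kl' !(liftE _ ky') -mulrDl addrC subrK.
rewrite E opprD addrA.
have -> : lift f l x - lift g l x = f k - g k by rewrite -kl !(liftE _ kx).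
rewrite (le_trans (ler_normB _ _))//.
have h1 := reproduced_mean_le lx cfg (ltW e1) fg wW.
have h2 := fg k.
have : e / (W + 1) + e / (W + 1) * W = e by field; rewrite gt_eqF.
lra.
Qed.

Lemma reproduced_descend a : continuous a -> reproduced (descend (conv a w)).
Proof.
move=> ca l x lx; have [k [kl kx]] := skew_point lx.
have cU : right_invariant U (conv a w) by exact: right_invariant_conv.
have -> : lift (descend (conv a w)) l x = conv a w x.
  by rewrite -kl (liftE _ kx) (descendE cU kx).
rewrite -[in LHS]ww bundle_convA// {1}/bundle_conv -lx.
apply: mean_eq => y py; have [k' [kl' ky']] := skew_point (esym py).
by rewrite -kl' (liftE _ ky') (descendE cU ky').
Qed.

(** The action translates a fibre from the left by [c t l]; neither [y^-1 x] nor the mean changes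
    when [x] and [y] are translated together. *)
Lemma reproduced_koopman t f : continuous f -> reproduced f ->
  reproduced (f \o skew_act (U := U) c t).
Proof.
move=> cf rf l x lx.
have E y : q l = p y -> lift (f \o skew_act (U := U) c t) l y = lift f (psi t l) (c t l ** y).
  move=> ly; have [k [kl ky]] := skew_point ly.
  rewrite -{1}kl (liftE _ ky) /= -kl.
  have -> : psi t (val k).1 = (val (skew_act (U := U) c t k)).1 by [].
  rewrite liftE//= ky coset_mulE// cocycle_proj kl//.
have pcx : p (c t l ** x) = p x by rewrite bproj_mul cocycle_proj.
rewrite E// rf ?q_fix_act ?pcx//.
have pc : p (c t l) = q l by rewrite cocycle_proj.
have cF : fcont p (q l) (fun y => lift f (psi t l) y * w (inv y ** (c t l ** x))).
  by rewrite -(q_fix_act R psi t l); apply: fcont_kernel; rewrite ?q_fix_act ?pcx.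
rewrite -(mean_left cF pc); apply: mean_eq => y py.
rewrite E ?py//; congr (_ * w _).
have cy : p (c t l) = p y by rewrite pc py.
rewrite binvM// -bmulA ?bproj_inv ?pcx -?lx ?pc ?py//.
by rewrite bmulVK// pc.
Qed.

End kernel.

(** The kernel lives on the closed fibre product; Tietze's theorem extends it to the full product,
    where tensors approximate it. *)
Lemma tensor_kernel (w : H -> R) (e : R) : continuous w -> 0 < e ->
  exists (s : seq H) (a b : H -> H -> R), [/\ forall i, continuous (a i), forall i, continuous (b i)
    & forall y z, p y = p z -> `|w (inv y ** z) - \sum_(i <- s) b i y * a i z| <= e].
Proof.
move=> cw e0; have hH := bundle_space p.
have hHH : compact_hausdorff (H * H)%type.
  split; last exact: hausdorff_pair hH.2 hH.2.
  by rewrite -setXTT; exact: compact_setX hH.1 hH.1.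
pose D := [set yz : H * H | p yz.1 = p yz.2].
have cD : closed D.
  have [_ hM] := bundle_base p.
  rewrite -(setCK D); apply: open_closedC; rewrite openE => -[y z] /= /eqP.
  have := hM; rewrite open_hausdorff => /[apply] -[[A B]] /= [/set_mem Ax /set_mem By] [oA oB AB0].
  exists (p @^-1` A, p @^-1` B).
    by split; apply: (bproj_continuous (g := p)); exact: open_nbhs_nbhs.
  move=> [y' z'] /= [A' B'] e'.
  by have : (A `&` B) (p y') by [split=> //; rewrite e']; rewrite (eqP AB0).
have cK : {within D, continuous (fun yz : H * H => w (inv yz.1 ** yz.2))}.
  apply/subspace_continuousP => -[y z] /= yz.
  have W : \forall v \near within D (nbhs (y, z)), D v by apply: withinT; exact: nbhs_filter.
  have FW := within_filter D (nbhs_filter (y, z)).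
  have c1 : fst @ within D (nbhs (y, z)) --> y.
    by apply: cvg_trans (cvg_app _ (cvg_within _)) _; exact: cvg_fst.
  have c2 : snd @ within D (nbhs (y, z)) --> z.
    by apply: cvg_trans (cvg_app _ (cvg_within _)) _; exact: cvg_snd.
  apply: (cvg_comp (fun v => inv v.1 ** v.2) w _ (cw _)).
  apply: cvg_bmul => //; first by rewrite bproj_inv.
    by apply: filterS W => v; rewrite bproj_inv.
  exact: (cvg_binv c1).
have [g cg gE] := tietze_compact hHH cD cK.
have [s [b [cb Hb]]] := tensor_approx hH hH.1 cg e0.
exists s, (fun i z => g (i, z)), b; split=> //.
  move=> i z; apply: (@cvg_comp _ _ _ (fun z => (i, z)) g _ (nbhs (i, z))) (cg (i, z)).
  by apply: cvg_pair; [exact: cvg_cst | exact: cvg_id].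
by move=> y z yz; rewrite -(gE (y, z))//; exact: Hb.
Qed.


Section finite_rank.
Variables (w : H -> R) (s : seq H) (a b : H -> H -> R) (W eta : R).
Hypotheses (w_cont : continuous w) (wU : right_invariant U w) (ww : conv w w = w).
Hypotheses (a_cont : forall i, continuous (a i)) (b_cont : forall i, continuous (b i)).
Hypotheses (w_le : forall x, `|w x| <= W) (W_ge0 : 0 <= W) (eta_ge0 : 0 <= eta).
Hypothesis etaW : eta * W <= 1 / 2.
Hypothesis kernel_approx : forall y z, p y = p z ->
  `|w (inv y ** z) - \sum_(i <- s) b i y * a i z| <= eta.

(** Convolution with [w] makes the values of [finite_rank] reproduced functions. *)
Definition generator i : K -> R := descend (conv (a i) w).

Definition finite_rank f : K -> R :=
  fun k => \sum_(i <- s) coef (b i) f (val k).1 * generator i k.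

Let conv_aU i : right_invariant U (conv (a i) w).
Proof. exact: right_invariant_conv. Qed.

Lemma generator_continuous i : continuous (generator i).
Proof. by apply: descend_continuous => //; exact: conv_continuous. Qed.

Lemma finite_rank_continuous f : continuous f -> continuous (finite_rank f).
Proof.
move=> cf; apply: continuous_sum => i; apply: continuous_mul; last exact: generator_continuous.
move=> k; apply: (cvg_comp (fun k => (val k).1) _ (skew_fst_continuous (x := k))).
exact: coef_continuous.
Qed.

Lemma finite_rank_reproduced f : continuous f -> reproduced w (finite_rank f).
Proof.
move=> cf; rewrite /finite_rank.
elim: s => [|i s' IH].
  rewrite (_ : (fun k => _) = (fun=> 0)); first exact: reproduced0.
  by apply/funext => k; rewrite big_nil.
have cg := generator_continuous (i := i).
have ck : continuous (fun k : K => coef (b i) f (val k).1 * generator i k).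
  apply: continuous_mul => //.
  move=> k; apply: (cvg_comp (fun k => (val k).1) _ (skew_fst_continuous (x := k))).
  exact: coef_continuous.
rewrite (_ : (fun k => _) = (fun k => coef (b i) f (val k).1 * generator i k) \+
   (fun k => \sum_(i <- s') coef (b i) f (val k).1 * generator i k)); last first.
  by apply/funext => k; rewrite big_cons.
apply: reproducedD => //.
  apply: continuous_sum => j; apply: continuous_mul; last exact: generator_continuous.
  move=> k'; apply: (cvg_comp (fun k => (val k).1) _ (skew_fst_continuous (x := k'))).
  exact: coef_continuous.
apply: (@reproducedZ w w_cont (coef (b i) f) (generator i)) => //.
exact: reproduced_descend.
Qed.

Lemma finite_rankB f g : continuous f -> continuous g ->
  finite_rank (fun k => f k - g k) = fun k => finite_rank f k - finite_rank g k.
Proof.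
move=> cf cg; apply/funext => k; rewrite /finite_rank -sumrB; apply: eq_bigr => i _.
rewrite -mulrBl; congr (_ * _).
rewrite (_ : (fun k => f k - g k) = f \+ (fun k => (fun=> -1) (val k).1 * g k)); last first.
  by apply/funext => k' /=; rewrite mulN1r.
rewrite coefD//; last exact: (continuous_scale cg).
by rewrite (@coefZ _ g (fun=> -1))// mulN1r.
Qed.

(** Since [f] is reproduced, the difference is the convolution with [w] of [d], the error of the
    tensor kernel alone. That error is at most [B * eta], and [eta * W <= 1 / 2]. *)
Lemma finite_rank_contract f B : continuous f -> reproduced w f ->
  (forall k, `|f k| <= B) -> forall k, `|f k - finite_rank f k| <= B / 2.
Proof.
move=> cf rf fB k; have B0 : 0 <= B by exact: le_trans (fB k).
have [x [kx lx]] := skew_point_repr k; set l := (val k).1 in lx.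
pose d z := lift f l z - \sum_(i <- s) coef (b i) f l * a i z.
have cd : fcont p (q l) d.
  apply: (fcontD (f := lift f l) (g := fun z => - \sum_(i <- s) coef (b i) f l * a i z)).
    exact: fcont_lift.
  by apply: fcontN; apply: fcont_sum => i; apply: fcontZ; exact: fcontW.
have dB z : p z = q l -> `|d z| <= B * eta.
  move=> pz.
  have c1 : fcont p (q l) (fun y => lift f l y * w (inv y ** z)) by exact: fcont_kernel.
  have c2 i : fcont p (q l) (fun y => a i z * (lift f l y * b i y)).
    by apply: fcontZ; apply: fcontM; [exact: fcont_lift|exact: fcontW].
  have -> : d z = mean (q l) (fun y => lift f l y * (w (inv y ** z) - \sum_(i <- s) b i y * a i z)).
    rewrite /d rf//.
    have -> : \sum_(i <- s) coef (b i) f l * a i z =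
        mean (q l) (fun y => \sum_(i <- s) a i z * (lift f l y * b i y)).
      rewrite mean_sum//; apply: eq_bigr => i _; rewrite meanZ 1?mulrC//.
      by apply: fcontM; [exact: fcont_lift|exact: fcontW].
    rewrite -meanN; last exact: fcont_sum.
    rewrite -meanD//; last by apply: fcontN; exact: fcont_sum.
    apply: mean_eq => y py /=; rewrite mulrBr mulr_sumr; congr (_ - _).
    by apply: eq_bigr => i _; ring.
  apply: mean_norm_le.
    apply: fcontM; first exact: fcont_lift.
    apply: (fcontD (f := fun y => w (inv y ** z)) (g := fun y => - \sum_(i <- s) b i y * a i z)).
      by apply: fcont_shift => //; exact: fcontW.
    apply: fcontN; apply: fcont_sum => i.
    by apply: (fcontM (f := b i) (g := fun=> a i z)); [exact: fcontW|exact: fcont_cst].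
  move=> y py; rewrite normrM ler_pM//; first by apply: lift_norm_le; rewrite ?py.
  by apply: kernel_approx; rewrite py.
have -> : f k - finite_rank f k = mean (q l) (fun z => d z * w (inv z ** x)).
  have -> : f k = lift f l x by rewrite (liftE _ kx).
  rewrite rf//.
  have -> : finite_rank f k = mean (q l) (fun z => \sum_(i <- s) coef (b i) f l * (a i z * w (inv z ** x))).
    rewrite mean_sum; last first.
      by move=> i; apply: fcontZ; rewrite lx; exact: fcont_conv.
    apply: eq_bigr => i _; rewrite meanZ; last by rewrite lx; exact: fcont_conv.
    by rewrite /generator (descendE _ kx)// /bundle_conv -lx.
  rewrite -meanN; last first.
    by apply: fcont_sum => i; apply: fcontZ; rewrite lx; exact: fcont_conv.
  rewrite -meanD; first last.
  - by apply: fcontN; apply: fcont_sum => i; apply: fcontZ; rewrite lx; exact: fcont_conv.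
  - exact: fcont_kernel.
  apply: mean_eq => z pz /=; rewrite /d mulrBl mulr_suml; congr (_ - _).
  by apply: eq_bigr => i _; ring.
apply: (@le_trans _ _ (B * eta * W)).
  apply: mean_norm_le.
    by apply: fcontM => //; apply: fcont_shift => //; exact: fcontW.
  by move=> z pz; rewrite normrM ler_pM//; exact: dB.
by rewrite -mulrA ler_wpM2l// -[2^-1]mul1r.
Qed.

Lemma skew_bounded f : continuous f -> exists2 B, 0 <= B & forall k, `|f k| <= B.
Proof.
apply: continuous_bounded_compact.
exact: (skew_product_compact_hausdorff c hL U_open).1.
Qed.

Let small (C e : R) : 0 < e -> exists n, C / 2 ^+ n <= e.
Proof.
move=> e0; have : (fun n => C * 2^-1 ^+ n) @ \oo --> C * 0.
  by apply: cvgMr; apply: cvg_expr; rewrite ger0_norm// invf_lt1// ltr1n.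
rewrite mulr0 => /cvgr0_norm_le/(_ e e0)[n _ /(_ n (leqnn n))] /= H1.
by exists n; rewrite (le_trans (ler_norm _))// -exprVn.
Qed.

(** When the image vanishes, [finite_rank_contract] halves any bound for [f]. *)
Lemma finite_rank_inj f : continuous f -> reproduced w f ->
  (forall k, finite_rank f k = 0) -> forall k, f k = 0.
Proof.
move=> cf rf f0 k; have [B B0 fB] := skew_bounded cf.
have K n : forall k, `|f k| <= B / 2 ^+ n.
  elim: n => [|n IH] k'; first by rewrite expr0 divr1.
  by have := finite_rank_contract cf rf IH k'; rewrite f0 subr0 exprSr invfM mulrA.
apply: le_distP => e e0; rewrite subr0; have [n ne] := small B e0.
exact: le_trans (K n k) ne.
Qed.

(* Neumann series: [g = sum_n (1 - finite_rank)^n f]. *)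
Lemma finite_rank_surj f : continuous f -> reproduced w f ->
  exists g, [/\ continuous g, reproduced w g & finite_rank g = f].
Proof.
move=> cf rf; have [B B0 fB] := skew_bounded cf.
pose u := fix u n := if n is n'.+1 then (fun k => f k + (u n' k - finite_rank (u n') k)) else f.
have uc n : continuous (u n).
  elim: n => [//|n IH]; apply: continuous_add => //; apply: continuous_sub => //.
  exact: finite_rank_continuous.
have ur n : reproduced w (u n).
  elim: n => [//|n IH]; apply: (@reproducedD w w_cont f (fun k => u n k - finite_rank (u n) k)) => //.
    by apply: continuous_sub => //; exact: finite_rank_continuous.
  apply: reproducedB => //; first exact: finite_rank_continuous.
  exact: finite_rank_reproduced.
have uB n : forall k, `|u n.+1 k - u n k| <= (B / 2) / 2 ^+ n.
  elim: n => [|n IH] k.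
    have -> : u 1%N k - u 0%N k = f k - finite_rank f k by rewrite /=; ring.
    by rewrite expr0 divr1; exact: finite_rank_contract.
  have cu := continuous_sub (uc n.+1) (uc n).
  have ru : reproduced w (fun k => u n.+1 k - u n k) by exact: reproducedB.
  have := finite_rank_contract cu ru IH k.
  rewrite finite_rankB// -mulrA -invfM -exprSr.
  congr (`|_| <= _); rewrite /=; ring.
have [g cg gE] := geometric_limit uc uB.
have rg : reproduced w g.
  apply: reproduced_limit => // e e0; have [n ne] := small (2 * (B / 2)) e0.
  by exists (u n); split=> // k; exact: le_trans (gE n k) ne.
exists g; split=> //; apply/funext => k; apply: le_distP => e e0.
have e2 : 0 < e / 2 by rewrite divr_gt0.
have [n ne] := small (2 * (B / 2)) (divr_gt0 e2 (ltr0n R 2)).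
have hn k' : `|g k' - u n k'| <= e / 2 / 2 by exact: le_trans (gE n k') ne.
have cgu := continuous_sub cg (uc n).
have rgu : reproduced w (fun k => g k - u n k) by exact: reproducedB.
have h1 := finite_rank_contract cgu rgu hn k.
rewrite finite_rankB// in h1.
have h2 := le_trans (gE n.+1 k) (le_trans (_ : 2 * (B / 2) / 2 ^+ n.+1 <= 2 * (B / 2) / 2 ^+ n) ne).
have h3 : 2 * (B / 2) / 2 ^+ n.+1 <= 2 * (B / 2) / 2 ^+ n.
  rewrite ler_wpM2l ?mulr_ge0// ?divr_ge0// lef_pV2 ?posrE ?exprn_gt0//.
  by rewrite exprS ler_peMl ?exprn_ge0// ler1n.
have {h2}h2 := h2 h3.
have E : u n.+1 k = f k + (u n k - finite_rank (u n) k) by [].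
move: h1 h2; rewrite E !ler_norml => /andP[? ?] /andP[? ?]; apply/andP; split; lra.
Qed.

End finite_rank.

End reproducing.

(** * Finitely generated projective submodules *)

Section complex_functions.
Variables (R : realType) (X : topologicalType).
Local Notation C := (cplx R).
Implicit Types F : cfun R X.

Definition mk_cplx (u v : R) : C := Complex u v.

Definition real_part F : X -> R := fun x => re (F x).
Definition imag_part F : X -> R := fun x => im (F x).

Lemma real_part_continuous F : continuous (real_part F).
Proof. by move=> x; apply: (@cvg_re _ _ _ (nbhs_filter x)); exact: cfun_continuous. Qed.

Lemma imag_part_continuous F : continuous (imag_part F).
Proof. by move=> x; apply: (@cvg_im _ _ _ (nbhs_filter x)); exact: cfun_continuous. Qed.

Lemma mk_cplx_continuous (u v : X -> R) :
  continuous u -> continuous v -> continuous (fun x => mk_cplx (u x) (v x)).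
Proof. by move=> cu cv x; apply: (@cvg_cplx _ _ _ (nbhs_filter x)); [exact: cu|exact: cv]. Qed.

Lemma cfun_sumE (I : Type) (r : seq I) (Q : I -> cfun R X) x :
  (\sum_(i <- r) Q i) x = \sum_(i <- r) Q i x.
Proof. by apply: (big_morph (fun f : cfun R X => f x)). Qed.

End complex_functions.

Section fgp.
Variables (R : realType) (G : groupType) (L H : topologicalType).
Variables (psi : tds G L) (p : group_bundle (gelfand_fix R psi) H).
Variables (U : subgroup_bundle p) (c : rel_cocycle p).
Hypothesis hL : compact_hausdorff L.
Hypothesis p_open : open_map p.
Hypothesis U_open : open_map (subbundle_proj (U := U)).
Local Notation C := (cplx R).
Local Notation K := (skew_product U).
Local Notation cls := (coset_class U).
Local Notation "x ** y" := (bmul p x y) (at level 40, left associativity).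
Local Notation inv := (binv p).
Local Notation conv := (bundle_conv (R := R) p).
Local Notation q := (q_fix R psi).
Local Notation qe := (skew_extension c hL U_open).
Implicit Types (l : L) (x y z : H) (k : K) (F : cfun R K).

(** Since [w] is real, the complex reproducing identity splits into its real and imaginary parts. *)
Definition reproduced_module (w : H -> R) : set (cfun R K) :=
  [set F | reproduced w (real_part F) /\ reproduced w (imag_part F)].

Lemma base_mul_continuous (u : L -> R) (f : K -> R) : continuous u -> continuous f ->
  continuous (fun k => u (val k).1 * f k).
Proof.
move=> cu cf; apply: continuous_mul => // k.
by apply: (cvg_comp (fun k => (val k).1) u (skew_fst_continuous (x := k))); exact: cu.
Qed.

Section kernel.
Variable w : H -> R.
Hypotheses (w_cont : continuous w) (wU : right_invariant U w) (ww : conv w w = w).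

(** Functions on [L] are constants for the fibrewise mean; complex multiplication only combines the
    two real identities. *)
Lemma reproduced_scale (a : cfun R L) F : reproduced_module w F ->
  reproduced_module w ((a *: (F : pullback_module R qe)) : cfun R K).
Proof.
move=> [rF iF].
have cr := @real_part_continuous R K F; have ci := @imag_part_continuous R K F.
have ca1 := @real_part_continuous R L a; have ca2 := @imag_part_continuous R L a.
have ca3 : continuous (fun l => - im (a l)).
  by move=> l; apply: cvgN; exact: ca2.
split.
- rewrite (_ : real_part _ = (fun k => re (a (val k).1) * real_part F k) \+
    (fun k => (- im (a (val k).1)) * imag_part F k)).
    apply: reproducedD => //.
    - exact: (@base_mul_continuous (fun l => re (a l))).
    - exact: (@base_mul_continuous (fun l => - im (a l))).
    - exact: (@reproducedZ _ _ _ _ _ _ _ w w_cont (fun l => re (a l)) _ cr rF).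
    - exact: (@reproducedZ _ _ _ _ _ _ _ w w_cont (fun l => - im (a l)) _ ci iF).
  by apply/funext => k; rewrite /real_part /= -[_ k]/(a (val k).1 * F k) reM mulNr.
- rewrite (_ : imag_part _ = (fun k => re (a (val k).1) * imag_part F k) \+
    (fun k => im (a (val k).1) * real_part F k)).
    apply: reproducedD => //.
    - exact: (@base_mul_continuous (fun l => re (a l))).
    - exact: (@base_mul_continuous (fun l => im (a l))).
    - exact: (@reproducedZ _ _ _ _ _ _ _ w w_cont (fun l => re (a l)) _ ci iF).
    - exact: (@reproducedZ _ _ _ _ _ _ _ w w_cont (fun l => im (a l)) _ cr rF).
  by apply/funext => k; rewrite /imag_part /= -[_ k]/(a (val k).1 * F k) imM.
Qed.

Lemma reproduced_add F F' : reproduced_module w F -> reproduced_module w F' ->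
  reproduced_module w (F + F').
Proof.
move=> [rF iF] [rF' iF']; split.
- rewrite (_ : real_part _ = real_part F \+ real_part F'); last by apply/funext => k; exact: reD.
  by apply: reproducedD => //; exact: real_part_continuous.
- rewrite (_ : imag_part _ = imag_part F \+ imag_part F'); last by apply/funext => k; exact: imD.
  by apply: reproducedD => //; exact: imag_part_continuous.
Qed.

Lemma reproduced_submodule : submodule (reproduced_module w : set (pullback_module R qe)).
Proof.
split.
  by split; (rewrite (_ : _ (0 : cfun R K) = fun=> 0); [exact: reproduced0 | by apply/funext]).
by move=> a u v Su Sv; apply: reproduced_add => //; exact: reproduced_scale.
Qed.

Lemma reproduced_closed : closed (reproduced_module w).
Proof.
move=> F clF.
have near_F (e : R) : 0 < e -> exists2 F', reproduced_module w F' &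
    forall k, `|real_part F k - real_part F' k| <= e /\ `|imag_part F k - imag_part F' k| <= e.
  move=> e0; have e0' : 0 < ofR e by rewrite (ofR_lt 0).
  have [|F' [SF' FF']] := clF [set F' | forall k, `|F k - F' k| < ofR e].
    by apply/nbhs_cfunP; exists (ofR e).
  exists F' => // k; have h := FF' k.
  have := le_lt_trans (re_norm_le _) h; have := le_lt_trans (im_norm_le _) h.
  by rewrite !ofR_lt reB imB => /ltW h1 /ltW h2.
split; apply: reproduced_limit => //; [exact: real_part_continuous| |exact: imag_part_continuous|].
- move=> e e0; have [F' [rF' _] FF'] := near_F e e0.
  by exists (real_part F'); split=> //; [exact: real_part_continuous|move=> k; have [] := FF' k].
- move=> e e0; have [F' [_ rF'] FF'] := near_F e e0.
  by exists (imag_part F'); split=> //; [exact: imag_part_continuous|move=> k; have [] := FF' k].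
Qed.

Lemma reproduced_koopman_invariant (phi : tds G K) :
  (forall t k, phi t k = skew_act (U := U) c t k) -> koopman_invariant phi (reproduced_module w).
Proof.
move=> phiE t F [rF iF]; split.
- rewrite (_ : real_part _ = real_part F \o skew_act (U := U) c t^-1%g); last first.
    by apply/funext => k; rewrite /= -phiE.
  by apply: reproduced_koopman => //; exact: real_part_continuous.
- rewrite (_ : imag_part _ = imag_part F \o skew_act (U := U) c t^-1%g); last first.
    by apply/funext => k; rewrite /= -phiE.
  by apply: reproduced_koopman => //; exact: imag_part_continuous.
Qed.

Section dual_basis.
Variables (s : seq H) (a b : H -> H -> R) (W eta : R).
Hypotheses (a_cont : forall i, continuous (a i)) (b_cont : forall i, continuous (b i)).
Hypothesis w_le : forall x, `|w x| <= W.
Hypothesis etaW : eta * W <= 1 / 2.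
Hypothesis kernel_approx : forall y z, p y = p z ->
  `|w (inv y ** z) - \sum_(i <- s) b i y * a i z| <= eta.

Local Notation V := (pullback_module R qe).
Let rank1 := finite_rank (U := U) w s a b.

Let gen_cont i : continuous (generator (U := U) w a i).
Proof. exact: generator_continuous. Qed.

Definition cgenerator i : V := cfun_of (ofR_continuous (@gen_cont i)).

Let ccoef_cont i F : continuous (fun l =>
  mk_cplx (coef (b i) (real_part F) l) (coef (b i) (imag_part F) l)).
Proof.
apply: mk_cplx_continuous; apply: (coef_continuous c) => //.
- exact: real_part_continuous.
- exact: imag_part_continuous.
Qed.

Definition ccoef i F : cfun R L := cfun_of (@ccoef_cont i F).

Definition cfinite_rank (F : V) : V := \sum_(i <- s) ccoef i F *: cgenerator i.

Lemma real_cfinite_rank F : real_part (cfinite_rank F) = rank1 (real_part F).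
Proof.
apply/funext => k; rewrite /real_part /cfinite_rank cfun_sumE.
rewrite (big_morph (@re R) (id1 := 0) (op1 := +%R) (@reD R))//.
apply: eq_bigr => i _.
rewrite -[X in re X]/(ccoef i F (val k).1 * ofR (generator (U := U) w a i k)).
by rewrite reM /= mulr0 subr0.
Qed.

Lemma imag_cfinite_rank F : imag_part (cfinite_rank F) = rank1 (imag_part F).
Proof.
apply/funext => k; rewrite /imag_part /cfinite_rank cfun_sumE.
rewrite (big_morph (@im R) (id1 := 0) (op1 := +%R) (@imD R))//.
apply: eq_bigr => i _.
rewrite -[X in im X]/(ccoef i F (val k).1 * ofR (generator (U := U) w a i k)).
by rewrite imM /= mulr0 add0r.
Qed.

Lemma ccoef_linear i (e : cfun R L) (F F' : V) :
  ccoef i (e *: F + F') = e * ccoef i F + ccoef i F'.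
Proof.
have ce1 := @real_part_continuous R L e; have ce2 := @imag_part_continuous R L e.
have ce3 : continuous (fun l => - im (e l)) by move=> l'; apply: cvgN; exact: ce2.
apply: cfunP => l; apply: cplxP.
- rewrite -[LHS]/(coef (b i) (real_part (e *: F + F' : V)) l).
  rewrite -[X in _ = re X]/(e l * ccoef i F l + ccoef i F' l).
  rewrite reD reM /=.
  rewrite (_ : real_part _ = (fun k => re (e (val k).1) * real_part F k) \+
     ((fun k => - im (e (val k).1) * imag_part F k) \+ real_part F')); last first.
    apply/funext => k; rewrite /real_part /= -[_ k]/(e (val k).1 * F k + F' k) reD reM mulNr.
    by rewrite addrA.
  rewrite coefD//; last 2 first.
  - by apply: (@base_mul_continuous (fun l => re (e l))) => //; exact: real_part_continuous.
  - apply: continuous_add; last exact: real_part_continuous.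
    by apply: (@base_mul_continuous (fun l => - im (e l))) => //; exact: imag_part_continuous.
  rewrite coefD//; last 2 first.
  - by apply: (@base_mul_continuous (fun l => - im (e l))) => //; exact: imag_part_continuous.
  - exact: real_part_continuous.
  rewrite (@coefZ _ _ _ _ _ _ _ _ _ (fun l => re (e l)))//; last exact: real_part_continuous.
  rewrite (@coefZ _ _ _ _ _ _ _ _ _ (fun l => - im (e l)))//; last exact: imag_part_continuous.
  by rewrite mulNr addrA.
- rewrite -[LHS]/(coef (b i) (imag_part (e *: F + F' : V)) l).
  rewrite -[X in _ = im X]/(e l * ccoef i F l + ccoef i F' l).
  rewrite imD imM /=.
  rewrite (_ : imag_part _ = (fun k => re (e (val k).1) * imag_part F k) \+
     ((fun k => im (e (val k).1) * real_part F k) \+ imag_part F')); last first.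
    apply/funext => k; rewrite /imag_part /= -[_ k]/(e (val k).1 * F k + F' k) imD imM.
    by rewrite addrA.
  rewrite coefD//; last 2 first.
  - by apply: (@base_mul_continuous (fun l => re (e l))) => //; exact: imag_part_continuous.
  - apply: continuous_add; last exact: imag_part_continuous.
    by apply: (@base_mul_continuous (fun l => im (e l))) => //; exact: real_part_continuous.
  rewrite coefD//; last 2 first.
  - by apply: (@base_mul_continuous (fun l => im (e l))) => //; exact: real_part_continuous.
  - exact: imag_part_continuous.
  rewrite (@coefZ _ _ _ _ _ _ _ _ _ (fun l => re (e l)))//; last exact: imag_part_continuous.
  rewrite (@coefZ _ _ _ _ _ _ _ _ _ (fun l => im (e l)))//; last exact: real_part_continuous.
  by rewrite addrA.
Qed.

Lemma cfinite_rank_linear (e : cfun R L) (F F' : V) :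
  cfinite_rank (e *: F + F') = e *: cfinite_rank F + cfinite_rank F'.
Proof.
rewrite /cfinite_rank scaler_sumr -big_split; apply: eq_bigr => i _.
by rewrite ccoef_linear scalerDl scalerA.
Qed.

Lemma cfinite_rank_surj F : reproduced_module w F -> exists F' : V,
  reproduced_module w F' /\ cfinite_rank F' = F.
Proof.
move=> [rF iF].
have [u [cu ru uE]] := finite_rank_surj c hL p_open U_open w_cont wU ww a_cont b_cont w_le etaW
  kernel_approx (@real_part_continuous R K F) rF.
have [v [cv rv vE]] := finite_rank_surj c hL p_open U_open w_cont wU ww a_cont b_cont w_le etaW
  kernel_approx (@imag_part_continuous R K F) iF.
pose F' : V := cfun_of (mk_cplx_continuous cu cv).
have reF' : real_part F' = u by [].
have imF' : imag_part F' = v by [].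
exists F'; split; first by split.
apply: cfunP => k; apply: cplxP.
  by rewrite -[LHS]/(real_part (cfinite_rank F') k) real_cfinite_rank /rank1 reF' uE.
by rewrite -[LHS]/(imag_part (cfinite_rank F') k) imag_cfinite_rank /rank1 imF' vE.
Qed.

Lemma cfinite_rank_inj (F : V) : reproduced_module w F -> cfinite_rank F = 0 -> F = 0.
Proof.
move=> [rF iF] F0; apply: cfunP => k; apply: cplxP.
  apply: (finite_rank_inj c hL U_open w_cont wU a_cont b_cont w_le etaW
    kernel_approx (@real_part_continuous R K F) rF) => k'.
  by rewrite -[LHS]/(rank1 (real_part F) k') -real_cfinite_rank F0.
apply: (finite_rank_inj c hL U_open w_cont wU a_cont b_cont w_le etaW
    kernel_approx (@imag_part_continuous R K F) iF) => k'.
by rewrite -[LHS]/(rank1 (imag_part F) k') -imag_cfinite_rank F0.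
Qed.

Local Notation S := (reproduced_module w : set V).

Lemma cgenerator_reproduced i : S (cgenerator i).
Proof.
split; first exact: (reproduced_descend p_open w_cont wU ww (@a_cont i)).
rewrite (_ : imag_part _ = fun=> 0); first exact: reproduced0.
exact/funext.
Qed.

Lemma reproduced_submodule_sum (I : Type) (r : seq I) (e : I -> cfun R L) (Q : I -> V)
    (T : set V) : submodule T -> (forall i, T (Q i)) -> T (\sum_(i <- r) e i *: Q i).
Proof.
move=> [T0 TZ] TQ; elim: r => [|i r IH]; first by rewrite big_nil.
by rewrite big_cons; exact: TZ.
Qed.

(** [cfinite_rank] maps the module onto itself, and its values are combinations of the
    generators. *)
Lemma reproduced_finitely_generated : finitely_generated S.
Proof.
exists [set cgenerator i | i in [set` s]]; first exact/finite_image/finite_seq.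
apply/seteqP; split=> [F SF T [Tsub TX]|F HF].
  have [F' [_ <-]] := cfinite_rank_surj SF; rewrite /cfinite_rank big_seq.
  apply: (big_ind T) => [|u v Tu Tv|i si]; first exact: Tsub.1.
    by rewrite -(scale1r u); exact: Tsub.2.
  by rewrite -(addr0 (_ *: _)); apply: Tsub.2; [apply: TX; exists i|exact: Tsub.1].
apply: HF; split; first exact: reproduced_submodule.
by move=> _ [i _ <-]; exact: cgenerator_reproduced.
Qed.

Lemma linear_on_sum (N : lmodType (cfun R L)) (f : V -> N) (I : Type) (r : seq I)
    (e : I -> cfun R L) (Q : I -> V) : linear_on S f -> (forall i, S (Q i)) ->
  f (\sum_(i <- r) e i *: Q i) = \sum_(i <- r) e i *: f (Q i).
Proof.
move=> fl SQ; have S0 : S 0 by exact: reproduced_submodule.1.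
have f0 : f 0 = 0.
  have := fl 1 0 0 S0 S0; rewrite scaler0 addr0 scale1r => /eqP.
  by rewrite -subr_eq subrr => /eqP <-.
elim: r => [|i r IH]; first by rewrite !big_nil.
rewrite !big_cons fl// ?IH//.
exact: (reproduced_submodule_sum r e reproduced_submodule SQ).
Qed.

(* The dual basis lemma, with coordinates [ccoef i] of the preimage under
   [cfinite_rank]. *)
Lemma reproduced_projective : projective S.
Proof.
move=> M N g f gsurj fl.
have /choice[pre preP] : forall F : V, exists F' : V, S F -> S F' /\ cfinite_rank F' = F.
  move=> F; have [SF|SF] := pselect (S F); last by exists 0.
  by have [F' ?] := cfinite_rank_surj SF; exists F'.
have /choice[m mE] : forall i : H, exists y : M, g y = f (cgenerator i).
  move=> i; have : range g (f (cgenerator i)) by rewrite gsurj.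
  by move=> [y _ <-]; exists y.
have [S0 SZ] := reproduced_submodule.
(* The choice of preimages is linear because they are unique in [S], by [cfinite_rank_inj]. *)
have pre_linear e (F F' : V) : S F -> S F' -> pre (e *: F + F') = e *: pre F + pre F'.
  move=> SF SF'; have [h1 h1'] := preP F SF; have [h2 h2'] := preP F' SF'.
  have [h3 h3'] := preP _ (SZ e F F' SF SF').
  have h4 := SZ e _ _ h1 h2.
  apply/eqP; rewrite -subr_eq0; apply/eqP; apply: cfinite_rank_inj.
    by have := SZ (- 1) _ _ h4 h3; rewrite scaleN1r addrC.
  have := cfinite_rank_linear (-1) (e *: pre F + pre F') (pre (e *: F + F')).
  rewrite (cfinite_rank_linear e (pre F)) h1' h2' h3' !scaleN1r addNr => <-.
  by rewrite addrC.
exists (fun F => \sum_(i <- s) ccoef i (pre F) *: m i).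
  move=> e F F' SF SF'; rewrite pre_linear// scaler_sumr -big_split; apply: eq_bigr => i _.
  by rewrite ccoef_linear scalerDl scalerA.
move=> F SF; have [h1 h2] := preP F SF.
rewrite -[in RHS]h2 /cfinite_rank linear_on_sum//; last exact: cgenerator_reproduced.
rewrite linear_sum; apply: eq_bigr => i _.
by rewrite linearZ /= mE.
Qed.

End dual_basis.

Lemma reproduced_fgp : fgp_submodule qe (reproduced_module w).
Proof.
have [W W0 wW] := continuous_bounded_compact (bundle_space p).1 w_cont.
have e0 : 0 < (2 * (W + 1))^-1 :> R by rewrite invr_gt0 mulr_gt0// ltr_wpDl.
have [s [a [b [ca cb ab]]]] := tensor_kernel p w_cont e0.
have eW : (2 * (W + 1))^-1 * W <= 1 / 2.
  rewrite mulrC ler_pdivrMr ?mulr_gt0 ?ltr_wpDl//; lra.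
split.
- exact: reproduced_submodule.
- exact: (reproduced_finitely_generated ca cb wW eW ab).
- exact: (reproduced_projective ca cb wW eW ab).
- exact: reproduced_closed.
- by apply: reproduced_koopman_invariant.
Qed.

End kernel.
End fgp.

(** * Density *)

Lemma lin_span_submodule (A : pzRingType) (V : lmodType A) (X : set V) :
  submodule (lin_span X).
Proof.
split; first by move=> T [[T0 _] _].
by move=> a u v Xu Xv T HT; apply: HT.1.2; [exact: Xu|exact: Xv].
Qed.

Section density.
Variables (R : realType) (G : groupType) (L H : topologicalType).
Variables (psi : tds G L) (p : group_bundle (gelfand_fix R psi) H).
Variables (U : subgroup_bundle p) (c : rel_cocycle p).
Hypothesis L_stonean : stonean L.
Hypothesis p_open : open_map p.
Hypothesis U_open : open_map (subbundle_proj (U := U)).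
Local Notation C := (cplx R).
Local Notation K := (skew_product U).
Local Notation cls := (coset_class U).
Local Notation conv := (bundle_conv (R := R) p).
Local Notation q := (q_fix R psi).
Local Notation hL := (L_stonean.1).
Local Notation qe := (skew_extension c L_stonean.1 U_open).
Local Notation span := (lin_span (fgp_union R qe)).
Implicit Types (l : L) (k : K) (f g : K -> R).

(** Tensor approximation works on the full product, in which the skew product is closed. *)
Lemma tietze_skew f : continuous f ->
  exists2 F : L * coset_space U -> R, continuous F & forall k, F (val k) = f k.
Proof.
move=> cf; pose D := skew_set (U := U).
pose F0 lz : R := if pselect (D lz) is left lzD then f (SigSub (mem_set lzD)) else 0.
have F0E k : F0 (val k) = f k.
  rewrite /F0; case: pselect => [kD|]; last by have := skew_productP k.
  by congr f; exact: val_inj.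
have cF0 : {within D, continuous F0}.
  apply/subspace_continuousP => lz lzD; pose k : K := SigSub (mem_set lzD).
  rewrite (_ : from_subspace D F0 lz = f k); last exact: (F0E k).
  move=> A /(cf k)[B [[B' oB' <-] B'k B'A]].
  apply: (@filterS _ _ (nbhs_filter lz) B').
    move=> y B'y yD; have := B'A (SigSub (mem_set yD)) B'y.
    by rewrite /= -F0E.
  exact: open_nbhs_nbhs.
have [F cF FE] :=
  tietze_compact (compact_hausdorff_prod_coset hL U_open) (skew_set_closed c) cF0.
by exists F => // k; rewrite FE ?F0E//; exact: skew_productP.
Qed.

Definition in_span f := exists2 F, span F & forall k, F k = ofR (f k).

Definition approximable f := forall e : R, 0 < e ->
  exists2 g, in_span g & forall k, `|f k - g k| <= e.

Lemma in_spanD f g : in_span f -> in_span g -> in_span (fun k => f k + g k).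
Proof.
move=> [F SF FE] [F' SF' FE']; exists (F + F').
  by rewrite -(scale1r F); exact: (lin_span_submodule _).2.
by move=> k; rewrite -[LHS]/(F k + F' k) FE FE'; apply: cplxP; rewrite ?reD ?imD//= addr0.
Qed.

Lemma in_span_sum (I : Type) (r : seq I) (Q : I -> K -> R) :
  (forall i, in_span (Q i)) -> in_span (fun k => \sum_(i <- r) Q i k).
Proof.
move=> SQ; elim: r => [|i r IH].
  by exists 0; [exact: (lin_span_submodule _).1|move=> k; rewrite big_nil].
rewrite (_ : (fun k => _) = fun k => Q i k + \sum_(j <- r) Q j k); first exact: in_spanD.
by apply/funext => k; rewrite big_cons.
Qed.

Lemma approximable_limit f : (forall e : R, 0 < e ->
  exists2 g, approximable g & forall k, `|f k - g k| <= e) -> approximable f.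
Proof.
move=> Hf e e0; have e20 : 0 < e / 2 by rewrite divr_gt0.
have [g Sg fg] := Hf _ e20; have [g' Sg' gg'] := Sg _ e20; exists g' => // k.
rewrite (_ : f k - g' k = (f k - g k) + (g k - g' k)); last by rewrite addrA subrK.
by rewrite (le_trans (ler_normD _ _))// (splitr e) lerD.
Qed.

Lemma approximableD f g : approximable f -> approximable g ->
  approximable (fun k => f k + g k).
Proof.
move=> Sf Sg e e0; have e20 : 0 < e / 2 by rewrite divr_gt0.
have [f' Sf' ff'] := Sf _ e20; have [g' Sg' gg'] := Sg _ e20.
exists (fun k => f' k + g' k) => [|k]; first exact: in_spanD.
by rewrite opprD addrACA (le_trans (ler_normD _ _))// (splitr e) lerD.
Qed.

Lemma approximable_sum (I : Type) (r : seq I) (Q : I -> K -> R) :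
  (forall i, approximable (Q i)) -> approximable (fun k => \sum_(i <- r) Q i k).
Proof.
move=> SQ; elim: r => [|i r IH] e e0.
  exists (fun k => \sum_(i <- [::]) Q i k) => [|k]; last by rewrite subrr normr0 ltW.
  by exists 0; [exact: (lin_span_submodule _).1|move=> k; rewrite big_nil].
have [g Sg fg] := approximableD (SQ i) IH e0.
by exists g => // k; rewrite big_cons.
Qed.

(** The function belongs to the module of [w]: a convolution by [w] is reproduced, and the module is
    stable under functions on [L]. *)
Lemma in_span_generator (a : L -> R) (h w : H -> R) :
  continuous a -> continuous h -> continuous w -> right_invariant U w -> conv w w = w ->
  in_span (fun k => a (val k).1 * descend (conv h w) k).
Proof.
move=> ca ch cw wU ww.
have cd : continuous (descend (U := U) (conv h w)).
  by apply: descend_continuous; [exact: right_invariant_conv|exact: conv_continuous].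
have cad : continuous (fun k : K => a (val k).1 * descend (conv h w) k).
  exact: base_mul_continuous.
exists (cfun_of (ofR_continuous cad)) => //.
move=> T [_ TX]; apply: TX.
exists (reproduced_module w); first exact: reproduced_fgp.
split.
  rewrite -[real_part _]/(fun k : K => a (val k).1 * descend (conv h w) k).
  exact: (reproducedZ cw a cd (reproduced_descend p_open cw wU ww ch)).
by rewrite (_ : imag_part _ = fun=> 0); [exact: reproduced0 | apply/funext].
Qed.

(** The idempotents that suit [g] are local in [M]; a partition of unity on [M], pulled back to [L],
    glues the approximations. The summands may belong to different modules, whence the span. *)
Lemma approximable_tensor (a : L -> R) (g : H -> R) :
  continuous a -> continuous g -> right_invariant U g ->
  approximable (fun k => a (val k).1 * descend g k).
Proof.
move=> ca cg gU e e0.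
have [A A0 aA] := continuous_bounded_compact hL.1 ca.
have e'0 : 0 < e / (A + 1) by rewrite divr_gt0// ltr_wpDl.
have hM := bundle_base p.
have base m B := gelfand_fix_clopen_base L_stonean hM (m := m) (A := B).
have /choice[V /choice[h /choice[w HV]]] := fun m => local_idempotent p_open base m cg gU e'0.
have nV m : nbhs m (V m) by have [] := HV m.
have [s [phi [cphi phi0 phiV phi1]]] := partition_of_unity R hM nV.
exists (fun k =>
  \sum_(m <- s) (a (val k).1 * phi m (q (val k).1)) * descend (conv (h m) (w m)) k).
  apply: in_span_sum => m; have [_ ch [cw wU ww] _] := HV m.
  apply: (in_span_generator (a := fun l => a l * phi m (q l))) => //.
  apply: continuous_mul => // l.
  by apply: (cvg_comp q (phi m) (q_fix_continuous c (x := l))); exact: cphi.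
move=> k; have [x [kx qk]] := skew_point_repr k.
rewrite (descendE gU kx).
rewrite (_ : _ - _ =
  a (val k).1 * \sum_(m <- s) phi m (p x) * (g x - conv (h m) (w m) x)); last first.
  rewrite mulr_sumr -[X in _ * X - _]mul1r -(phi1 (p x)) mulr_suml mulr_sumr -sumrB qk.
  apply: eq_bigr => m _; have [_ _ [_ wU _] _] := HV m.
  rewrite (descendE (right_invariant_conv _ wU) kx); ring.
rewrite normrM.
have -> : e = (A + 1) * (e / (A + 1)) by rewrite mulrCA mulfV ?mulr1// gt_eqF// ltr_wpDl.
apply: ler_pM => //; first by rewrite (le_trans (aA _))// lerDl.
rewrite (le_trans (ler_norm_sum _ _ _))// -[leRHS]mul1r -[X in _ <= X * _](phi1 (p x)) mulr_suml.
apply: ler_sum => m _; rewrite normrM ger0_norm//.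
have [->|/phiV Vx] := eqVneq (phi m (p x)) 0; first by rewrite !mul0r.
by rewrite ler_wpM2l// distrC; have [_ _ _] := HV m; apply.
Qed.

(** Slices of the extended function are constant on cosets, so as functions on [H] they are right
    invariant. *)
Lemma continuous_approximable f : continuous f -> approximable f.
Proof.
move=> /tietze_skew[F cF FE]; apply: approximable_limit => e e0.
have [s [a [ca Fa]]] := tensor_approx hL (coset_space_compact_hausdorff U_open).1 cF e0.
exists (fun k => \sum_(i <- s) a i (val k).1 * descend (fun x => F (i, cls x)) k); last first.
  move=> k; rewrite -FE.
  have -> : val k = ((val k).1, (val k).2) by case: (val k).
  have := Fa (val k).1 (val k).2; congr (`|_ - _| <= _); apply: eq_bigr => i _.
  by have [x [kx _]] := skew_point_repr k; rewrite /descend /coset_class reprK.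
apply: approximable_sum => i; apply: approximable_tensor => // [x|x u Uu pxu].
  apply: (cvg_comp (fun x => (i, cls x)) F (G := nbhs (i, cls x))); last exact: cF.
  apply: (@cvg_pair _ _ _ (nbhs x) (nbhs i) (nbhs (cls x)) _ (nbhs_filter _) (nbhs_filter _)).
    exact: cvg_cst.
  exact: coset_class_continuous.
by rewrite coset_class_right.
Qed.

Lemma fgp_union_total : dense span.
Proof.
move=> O [F OF] oO.
have /nbhs_cfunP[e' e'0 eO] : nbhs F O by exact: open_nbhs_nbhs.
have [e e0 eE] := cplx_pos e'0; have e40 : 0 < e / 4 by rewrite divr_gt0.
have [u [U1 SU1 UE] Fu] := continuous_approximable (@real_part_continuous R K F) e40.
have [v [V1 SV1 VE] Fv] := continuous_approximable (@imag_part_continuous R K F) e40.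
(* [Complex 0 1] is the imaginary unit; the errors of the two parts add up to [e / 2]. *)
exists ((Complex 0 1 : C) *: V1 + U1); split; last exact: (lin_span_submodule _).2.
apply: eO => k; rewrite -[X in `|_ - X|]/((Complex 0 1 : C) * V1 k + U1 k) UE VE eE.
apply: le_lt_trans (norm_le_re_im _) _; rewrite ofR_lt.
rewrite reB imB reD imD reM imM /= !mul0r !mul1r !subr0 !addr0 ?add0r.
rewrite (@le_lt_trans _ _ (e / 4 + e / 4))//; first exact: lerD (Fu k) (Fv k).
lra.
Qed.

(** A closed subspace that contains [fgp_union] contains the closure of its span. *)
Lemma fgp_union_generates : smallest (@Cstar_subalgebra R K) (fgp_union R qe) = setT.
Proof.
apply/seteqP; split=> // F _ B [[Bsub _ _ Bcl] fgpB].
apply: Bcl => O FO; have O0 : O° !=set0 by exists F; exact: nbhs_singleton (nbhs_interior FO).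
have [F' [OF' SF']] := fgp_union_total O0 (@open_interior _ O).
by exists F'; split; [apply: SF'|exact: interior_subset].
Qed.

End density.

Theorem theorem4p7 (R : realType) (G : groupType)
    (L : topologicalType) (psi : tds G L)
    (H : topologicalType) (p : group_bundle (gelfand_fix R psi) H)
    (U : subgroup_bundle p) (c : rel_cocycle p) :
  stonean L ->
  open_map p ->
  open_map (subbundle_proj (U := U)) ->
  exists (phi : tds G (skew_product U)) (q : extension phi psi),
    [/\ (forall t w, phi t w = skew_act c t w),
        (forall w, q w = skew_proj w),
        open_map q,
        dense (lin_span (fgp_union R q))
      & rel_discrete_spectrum R q].
Proof.
move=> L_stonean p_open U_open.
exists (skew_tds c L_stonean.1 U_open), (skew_extension c L_stonean.1 U_open).
have q_open : open_map (skew_extension c L_stonean.1 U_open) by exact: skew_proj_open.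
split=> //; first exact: fgp_union_total.
by split=> //; exact: fgp_union_generates.
Qed.
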